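(* Let $\mathcal{H}$ be an infinite-dimensional, complex, separable Hilbert space and let $T \in \mathcal{B}(\mathcal{H})$. The following conditions are equivalent. (a) $T$ has property (CN). (b) One of the following holds: (i) there exist $\lambda, \mu \in \mathbb{C}$ and $L = L^* \in \mathcal{B}(\mathcal{H})$ such that $T = \lambda I + \mu L$; (ii) there exist $\lambda, \mu \in \mathbb{C}$ with $\mu \ne 0$ and a unitary operator $U \in \mathcal{B}(\mathcal{H})$ with $\sigma_e(U) \subseteq \mathbb{T} \cap \{ z \in \mathbb{C} : \mathrm{Re}(z) \ge 0 \}$ such that $T = \lambda I + \mu U$.
   Context: $\mathcal{B}(\mathcal{H})$ is the algebra of bounded linear operators on $\mathcal{H}$. A projection means an orthogonal projection, and $P^\perp = I - P$. $T$ has the common norm property (CN) if $\|P T P^\perp\| = \|P^\perp T P\|$ (operator norm) for every projection $P \in \mathcal{B}(\mathcal{H})$. $\mathbb{T} = \{z \in \mathbb{C} : |z| = 1\}$. The essential spectrum $\sigma_e(U)$ is the spectrum of the image of $U$ in the Calkin algebra $\mathcal{B}(\mathcal{H})/\mathcal{K}(\mathcal{H})$, where $\mathcal{K}(\mathcal{H})$ is the ideal of compact operators. *)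

(* Defs.v *)
From HB Require Import structures.
From mathcomp Require Import all_boot all_order all_algebra generic_quotient ring_quotient.
From mathcomp Require Import sesquilinear.
From mathcomp Require Import all_classical reals topology normedtype.
From mathcomp Require Import complex.

Set Implicit Arguments.
Unset Strict Implicit.
Unset Printing Implicit Defensive.

Import Order.TTheory GRing.Theory Num.Theory.
Import numFieldNormedType.Exports.
Local Open Scope classical_set_scope.
Local Open Scope ring_scope.
Local Open Scope quotient_scope.

Section BoundedOperators.
Variables (K : numFieldType) (V : normedModType K).

Definition bounded_linear : {pred V -> V} :=
  [pred f : V -> V |
    `[< linear f /\ exists M : K, forall x, `|f x| <= M * `|x| >]].

Record bounded_op := BoundedOp {
  bounded_op_fun :> V -> V;
  bounded_opP : bounded_op_fun \in bounded_linear }.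

HB.instance Definition _ := [isSub for bounded_op_fun].
HB.instance Definition _ := [Choice of bounded_op by <:].

Lemma bounded_linear_submod_closed : submod_closed bounded_linear.
Proof.
split=> [|a f g /asboolP[lf [M fM]] /asboolP[lg [N gN]]]; apply/asboolP.
  split=> [c x y|]; first by rewrite scaler0 addr0.
  by exists 0 => x; rewrite normr0 mul0r.
split=> [c x y|].
  rewrite /= !fctE /= lf lg !scalerDr !scalerA (mulrC a c) -!addrA.
  by congr (_ + _); rewrite addrCA.
exists (`|a| * M + N) => x; rewrite /= !fctE /=.
rewrite (le_trans (ler_normD _ _))// normrZ mulrDl -mulrA.
by rewrite lerD// ler_wpM2l.
Qed.
HB.instance Definition _ :=
  GRing.isSubmodClosed.Build K (V -> V) bounded_linear
    bounded_linear_submod_closed.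
HB.instance Definition _ :=
  [SubChoice_isSubLmodule of bounded_op by <:].

Lemma bounded_op_linear (T : bounded_op) : linear T.
Proof. by have /asboolP[] := bounded_opP T. Qed.
HB.instance Definition _ (T : bounded_op) :=
  GRing.isLinear.Build K V V *:%R T (bounded_op_linear T).

Lemma bounded_op_inj (S T : bounded_op) : (forall x, S x = T x) -> S = T.
Proof. by move=> ST; apply/val_inj/funext. Qed.

Lemma bounded_op_bound (T : bounded_op) :
  exists2 M : K, 0 < M & forall x, `|T x| <= M * `|x|.
Proof.
have /asboolP[_ [M fM]] := bounded_opP T; exists (`|M| + 1).
  by rewrite ltr_wpDl.
move=> x; have := fM x; have [->|x0 h] := eqVneq x 0.
  by rewrite normr0 !mulr0.
apply: le_trans h _; rewrite ler_wpM2r//.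
have M0 : 0 <= M.
  by rewrite -(pmulr_lge0 _ (_ : 0 < `|x|)) ?normr_gt0// (le_trans _ (fM x)).
by rewrite ger0_norm// lerDl.
Qed.

Lemma bounded_linear_id : idfun \in bounded_linear.
Proof. by apply/asboolP; split=> //; exists 1 => x; rewrite mul1r. Qed.

Lemma bounded_linear_comp (S T : bounded_op) : S \o T \in bounded_linear.
Proof.
apply/asboolP; split=> [c x y|]; first by rewrite /= !linearP.
have [M M0 SM] := bounded_op_bound S; have [N N0 TN] := bounded_op_bound T.
exists (M * N) => x; rewrite /= (le_trans (SM _))// -mulrA.
by rewrite ler_wpM2l// ltW.
Qed.

Definition op_id := BoundedOp bounded_linear_id.
Definition op_comp (S T : bounded_op) := BoundedOp (bounded_linear_comp S T).

Lemma op_compA : associative op_comp.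
Proof. by move=> S T U; exact: bounded_op_inj. Qed.
Lemma op_comp1l : left_id op_id op_comp.
Proof. by move=> S; exact: bounded_op_inj. Qed.
Lemma op_comp1r : right_id op_id op_comp.
Proof. by move=> S; exact: bounded_op_inj. Qed.
Lemma op_compDl : left_distributive op_comp +%R.
Proof. by move=> S T U; exact: bounded_op_inj. Qed.
Lemma op_compDr : right_distributive op_comp +%R.
Proof. by move=> S T U; apply: bounded_op_inj => x; exact: raddfD. Qed.

(* Multiplication in B(V) is composition.  The ring may be zero (when V = 0),
   hence pzRingType, and so no lalgType instance. *)
HB.instance Definition _ := GRing.Zmodule_isPzRing.Build bounded_op
  op_compA op_comp1l op_comp1r op_compDl op_compDr.

Lemma bounded_op_continuous (T : bounded_op) : continuous T.
Proof.
apply: bounded_linear_continuous; apply/linear_boundedP.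
have [M M0 TM] := bounded_op_bound T.
near=> r => x; rewrite (le_trans (TM x))// ler_wpM2r//.
by near: r; apply: nbhs_pinfty_ge; rewrite gtr0_real.
Unshelve. all: by end_near. Qed.

Definition unit_ball : set V := [set x | `|x| <= 1].

Definition compact_op : {pred bounded_op} :=
  [pred T : bounded_op | `[< precompact (T @` unit_ball) >]].

Lemma compact_sub (A B : set V) : compact B -> A `<=` B -> precompact A.
Proof.
move=> cB AB; exists B => //; split=> //.
by apply: compact_closed => //; exact: norm_hausdorff.
Qed.

Lemma compact_op_zmod_closed : zmod_closed compact_op.
Proof.
split=> [|S T /asboolP[A SA [cA _]] /asboolP[B TB [cB _]]]; apply/asboolP.
  by apply: (compact_sub (@compact_set1 _ 0)) => _ [x _ <-].
apply: (@compact_sub _ ((fun z : V * V => z.1 - z.2) @` (A `*` B))).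
  apply: continuous_compact; last exact: compact_setX.
  apply: continuous_subspaceT => z.
  by apply: cvgB; [exact: cvg_fst|exact: cvg_snd].
move=> _ [x x1 <-]; exists (S x, T x) => //; split.
- by apply: SA; exists x.
- by apply: TB; exists x.
Qed.

HB.instance Definition _ :=
  GRing.isZmodClosed.Build bounded_op compact_op compact_op_zmod_closed.

Lemma compact_op_comp_l (S T : bounded_op) :
  T \in compact_op -> S * T \in compact_op.
Proof.
move=> /asboolP[A TA [cA _]]; apply/asboolP; apply: (@compact_sub _ (S @` A)).
  apply: continuous_compact => //.
  exact/continuous_subspaceT/bounded_op_continuous.
by move=> _ [x x1 <-]; exists (T x) => //; apply: TA; exists x.
Qed.

Lemma compact_op_comp_r (S T : bounded_op) :
  S \in compact_op -> S * T \in compact_op.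
Proof.
move=> /asboolP[A SA [cA _]]; apply/asboolP.
have [M M0 TM] := bounded_op_bound T.
apply: (@compact_sub _ ((fun y : V => M *: y) @` A)).
  apply: continuous_compact => //.
  exact/continuous_subspaceT/scaler_continuous.
move=> _ [x x1 <-]; exists (S (M^-1 *: T x)) => [|/=].
  apply: SA; exists (M^-1 *: T x) => //; rewrite /unit_ball /= normrZ normfV.
  rewrite gtr0_norm// ler_pdivrMl// mulr1 (le_trans (TM x))//.
  by rewrite ler_piMr// ltW.
by rewrite linearZ scalerA divff ?gt_eqF// scale1r.
Qed.

(* The library only provides the ring structure on {ideal_quot I} when the base
   ring is commutative, so it is built here, together with the scaling. *)
Definition calkin := {ideal_quot compact_op}.

HB.instance Definition _ := GRing.Zmodule.on calkin.
HB.instance Definition _ := EqQuotient.on calkin.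

Definition calkin_pi (T : bounded_op) : calkin := \pi_calkin T.
Definition calkin_one : calkin := calkin_pi 1.
Definition calkin_mul (a b : calkin) : calkin := calkin_pi (repr a * repr b).

Lemma calkin_piE (S T : bounded_op) :
  calkin_pi S = calkin_pi T <-> S - T \in compact_op.
Proof.
by rewrite Quotient.idealrBE; split=> /eqP.
Qed.

Lemma calkin_piK (a : calkin) : calkin_pi (repr a) = a.
Proof. exact: reprK. Qed.

Lemma calkin_piM (S T : bounded_op) :
  calkin_pi (S * T) = calkin_mul (calkin_pi S) (calkin_pi T).
Proof.
rewrite /calkin_mul; set S' := repr _; set T' := repr _.
have /calkin_piE SS' : calkin_pi S = calkin_pi S' by rewrite calkin_piK.
have /calkin_piE TT' : calkin_pi T = calkin_pi T' by rewrite calkin_piK.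
apply/calkin_piE; rewrite -[S * T](addrNK (S * T')) -mulrBr -addrA -mulrBl.
by apply: rpredD; [exact: compact_op_comp_l|exact: compact_op_comp_r].
Qed.

Lemma calkin_piD (S T : bounded_op) :
  calkin_pi (S + T) = calkin_pi S + calkin_pi T.
Proof. exact: (raddfD \pi_calkin). Qed.

Lemma calkin_mulA : associative calkin_mul.
Proof.
move=> a b c; rewrite -[a]calkin_piK -[b]calkin_piK -[c]calkin_piK.
by rewrite -!calkin_piM mulrA.
Qed.
Lemma calkin_mul1l : left_id calkin_one calkin_mul.
Proof. by move=> a; rewrite -[a]calkin_piK -calkin_piM mul1r. Qed.
Lemma calkin_mul1r : right_id calkin_one calkin_mul.
Proof. by move=> a; rewrite -[a]calkin_piK -calkin_piM mulr1. Qed.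
Lemma calkin_mulDl : left_distributive calkin_mul +%R.
Proof.
move=> a b c; rewrite -[a]calkin_piK -[b]calkin_piK -[c]calkin_piK.
by rewrite -calkin_piD -!calkin_piM mulrDl calkin_piD.
Qed.
Lemma calkin_mulDr : right_distributive calkin_mul +%R.
Proof.
move=> a b c; rewrite -[a]calkin_piK -[b]calkin_piK -[c]calkin_piK.
by rewrite -calkin_piD -!calkin_piM mulrDr calkin_piD.
Qed.

HB.instance Definition _ := GRing.Zmodule_isPzRing.Build calkin
  calkin_mulA calkin_mul1l calkin_mul1r calkin_mulDl calkin_mulDr.

Definition calkin_scale (k : K) (a : calkin) : calkin :=
  calkin_pi (k *: repr a).

Lemma compact_opZ (k : K) (T : bounded_op) :
  T \in compact_op -> k *: T \in compact_op.
Proof.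
move=> cT; rewrite (_ : k *: T = (k *: (1 : bounded_op)) * T) ?compact_op_comp_l//.
exact: bounded_op_inj.
Qed.

Lemma calkin_piZ (k : K) (T : bounded_op) :
  calkin_pi (k *: T) = calkin_scale k (calkin_pi T).
Proof.
apply/calkin_piE; rewrite -scalerBr compact_opZ//.
by apply/calkin_piE; rewrite calkin_piK.
Qed.

Lemma calkin_scaleA k l a :
  calkin_scale k (calkin_scale l a) = calkin_scale (k * l) a.
Proof. by rewrite -[a]calkin_piK -!calkin_piZ scalerA. Qed.
Lemma calkin_scale1 : left_id 1 calkin_scale.
Proof. by move=> a; rewrite -[a]calkin_piK -calkin_piZ scale1r. Qed.
Lemma calkin_scaleDr : right_distributive calkin_scale +%R.
Proof.
move=> k a b; rewrite -[a]calkin_piK -[b]calkin_piK.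
by rewrite -calkin_piD -!calkin_piZ scalerDr calkin_piD.
Qed.
Lemma calkin_scaleDl a : {morph calkin_scale^~ a : k l / k + l}.
Proof.
by move=> k l; rewrite -[a]calkin_piK -!calkin_piZ scalerDl calkin_piD.
Qed.

HB.instance Definition _ := GRing.Zmodule_isLmodule.Build K calkin
  calkin_scaleA calkin_scale1 calkin_scaleDr calkin_scaleDl.

Definition ess_spectrum (T : bounded_op) : set K :=
  [set z | ~ exists b : calkin,
    (calkin_pi T - z *: (1 : calkin)) * b = 1 /\ b * (calkin_pi T - z *: (1 : calkin)) = 1].

Definition finite_dimensional : Prop :=
  exists n (e : 'I_n -> V), forall x, exists c : 'I_n -> K,
    x = \sum_(i < n) c i *: e i.

Definition separable : Prop :=
  exists2 A : set V, countable A & dense A.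

End BoundedOperators.

(* The inner product is linear in its first argument and conjugate-linear in the
   second; it takes values in R[i], and so does the norm of the library. *)
HB.mixin Record isHilbert (R : realType) H
    & CompleteNormedModule R[i] H := {
  inner : {dot H for (@Num.conj R[i])};
  inner_norm : forall x : H, `|x| ^+ 2 = inner x x
}.

#[short(type="hilbertType")]
HB.structure Definition Hilbert (R : realType) :=
  {H of CompleteNormedModule R[i] H & isHilbert R H}.

Section HilbertOperators.
Variables (R : realType) (H : hilbertType R).
Implicit Types P S T U L : bounded_op H.

(* Norms are nonnegative reals embedded in R[i]; Re brings them back to R. *)
Definition opnorm T : R :=
  sup [set complex.Re `|T x| | x in @unit_ball _ H].

Definition adjoint_of T S : Prop := forall x y : H, inner (T x) y = inner x (S y).

Definition self_adjoint T : Prop := adjoint_of T T.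

Definition unitary U : Prop :=
  exists V, [/\ adjoint_of U V, V * U = 1 & U * V = 1].

Definition projection P : Prop := P * P = P /\ self_adjoint P.

Definition common_norm T : Prop :=
  forall P, projection P ->
    opnorm (P * T * (1 - P)) = opnorm ((1 - P) * T * P).

End HilbertOperators.

(* Main.v *)
(* Sufficiency.  Passing to an affine combination multiplies both corners by the
   same scalar, and for self-adjoint [T] they are adjoint to each other.  If [U]
   is unitary and its corners have different norms, then for a suitable [P] the
   compression [A] of [U] to the range of [P] is bounded below but [A^*] has a
   smaller lower bound.  The condition on the essential spectrum makes
   [A + t + F] coercive for every small [t > 0] and some finite rank [F], so
   that [A + t] is onto by the Fredholm alternative; letting [t] tend to [0]
   contradicts the gap between [A] and [A^*].

   Necessity.  Projections of rank one show that [T] is normal.  For a projection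
   of rank two, the Gram matrices of the two corners have the same trace and the
   same largest eigenvalue, hence the same determinant; this means that the
   compressions of [1], [Re T], [Im T], [T^* T] to every plane are linearly
   dependent over the reals.  Tested on combinations of approximate eigenvectors
   this puts any four points of the spectrum on a line or circle, so [T] satisfies
   a real linear relation between [1], [Re T], [Im T], [T^* T], which makes it
   affine in a self-adjoint or in a unitary operator.  If the essential spectrum
   of a unitary [U] is not contained in a closed half-circle, then [0] is a
   strictly positive combination of some of its points, and combining approximate
   eigenvectors gives a projection [P] such that [P U P] is close to a nonzero
   multiple of the unilateral shift; the norm of one corner is then close to [1],
   that of the other is not. *)

Require Import Defs.
From mathcomp Require Import all_boot all_order all_algebra sesquilinear.
From mathcomp Require Import all_classical reals topology normedtype.
From mathcomp Require Import complex ring lra.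

Set Implicit Arguments.
Unset Strict Implicit.
Unset Printing Implicit Defensive.

Import Order.TTheory GRing.Theory Num.Theory.
Import numFieldNormedType.Exports.
Local Open Scope classical_set_scope.
Local Open Scope ring_scope.
Local Open Scope complex_scope.

(** For a unitary [U], the squared norms of [P U P x] and [(1 - P) U P x] add up to that of [P x],
    so an upper bound on one corner is a lower bound on the compression; the other corner is tied in
    the same way to the compression of the adjoint. An invertible operator and its adjoint have the
    same lower bound, hence the corners can only differ if some compression fails to be invertible
    in a one-sided way, as the unilateral shift does. Both directions decide when this can happen.
    No spectral measure and no index is used: points of the spectrum are represented by approximate
    eigenvectors, found for the commuting real and imaginary parts one after the other, with
    explicit error bounds. The half-circle may be normalised to [Re z >= 0] because a rotation of
    [U] is absorbed in [mu]. *)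

Local Notation cre := (@complex.Re _).
Local Notation cim := (@complex.Im _).

(** * Real-valued norms and the complex inner product *)

Section ComplexParts.
Variable R : realType.
Implicit Types (a b : R[i]) (r : R).

Definition cabs a : R := cre `|a|.

Lemma creD a b : cre (a + b) = cre a + cre b.
Proof. by case: a b => ? ? []. Qed.
Lemma cimD a b : cim (a + b) = cim a + cim b.
Proof. by case: a b => ? ? []. Qed.
Lemma creN a : cre (- a) = - cre a.
Proof. by case: a. Qed.
Lemma cimN a : cim (- a) = - cim a.
Proof. by case: a. Qed.
Lemma creM a b : cre (a * b) =
  cre a * cre b - cim a * cim b.
Proof. by case: a b => ? ? []. Qed.
Lemma cimM a b : cim (a * b) =
  cre a * cim b + cim a * cre b.
Proof. by case: a b => ? ? []. Qed.
Lemma creJ a : cre (conjc a) = cre a.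
Proof. by case: a. Qed.
Lemma cimJ a : cim (conjc a) = - cim a.
Proof. by case: a. Qed.
Lemma creZ r a : cre (r%:C * a) = r * cre a.
Proof. by rewrite creM /= mul0r subr0. Qed.

Lemma complex_eq a b :
  cre a = cre b -> cim a = cim b -> a = b.
Proof. by case: a b => ? ? [? ?] /= -> ->. Qed.

Lemma Re_sum (I : Type) (s : seq I) (P : pred I) (F : I -> R[i]) :
  cre (\sum_(i <- s | P i) F i) = \sum_(i <- s | P i) cre (F i).
Proof. exact: (big_morph _ creD). Qed.

Lemma cabsE a : `|a| = (cabs a)%:C.
Proof. by rewrite /cabs RRe_real ?normr_real. Qed.

Lemma cabs_sqr a : cabs a ^+ 2 = cre a ^+ 2 + cim a ^+ 2.
Proof.
apply: (@complexI R); have := add_Re2_Im2 a.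
by rewrite cabsE => ->; rewrite rmorphXn.
Qed.

Lemma cabs_ge0 a : 0 <= cabs a.
Proof. by have := normr_ge0 a; rewrite cabsE ler0c. Qed.

Lemma cabsM a b : cabs (a * b) = cabs a * cabs b.
Proof. by apply: (@complexI R); rewrite rmorphM/= -!cabsE normrM. Qed.

Lemma cabsD a b : cabs (a + b) <= cabs a + cabs b.
Proof. by rewrite -lecR rmorphD/= -!cabsE ler_normD. Qed.

Lemma cabsN a : cabs (- a) = cabs a.
Proof. by rewrite /cabs normrN. Qed.

Lemma cabsJ a : cabs (conjc a) = cabs a.
Proof.
apply/eqP; rewrite -(eqrXn2 (n := 2)) ?cabs_ge0//.
by rewrite !cabs_sqr creJ cimJ sqrrN.
Qed.

Lemma cabs_real r : cabs r%:C = `|r|.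
Proof.
apply/eqP; rewrite -(eqrXn2 (n := 2)) ?cabs_ge0//.
by rewrite cabs_sqr /= expr0n addr0 real_normK ?num_real.
Qed.

Lemma cabs_eq0 a : (cabs a == 0) = (a == 0).
Proof. by rewrite -(normr_eq0 a) cabsE eq_complex /= eqxx andbT. Qed.

Lemma cabs0 : cabs 0 = 0. Proof. by rewrite /cabs normr0. Qed.
Lemma cabs1 : cabs 1 = 1. Proof. by rewrite /cabs normr1. Qed.

Lemma cabs_i : cabs (0 +i* 1 : R[i]) = 1.
Proof.
apply/eqP; rewrite -(eqrXn2 (n := 2)) ?cabs_ge0//.
by rewrite cabs_sqr /= expr0n add0r.
Qed.

Lemma cabsV a : cabs a^-1 = (cabs a)^-1.
Proof. by apply: (@complexI R); rewrite fmorphV/= -!cabsE normfV. Qed.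

Lemma mulJc a : a * conjc a = (cabs a ^+ 2)%:C.
Proof.
by apply: complex_eq; rewrite !(creM, cimM, creJ, cimJ) ?cabs_sqr /=; ring.
Qed.

Lemma Re_le_cabs a : cre a <= cabs a.
Proof.
apply: le_trans (ler_norm _) _.
rewrite -(ler_pXn2r (n := 2)) ?nnegrE ?cabs_ge0//.
by rewrite real_normK ?num_real// cabs_sqr lerDl sqr_ge0.
Qed.

Lemma cabs_Re_le a : `|cre a| <= cabs a.
Proof.
rewrite -(ler_pXn2r (n := 2)) ?nnegrE ?cabs_ge0//.
by rewrite real_normK ?num_real// cabs_sqr lerDl sqr_ge0.
Qed.

Lemma cabs_Im_le a : `|cim a| <= cabs a.
Proof.
rewrite -(ler_pXn2r (n := 2)) ?nnegrE ?cabs_ge0//.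
by rewrite real_normK ?num_real// cabs_sqr lerDr sqr_ge0.
Qed.

Lemma norm1_cabs a : `|a| = 1 <-> cabs a = 1.
Proof. by rewrite cabsE; split=> [[]//|->]. Qed.

(** Such a phase turns an estimate of real parts into one of moduli. *)
Lemma cabs_phase a : exists2 u, cabs u = 1 & u * a = (cabs a)%:C.
Proof.
have [->|a0] := eqVneq a 0; first by exists 1; rewrite ?cabs1// mulr0 cabs0.
exists (conjc a * (cabs a)^-1%:C).
  rewrite cabsM cabsJ cabs_real ger0_norm ?invr_ge0 ?cabs_ge0// divff//.
  by rewrite cabs_eq0.
rewrite mulrAC [_ * a]mulrC mulJc -rmorphM/= expr2 mulfK//.
by rewrite cabs_eq0.
Qed.

End ComplexParts.

Section InnerProduct.
Variables (R : realType) (H : hilbertType R).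
Implicit Types (x y z : H) (a b : R[i]) (r : R).

Definition nm x : R := cre `|x|.

Lemma normE x : `|x| = (nm x)%:C.
Proof. by rewrite /nm RRe_real ?normr_real. Qed.

Lemma nm_ge0 x : 0 <= nm x.
Proof. by have := normr_ge0 x; rewrite normE ler0c. Qed.

Lemma nm_eq0 x : (nm x == 0) = (x == 0).
Proof. by rewrite -(normr_eq0 x) normE eq_complex /= eqxx andbT. Qed.

Lemma nm0 : nm 0 = 0. Proof. by rewrite /nm normr0. Qed.

Lemma nm_gt0 x : (0 < nm x) = (x != 0).
Proof. by rewrite lt_neqAle nm_ge0 andbT eq_sym nm_eq0. Qed.

Lemma nmD x y : nm (x + y) <= nm x + nm y.
Proof. by rewrite -lecR rmorphD/= -!normE ler_normD. Qed.

Lemma nmN x : nm (- x) = nm x.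
Proof. by rewrite /nm normrN. Qed.

Lemma nmZ a x : nm (a *: x) = cabs a * nm x.
Proof. by apply: (@complexI R); rewrite rmorphM/= -!normE -cabsE normrZ. Qed.

Lemma nmB x y : nm (x - y) = nm (y - x).
Proof. by rewrite -nmN opprB. Qed.

Lemma nmBD x y : nm (x - y) <= nm x + nm y.
Proof. by rewrite (le_trans (nmD _ _))// nmN. Qed.

Lemma nmB_ge x y : nm x - nm y <= nm (x - y).
Proof. by rewrite lerBlDr; apply: le_trans (nmD _ _); rewrite subrK. Qed.

Lemma inner_sym x y : inner x y = conjc (inner y x).
Proof. by rewrite (hermC inner) expr0 mul1r. Qed.

Lemma innerDl x y z : inner (x + y) z = inner x z + inner y z.
Proof. exact: linearDl. Qed.
Lemma innerDr x y z : inner x (y + z) = inner x y + inner x z.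
Proof. exact: linearDr. Qed.
Lemma innerNl x y : inner (- x) y = - inner x y.
Proof. exact: linearNl. Qed.
Lemma innerNr x y : inner x (- y) = - inner x y.
Proof. exact: linearNr. Qed.
Lemma innerBl x y z : inner (x - y) z = inner x z - inner y z.
Proof. exact: linearBl. Qed.
Lemma innerBr x y z : inner x (y - z) = inner x y - inner x z.
Proof. exact: linearBr. Qed.
Lemma innerZl a x y : inner (a *: x) y = a * inner x y.
Proof. exact: linearZl_LR. Qed.
Lemma innerZr a x y : inner x (a *: y) = conjc a * inner x y.
Proof. by rewrite linearZr. Qed.
Lemma inner0l x : inner 0 x = 0. Proof. exact: linear0l. Qed.
Lemma inner0r x : inner x 0 = 0. Proof. exact: linear0r. Qed.

Definition innerE := (innerDl, innerDr, innerNl, innerNr, innerZl, innerZr).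

Lemma inner_suml (I : Type) (s : seq I) (P : pred I) (F : I -> H) y :
  inner (\sum_(i <- s | P i) F i) y = \sum_(i <- s | P i) inner (F i) y.
Proof.
by apply: (big_morph (inner^~ y)) => [u v|]; rewrite ?innerDl ?inner0l.
Qed.

Lemma inner_sumr (I : Type) (s : seq I) (P : pred I) (F : I -> H) x :
  inner x (\sum_(i <- s | P i) F i) = \sum_(i <- s | P i) inner x (F i).
Proof.
by apply: (big_morph (inner x)) => [u v|]; rewrite ?innerDr ?inner0r.
Qed.

Lemma inner_self x : inner x x = (nm x ^+ 2)%:C.
Proof. by rewrite -inner_norm normE rmorphXn. Qed.

Lemma Re_inner_sym x y : cre (inner x y) = cre (inner y x).
Proof. by rewrite inner_sym creJ. Qed.

Lemma cabs_inner_sym x y : cabs (inner x y) = cabs (inner y x).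
Proof. by rewrite inner_sym cabsJ. Qed.

Lemma inner_eq0_sym x y : inner x y = 0 -> inner y x = 0.
Proof. by move=> xy; rewrite inner_sym xy conjc0. Qed.

Lemma nm_sqr x : nm x ^+ 2 = cre (inner x x).
Proof. by rewrite inner_self. Qed.

Lemma nm_sqrD x y :
  nm (x + y) ^+ 2 = nm x ^+ 2 + cre (inner x y) *+ 2 + nm y ^+ 2.
Proof. by rewrite !nm_sqr !innerE !creD (Re_inner_sym y x); ring. Qed.

Lemma nm_sqrB x y :
  nm (x - y) ^+ 2 = nm x ^+ 2 - cre (inner x y) *+ 2 + nm y ^+ 2.
Proof. by rewrite nm_sqrD nmN innerNr creN mulNrn. Qed.

Lemma pythagoras x y : inner x y = 0 -> nm (x + y) ^+ 2 = nm x ^+ 2 + nm y ^+ 2.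
Proof. by move=> xy; rewrite nm_sqrD xy mul0rn addr0. Qed.

Lemma nmZr r x : nm (r%:C *: x) = `|r| * nm x.
Proof. by rewrite nmZ cabs_real. Qed.

Lemma cauchy_schwarz x y : cabs (inner x y) <= nm x * nm y.
Proof.
(* The real part is bounded by expanding the square of [nm (nm v *: u - nm u *: v)]; a phase then
   gives the modulus. *)
have key u v : cre (inner u v) <= nm u * nm v.
  have [->|u0] := eqVneq u 0; first by rewrite inner0l nm0 mul0r.
  have [->|v0] := eqVneq v 0; first by rewrite inner0r nm0 mulr0.
  rewrite -nm_gt0 in u0; rewrite -nm_gt0 in v0.
  have := sqr_ge0 (nm ((nm v)%:C *: u - (nm u)%:C *: v)).
  rewrite nm_sqrB !nmZr innerZl innerZr conjc_real !creZ.
  rewrite !ger0_norm ?nm_ge0// => h; rewrite -subr_ge0.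
  rewrite -(pmulr_rge0 _ (mulr_gt0 (mulr_gt0 u0 v0) (ltr0n _ 2))).
  by apply: le_trans h _; rewrite le_eqVlt; apply/orP; left; apply/eqP; ring.
have [u u1 ue] := cabs_phase (inner x y).
have := key (u *: x) y; rewrite innerZl ue nmZ u1 mul1r.
exact.
Qed.

Lemma Re_inner_le x y : `|cre (inner x y)| <= nm x * nm y.
Proof. exact: le_trans (cabs_Re_le _) (cauchy_schwarz _ _). Qed.

Lemma inner_eq0 x : (forall y, inner x y = 0) -> x = 0.
Proof.
move=> h; apply/eqP; rewrite -nm_eq0 -(sqrf_eq0 (nm x)) nm_sqr h.
exact: eqxx.
Qed.

Lemma inner_inj x y : (forall z, inner x z = inner y z) -> x = y.
Proof.
move=> h; apply/eqP; rewrite -subr_eq0; apply/eqP/inner_eq0 => z.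
by rewrite innerBl h subrr.
Qed.

Lemma normalizeP x : x != 0 -> nm ((nm x)^-1%:C *: x) = 1.
Proof.
move=> x0; rewrite nmZr ger0_norm ?invr_ge0 ?nm_ge0// mulVf//.
by rewrite nm_eq0.
Qed.

Lemma cauchy_limit (u : nat -> H) :
  (forall e : R, 0 < e ->
     exists N, forall m n, (N <= m)%N -> (N <= n)%N -> nm (u m - u n) < e) ->
  exists l, forall e : R, 0 < e ->
    exists N, forall n, (N <= n)%N -> nm (u n - l) < e.
Proof.
move=> cu; have : cvg (u @ \oo).
  apply/cauchy_cvgP/cauchy_exP => e; rewrite ltcE => /= /andP[/eqP e0 e_gt0].
  have [N uN] := cu _ e_gt0.
  exists (u N); exists N => // n /= Nn.
  by rewrite -ball_normE /= normE ltcE /= e0 eqxx/=; exact: uN.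
move=> /cvg_ex[l /cvgrPdist_lt ul]; exists l => e e0.
have [|N _ Nl] := ul e%:C; first by rewrite ltcR.
by exists N => n /Nl; rewrite /= normE ltcR nmB.
Qed.

End InnerProduct.

(** * Operator norm, adjoints and the Lax-Milgram lemma *)

Section BoundedOperatorFacts.
Variables (R : realType) (H : hilbertType R).
Implicit Types (x y z : H) (S T : bounded_op H) (a b : R[i]) (r : R).

Lemma opM S T x : (S * T) x = S (T x). Proof. by []. Qed.
Lemma opD S T x : (S + T) x = S x + T x. Proof. by []. Qed.
Lemma opN T x : (- T) x = - T x. Proof. by []. Qed.
Lemma opB S T x : (S - T) x = S x - T x. Proof. by []. Qed.
Lemma opZ a T x : (a *: T) x = a *: T x. Proof. by []. Qed.
Lemma op1 x : (1 : bounded_op H) x = x. Proof. by []. Qed.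
Lemma opxD T x y : T (x + y) = T x + T y. Proof. exact: raddfD. Qed.
Lemma opxB T x y : T (x - y) = T x - T y. Proof. exact: raddfB. Qed.
Lemma opxZ T a x : T (a *: x) = a *: T x. Proof. exact: linearZ. Qed.
Lemma opx0 T : T 0 = 0. Proof. exact: raddf0. Qed.
Lemma opx_sum T (I : Type) (s : seq I) (P : pred I) (F : I -> H) :
  T (\sum_(i <- s | P i) F i) = \sum_(i <- s | P i) T (F i).
Proof. exact: raddf_sum. Qed.

Lemma op_bound T : exists2 M : R, 0 < M & forall x, nm (T x) <= M * nm x.
Proof.
have [M M0 TM] := bounded_op_bound T; exists (cre M).
  by move: M0; rewrite ltcE => /andP[].
move=> x; have := TM x; rewrite !normE.
by rewrite -(RRe_real (gtr0_real M0)) -rmorphM/= lecR.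
Qed.

Lemma bounded_op_build (f : H -> H) (M : R) :
  (forall a x y, f (a *: x + y) = a *: f x + f y) ->
  (forall x, nm (f x) <= M * nm x) -> exists T : bounded_op H, forall x, T x = f x.
Proof.
move=> lf bf; have Pf : f \in @bounded_linear _ H.
  apply/asboolP; split=> //; exists M%:C => x.
  by rewrite !normE -rmorphM/= lecR.
by exists (BoundedOp Pf).
Qed.

Lemma opnorm_ub T x : nm (T x) <= opnorm T * nm x.
Proof.
have [M M0 TM] := op_bound T.
have [->|x0] := eqVneq x 0; first by rewrite opx0 nm0 mulr0.
rewrite -ler_pdivrMr ?nm_gt0//; apply: ub_le_sup.
  exists M => _ [y y1 <-]; apply: le_trans (TM y) _.
  by move: y1; rewrite /unit_ball /= normE lecR => y1; rewrite ler_piMr// ltW.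
exists ((nm x)^-1%:C *: x); first by rewrite /unit_ball /= normE normalizeP.
rewrite opxZ -/(nm _) nmZr ger0_norm ?invr_ge0 ?nm_ge0//.
exact: mulrC.
Qed.

Lemma opnorm_le T r : 0 <= r -> (forall x, nm (T x) <= r * nm x) -> opnorm T <= r.
Proof.
move=> r0 Tr; apply: ge_sup.
  by exists (nm (T 0)), 0 => //; rewrite /unit_ball /= normr0.
move=> _ [y + <-]; rewrite /unit_ball /= normE lecR => y1.
by apply: le_trans (Tr y) _; rewrite ler_piMr.
Qed.

Lemma opnorm_ge0 T : 0 <= opnorm T.
Proof.
have [M M0 TM] := op_bound T; apply: ub_le_sup.
  exists M => _ [y y1 <-]; apply: le_trans (TM y) _.
  by move: y1; rewrite /unit_ball /= normE lecR => y1; rewrite ler_piMr// ltW.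
exists 0; first by rewrite /unit_ball /= normr0.
by rewrite opx0 normr0.
Qed.

Lemma opnormZ a T : opnorm (a *: T) = cabs a * opnorm T.
Proof.
have le b S : opnorm (b *: S) <= cabs b * opnorm S.
  apply: opnorm_le => [|x]; first by rewrite mulr_ge0 ?cabs_ge0 ?opnorm_ge0.
  by rewrite opZ nmZ -mulrA ler_wpM2l ?cabs_ge0 ?opnorm_ub.
apply/eqP; rewrite eq_le le/=.
have [->|a0] := eqVneq a 0; first by rewrite cabs0 mul0r opnorm_ge0.
have a'0 : 0 < cabs a by rewrite lt_neqAle cabs_ge0 eq_sym cabs_eq0 a0.
rewrite mulrC -ler_pdivlMr// mulrC -cabsV.
by have := le a^-1 (a *: T); rewrite scalerA mulVf// scale1r.
Qed.

Lemma adjoint_sym S T : adjoint_of S T -> adjoint_of T S.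
Proof. by move=> h x y; rewrite inner_sym -h -inner_sym. Qed.

Lemma adjointM S S' T T' :
  adjoint_of S S' -> adjoint_of T T' -> adjoint_of (S * T) (T' * S').
Proof. by move=> hS hT x y; rewrite !opM hS hT. Qed.

Lemma adjointD S S' T T' :
  adjoint_of S S' -> adjoint_of T T' -> adjoint_of (S + T) (S' + T').
Proof. by move=> hS hT x y; rewrite !opD !innerE hS hT. Qed.

Lemma adjointN S S' : adjoint_of S S' -> adjoint_of (- S) (- S').
Proof. by move=> hS x y; rewrite !opN !innerE hS. Qed.

Lemma adjointB S S' T T' :
  adjoint_of S S' -> adjoint_of T T' -> adjoint_of (S - T) (S' - T').
Proof. by move=> hS hT; apply/adjointD/adjointN. Qed.

Lemma adjointZ a S S' : adjoint_of S S' -> adjoint_of (a *: S) (conjc a *: S').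
Proof. by move=> hS x y; rewrite !opZ !innerE conjcK hS. Qed.

Lemma adjoint1 : adjoint_of (1 : bounded_op H) 1.
Proof. by []. Qed.

Lemma self_adjointZ r S : self_adjoint S -> self_adjoint (r%:C *: S).
Proof. by move=> hS; rewrite /self_adjoint -{2}[r%:C]conjc_real; exact: adjointZ. Qed.

Lemma self_adjoint_Im S x : self_adjoint S -> cim (inner (S x) x) = 0.
Proof.
move=> hS; have := inner_sym (S x) x; rewrite -hS => /(congr1 (@complex.Im R)).
by rewrite cimJ; lra.
Qed.

Lemma projection1B (P : bounded_op H) : projection P -> projection (1 - P).
Proof.
move=> [PP hP]; split; last exact: adjointB adjoint1 hP.
by rewrite mulrBr mulr1 mulrBl mul1r PP subrr subr0.
Qed.

Lemma opnorm_adjoint S T : adjoint_of S T -> opnorm S = opnorm T.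
Proof.
have le S' T' : adjoint_of S' T' -> opnorm S' <= opnorm T'.
  move=> h; apply: opnorm_le => [|x]; first exact: opnorm_ge0.
  have [->|Sx0] := eqVneq (S' x) 0; first by rewrite nm0 mulr_ge0 ?opnorm_ge0 ?nm_ge0.
  rewrite -(ler_pM2r (x := nm (S' x))) ?nm_gt0// -expr2 nm_sqr h.
  apply: le_trans (ler_norm _) (le_trans (Re_inner_le _ _) _).
  by rewrite mulrC mulrAC ler_wpM2r ?nm_ge0 ?opnorm_ub.
by move=> h; apply/eqP; rewrite eq_le !le//; exact: adjoint_sym.
Qed.

Lemma invS_small r : 0 < r -> exists N, forall n, (N <= n)%N -> n.+1%:R^-1 < r.
Proof.
move=> r0; exists (Num.truncn r^-1) => n Nn.
rewrite invf_plt ?posrE// (lt_le_trans (truncnS_gt _))//.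
by rewrite ler_nat ltnS.
Qed.

(** The representing vector minimises [J]: the parallelogram law makes a minimising sequence Cauchy,
    and the first variation of [J] at its limit identifies the real parts. *)
Lemma riesz (phi : H -> R[i]) (m : R) :
  (forall a x y, phi (a *: x + y) = a * phi x + phi y) ->
  (forall x, cabs (phi x) <= m * nm x) -> exists y, forall x, phi x = inner x y.
Proof.
move=> lphi bphi.
have phiD x y : phi (x + y) = phi x + phi y.
  by rewrite -[x]scale1r lphi mul1r scale1r.
have phi0 : phi 0 = 0 by apply: (addrI (phi 0)); rewrite -phiD !addr0.
have phiZ a x : phi (a *: x) = a * phi x by rewrite -[a *: x]addr0 lphi phi0 addr0.
pose J x := nm x ^+ 2 - 2 * cre (phi x).
have lbJ : has_inf (range J).
  split; first by exists (J 0), 0.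
  exists (- m ^+ 2) => _ [x _ <-]; rewrite /J.
  have := le_trans (Re_le_cabs _) (bphi x); have := sqr_ge0 (nm x - m); nra.
pose d := inf (range J).
have dJ x : d <= J x by apply: ge_inf; [case: lbJ|exists x].
have /choice[u uJ] : forall n : nat, exists x, J x < d + n.+1%:R^-1.
  move=> n; have [|_ [x _ <-] xd] := @inf_adherent _ (range J) n.+1%:R^-1 _ lbJ.
    by rewrite invr_gt0.
  by exists x.
(* [J] is at least [d] at the midpoint of [x] and [y]. *)
have par x y : nm (x - y) ^+ 2 <= 2 * (J x - d) + 2 * (J y - d).
  have := dJ ((2^-1)%:C *: (x + y)).
  rewrite nm_sqrB /J phiZ phiD nmZr exprMn real_normK ?num_real// nm_sqrD creZ creD.
  by nra.
have [l ul] : exists l, forall e : R, 0 < e ->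
    exists N, forall n, (N <= n)%N -> nm (u n - l) < e.
  apply: cauchy_limit => e e0.
  have [N Ne] := invS_small (divr_gt0 (exprn_gt0 2 e0) (ltr0n R 4)).
  exists N => k n Nk Nn; rewrite -(ltr_pXn2r (n := 2)) ?nnegrE ?nm_ge0 ?ltW//.
  apply: le_lt_trans (par _ _) _.
  have := Ne _ Nk; have := Ne _ Nn; have := uJ k; have := uJ n.
  by move: (k.+1%:R^-1) (n.+1%:R^-1) => p q; lra.
have Rl h : cre (phi h) = cre (inner h l).
  (* This is [J (l + t h) - J l], estimated at [u n], where [J] is within [1 / (n + 1)] of its
     infimum. *)
  have main t : 0 <= 2 * t * (cre (inner l h) - cre (phi h)) + t ^+ 2 * nm h ^+ 2.
    apply/ler_addgt0Pr => e e0.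
    have [N1 N1e] := invS_small (divr_gt0 e0 (ltr0n R 2)).
    have c0 : 0 < 4 * (`|t| * nm h + 1) by rewrite mulr_gt0// ltr_wpDl// mulr_ge0 ?nm_ge0.
    have [N2 N2e] := ul _ (divr_gt0 e0 c0).
    pose n := maxn N1 N2; have := N1e n (leq_maxl _ _); have := N2e n (leq_maxr _ _).
    rewrite ltr_pdivlMr// => un1 un2.
    have : t * (cre (inner (u n) h) - cre (inner l h)) <= `|t| * (nm (u n - l) * nm h).
      rewrite -creN -creD -innerBl; apply: le_trans (ler_norm _) _.
      by rewrite normrM ler_wpM2l// Re_inner_le.
    have := dJ (u n + t%:C *: h); have := uJ n; rewrite /J phiD phiZ nm_sqrD.
    rewrite nmZr innerZr conjc_real exprMn real_normK ?num_real// creD !creZ.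
    have := mulr_ge0 (normr_ge0 t) (mulr_ge0 (nm_ge0 (u n - l)) (nm_ge0 h)).
    have := nm_ge0 (u n - l); move: (n.+1%:R^-1) un2 => q un2.
    lra.
  rewrite (Re_inner_sym h l); set dd := cre (inner l h) - _ in main.
  suff : dd = 0 by rewrite /dd => /eqP; rewrite subr_eq0 => /eqP.
  have [h0|h0] := eqVneq h 0.
    by rewrite /dd h0 inner0r phi0 /= subrr.
  have n0 : 0 < nm h ^+ 2 by rewrite exprn_gt0// nm_gt0.
  (* This [t] minimises the quadratic in [main]. *)
  have := main (- dd / nm h ^+ 2).
  rewrite (_ : 2 * _ * _ + _ = - (dd ^+ 2 / nm h ^+ 2)); last first.
    by field; rewrite nm_eq0.
  rewrite oppr_ge0 pmulr_lle0 ?invr_gt0// => dd0.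
  by apply/eqP; rewrite -sqrf_eq0 eq_le dd0 sqr_ge0.
exists l => x; apply: complex_eq; first exact: Rl.
(* The real part at [- i x] is the imaginary part at [x]. *)
have := Rl ((0 +i* -1) *: x); rewrite phiZ innerZl. rewrite !creM /=; lra.
Qed.

Lemma adjoint_exists T : exists S, adjoint_of T S.
Proof.
have [M M0 TM] := op_bound T.
have /choice[f fT] : forall y, exists z, forall x, inner (T x) y = inner x z.
  move=> y; apply: (@riesz _ (M * nm y)) => [a x z|x].
    by rewrite linearP !innerE.
  by apply: le_trans (cauchy_schwarz _ _) _; rewrite mulrAC ler_wpM2r ?nm_ge0.
have [||S SE] := @bounded_op_build f M.
- move=> a x y; apply: inner_inj => z; rewrite !innerE.
  by rewrite inner_sym -fT !innerE rmorphD rmorphM /= conjcK !fT -!inner_sym.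
- move=> x; have [->|fx0] := eqVneq (f x) 0; first by rewrite nm0 mulr_ge0 ?nm_ge0 ?ltW.
  rewrite -(ler_pM2r (x := nm (f x))) ?nm_gt0// -expr2 nm_sqr -fT.
  apply: le_trans (ler_norm _) (le_trans (Re_inner_le _ _) _).
  by rewrite mulrAC ler_wpM2r ?nm_ge0.
by exists S => x y; rewrite fT SE.
Qed.

(** The lower bound makes the preimages of a convergent sequence Cauchy, so a dense range is
    everything. *)
Lemma closed_range_surj T r : 0 < r -> (forall x, r * nm x <= nm (T x)) ->
  (forall y (e : R), 0 < e -> exists x, nm (T x - y) < e) ->
  forall y, exists x, T x = y.
Proof.
move=> r0 rT dT y.
have /choice[u uy] : forall n : nat, exists x, nm (T x - y) < n.+1%:R^-1.
  by move=> n; apply: dT; rewrite invr_gt0.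
have [l ul] : exists l, forall e : R, 0 < e ->
    exists N, forall n, (N <= n)%N -> nm (u n - l) < e.
  apply: cauchy_limit => e e0.
  have [N Ne] := invS_small (divr_gt0 (mulr_gt0 r0 e0) (ltr0n R 2)).
  exists N => k n Nk Nn; rewrite -(ltr_pM2l r0).
  apply: le_lt_trans (rT _) _; rewrite opxB.
  have -> : T (u k) - T (u n) = (T (u k) - y) - (T (u n) - y).
    by rewrite opprB addrA subrK.
  apply: le_lt_trans (nmBD _ _) _.
  have := Ne _ Nk; have := Ne _ Nn; have := uy k; have := uy n.
  by move: (k.+1%:R^-1) (n.+1%:R^-1) => p q; lra.
exists l; apply/eqP; rewrite -subr_eq0 -nm_eq0 eq_le nm_ge0 andbT.
apply/ler_addgt0Pr => e e0; rewrite add0r.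
have [M M0 TM] := op_bound T.
have [N1 N1e] := invS_small (divr_gt0 e0 (ltr0n R 2)).
have [N2 N2e] := ul _ (divr_gt0 e0 (mulr_gt0 (ltr0n R 2) M0)).
pose n := maxn N1 N2; have := N1e n (leq_maxl _ _); have := N2e n (leq_maxr _ _).
rewrite ltr_pdivlMr; last by rewrite mulr_gt0.
move=> un1 un2; have -> : T l - y = (T (u n) - y) - T (u n - l).
  by rewrite opxB opprB [RHS]addrC addrA subrK.
apply: le_trans (nmBD _ _) _.
by have := uy n; have := TM (u n - l); move: (n.+1%:R^-1) un2 => q un2; lra.
Qed.

Lemma coercive_below T r x : r * nm x ^+ 2 <= cre (inner (T x) x) ->
  r * nm x <= nm (T x).
Proof.
have [->|x0] := eqVneq x 0; first by rewrite nm0 mulr0 nm_ge0.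
move=> h; rewrite -(ler_pM2r (x := nm x)) ?nm_gt0// -mulrA -expr2.
exact: le_trans h (le_trans (ler_norm _) (Re_inner_le _ _)).
Qed.

(* The residual [y - T x] of an almost minimising [x] is shrunk by a fixed
   factor under one gradient step [x + t (y - T x)], so the infimum of the
   residuals is [0]. *)
Lemma lax_milgram T r : 0 < r ->
  (forall x, r * nm x ^+ 2 <= cre (inner (T x) x)) ->
  forall y, exists x, T x = y.
Proof.
move=> r0 cT; apply: (@closed_range_surj _ r) => // [x|y e e0].
  exact: coercive_below.
have [M M0 TM] := op_bound T.
pose J x := nm (T x - y) ^+ 2.
have lbJ : has_inf (range J).
  by split; [exists (J 0), 0|exists 0 => _ [x _ <-]; exact: sqr_ge0].
pose d := inf (range J).
have dJ x : d <= J x by apply: ge_inf; [case: lbJ|exists x].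
(* This [t] minimises the bound [1 - 2 t r + t^2 M^2] on the shrinking factor; the minimum is
   [1 - r t]. *)
pose t := r / M ^+ 2; have t0 : 0 < t by rewrite divr_gt0// exprn_gt0.
have step x : d <= (1 - r * t) * J x.
  apply: le_trans (dJ (x - t%:C *: (T x - y))) _; rewrite /J.
  set w := T x - y; rewrite opxB opxZ.
  rewrite (_ : _ - y = w - t%:C *: T w); last by rewrite /w addrAC.
  rewrite nm_sqrB nmZr innerZr conjc_real creZ exprMn real_normK ?num_real//.
  rewrite (Re_inner_sym w).
  have h1 : nm (T w) ^+ 2 <= M ^+ 2 * nm w ^+ 2.
    by rewrite -exprMn ler_pXn2r ?nnegrE ?nm_ge0// mulr_ge0 ?nm_ge0 ?ltW.
  have h2 : t ^+ 2 * nm (T w) ^+ 2 <= t * r * nm w ^+ 2.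
    apply: le_trans (ler_wpM2l (sqr_ge0 _) h1) _.
    rewrite le_eqVlt; apply/orP; left; apply/eqP; rewrite /t; field.
    by rewrite gt_eqF.
  by have := cT w; nra.
have dle : d <= 0.
  apply/ler_addgt0Pr => s s0; rewrite add0r.
  (* If [r t > 1] the factor is negative, and [step 0] alone gives [d <= 0]. *)
  have [rt1|rt1] := lerP (r * t) 1; last first.
    have J0 : 0 <= J 0 := sqr_ge0 _.
    by have := step 0; nra.
  have rt0 : 0 < r * t by rewrite mulr_gt0.
  have [|_ [x _ <-] xd] := @inf_adherent _ (range J) (s * (r * t)) _ lbJ.
    by rewrite mulr_gt0.
  have := step x; rewrite -/d in xd => dx.
  have : d <= (1 - r * t) * (d + s * (r * t)).
    by apply: le_trans dx _; rewrite ler_wpM2l ?subr_ge0// ltW.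
  move=> h; rewrite -(ler_pM2r rt0).
  have := mulr_ge0 (ltW s0) (sqr_ge0 (r * t)).
  by move: (r * t) h => p h; lra.
have [|_ [x _ <-] xd] := @inf_adherent _ (range J) (e ^+ 2) _ lbJ.
  by rewrite exprn_gt0.
exists x; rewrite -(ltr_pXn2r (n := 2)) ?nnegrE ?nm_ge0 ?ltW//.
by apply: lt_le_trans xd _; rewrite -[leRHS]add0r lerD2r.
Qed.

End BoundedOperatorFacts.

(** * Joint approximate eigenvalues of commuting operators *)

Section ApproximateSpectrum.
Variables (R : realType) (H : hilbertType R).
Implicit Types (x y z : H) (B S T U : bounded_op H) (W : set H).

Definition perp x (s : seq H) := forall y, y \in s -> inner x y = 0.

(* [N] is a gauge such as [fun x => nm (U x - z *: x)].  With [W = set0] this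
   expresses that [z] is in the approximate point spectrum of [U], and with
   [W = setT] that [U - z] is not left invertible modulo the compacts. *)
Definition approx_null W (N : H -> R) := forall s : seq H,
  (forall y, y \in s -> W y) -> forall e : R, 0 < e ->
  exists x, [/\ nm x = 1, perp x s & N x <= e].

Lemma sub_perp x (s t : seq H) : {subset s <= t} -> perp x t -> perp x s.
Proof. by move=> st xt y /st/xt. Qed.

Lemma perpZ a x (s : seq H) : perp x s -> perp (a *: x) s.
Proof. by move=> xs y /xs h; rewrite innerZl h mulr0. Qed.

Lemma approx_nullW W N N' : (forall x, N' x <= N x) -> approx_null W N ->
  approx_null W N'.
Proof.
move=> NN h s sW e /(h s sW)[x [x1 xs Nx]]; exists x; split=> //.
exact: le_trans (NN x) Nx.
Qed.

(* Take for [b] the limit of the suprema of the numerical range of [B] over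
   the filter of approximate null vectors of [N].  If [<Bx,x>] is close to [b],
   the almost nonnegative form of [D = b + eta - B] is tested on the vector
   [x - t D x], which is again an approximate null vector; this forces [D x] to
   be small. *)
Lemma joint_spectral_value W (N : H -> R) B (m : R) : self_adjoint B ->
  (forall x, W x -> W (B x)) ->
  (forall x y, N (x + y) <= N x + N y) ->
  (forall a x, N (a *: x) = cabs a * N x) ->
  0 <= m -> (forall x, N (B x) <= m * N x) ->
  approx_null W N ->
  exists2 b : R, approx_null W (fun x => N x + nm (B x - b%:C *: x)) &
    forall c, (forall s : seq H, (forall y, y \in s -> W y) ->
      forall e, 0 < e -> exists x,
        [/\ nm x = 1, perp x s, N x <= e & c <= cre (inner (B x) x)]) -> c <= b.
Proof.
move=> hB BW ND NZ m0 NB NW; have [M M0 BM] := op_bound B.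
pose F s e := [set cre (inner (B x) x) | x in
  [set x | [/\ nm x = 1, perp x s & N x <= e]]].
have bB x : nm x = 1 -> `|cre (inner (B x) x)| <= M.
  move=> x1; apply: le_trans (Re_inner_le _ _) _.
  by have := BM x; rewrite x1 !mulr1.
have F_ub s e : has_ubound (F s e).
  by exists M => _ [x [x1 _ _] <-]; apply: le_trans (ler_norm _) (bB x x1).
pose ok (p : seq H * R) := (forall y, y \in p.1 -> W y) /\ 0 < p.2.
have F0 p : ok p -> F p.1 p.2 !=set0.
  move=> [pW p0]; have [x xP] := NW _ pW _ p0.
  by exists (cre (inner (B x) x)), x.
pose V := [set sup (F p.1 p.2) | p in ok].
have V_inf : has_inf V.
  split; first by exists (sup (F [::] 1)), ([::], 1) => //; split.
  exists (- M) => _ [p pok <-]; have [r rF] := F0 _ pok.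
  apply: le_trans (ub_le_sup (F_ub _ _) rF).
  by case: rF => x [x1 _ _] <-; rewrite lerNl (le_trans _ (bB x x1))// -normrN ler_norm.
exists (inf V) => [s sW e e0|c cP]; last first.
  apply: lb_le_inf; first by case: V_inf.
  move=> _ [[s e] [sW e0] <-]; have [x [x1 xs Nx cx]] := cP _ sW _ e0.
  by apply: le_trans cx _; apply: ub_le_sup => //; exists x.
set b := inf V.
(* [m'] bounds the norm of [D = b + eta - B] when [eta <= 1]. The other two bounds on [eta] make
   both [eta] and [nm (D x)] at most [e / 4]. *)
pose m' := `|b| + 1 + M; have m'0 : 0 < m' by rewrite ltr_wpDl// addr_ge0.
pose eta := Num.min 1 (Num.min (e / 4) (e ^+ 2 / (64 * m'))).
have eta0 : 0 < eta.
  by rewrite !lt_min ltr01 !divr_gt0// ?exprn_gt0// mulr_gt0.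
have eta1 : eta <= 1 by rewrite ge_min lexx.
have eta2 : eta <= e / 4 by rewrite !ge_min lexx/= orbT.
have eta3 : 4 * eta * m' <= (e / 4) ^+ 2.
  have : eta <= e ^+ 2 / (64 * m') by rewrite !ge_min lexx/= !orbT.
  rewrite ler_pdivlMr ?mulr_gt0// => h; rewrite expr_div_n; lra.
(* A constraint [(s0, d0)] whose supremum is within [eta] of the infimum [b]: on its vectors the
   form of [D] is positive. *)
have [_ [[s0 d0] [/= s0W d00] <-] /= sd] := inf_adherent eta0 V_inf.
rewrite -/b in sd.
pose K := 1 + (`|b| + 1 + m) / (2 * m').
have K0 : 0 < K.
  by rewrite ltr_pwDl// divr_ge0 ?addr_ge0// mulr_ge0 ?ltW.
(* Orthogonality to [s0] and to its image under [B] keeps [x - t D x] orthogonal to [s0]; the bound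
   [d'] keeps its gauge below [d0] after normalisation. *)
pose s' := s ++ s0 ++ [seq B y | y <- s0].
pose d' := Num.min (e / 2) (d0 / (2 * K)).
have d'0 : 0 < d' by rewrite lt_min !divr_gt0// mulr_gt0.
have s'W y : y \in s' -> W y.
  rewrite !mem_cat => /or3P[/sW//|/s0W//|/mapP[z zs0 ->]].
  exact/BW/s0W.
have [x [x1 xs' Nx] bx] : exists2 x, [/\ nm x = 1, perp x s' & N x <= d'] &
    b - eta < cre (inner (B x) x).
  have bV : b <= sup (F s' d').
    by apply: ge_inf; [case: V_inf|exists (s', d')].
  have F'sup : has_sup (F s' d') by split=> //; exact: (F0 (s', d')).
  have [_ [x xP <-] xb] := sup_adherent eta0 F'sup.
  by exists x => //; apply: le_lt_trans xb; rewrite lerD2r.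
pose D := (b + eta)%:C *: (1 : bounded_op H) - B.
have hD : self_adjoint D by apply: adjointB => //; apply/self_adjointZ/adjoint1.
have DE z : D z = (b + eta)%:C *: z - B z by [].
clearbody D.
have Db z : nm (D z) <= m' * nm z.
  rewrite DE (le_trans (nmBD _ _))// nmZr /m' mulrDl lerD// ler_wpM2r ?nm_ge0//.
  by rewrite (le_trans (ler_normD _ _))// lerD2l ger0_norm// ltW.
have ND0 z : N (D z) <= (`|b| + 1 + m) * N z.
  have N0 : 0 <= N z.
    have := ND z (- z); rewrite subrr -[- z]scaleN1r NZ cabsN cabs1 mul1r.
    by have := NZ 0 0; rewrite scale0r cabs0 mul0r => ->; lra.
  rewrite DE; apply: le_trans (ND _ _) _.
  rewrite -scaleN1r !NZ cabsN cabs1 mul1r cabs_real mulrDl lerD// ler_wpM2r//.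
  by rewrite (le_trans (ler_normD _ _))// lerD2l ger0_norm// ltW.
pose h := D x; have hE : h = D x by []; clearbody h.
(* With this [t] the correction has norm at most [1 / 2], so [y] can be normalised. *)
pose t := (2 * m')^-1; pose y := x - t%:C *: h.
have t0 : 0 < t by rewrite invr_gt0 mulr_gt0.
have th : nm (t%:C *: h) <= 2^-1.
  rewrite nmZr gtr0_norm// /t invfM -mulrA -[leRHS]mulr1 ler_wpM2l ?invr_ge0//.
  by rewrite ler_pdivrMl// mulr1 hE (le_trans (Db x))// x1 mulr1.
have y2 : 2^-1 <= nm y by have := nmB_ge x (t%:C *: h); rewrite -/y; lra.
have ny0 : 0 < nm y by apply: lt_le_trans y2; rewrite invr_gt0.
have ys0 : perp y s0.
  move=> z zs0; rewrite /y hE DE !innerE.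
  have -> : inner x z = 0 by apply: xs'; rewrite !mem_cat zs0 orbT.
  have -> : inner (B x) z = 0.
    by rewrite hB; apply: xs'; rewrite !mem_cat map_f ?orbT.
  by rewrite mulr0 oppr0 addr0 mulr0 oppr0 addr0.
have Ny : N y <= K * d'.
  apply: le_trans (ND _ _) _; rewrite -scaleNr NZ cabsN cabs_real gtr0_norm//.
  rewrite /K mulrDl mul1r lerD// mulrAC mulrC ler_wpM2r ?invr_ge0 ?mulr_ge0 ?(ltW m'0)//.
  by rewrite hE (le_trans (ND0 x))// ler_wpM2l// !addr_ge0.
have Dy : 0 <= cre (inner (D y) y).
  have yF : cre (inner (B ((nm y)^-1%:C *: y)) ((nm y)^-1%:C *: y)) <= sup (F s0 d0).
    apply: ub_le_sup => //; exists ((nm y)^-1%:C *: y) => //; split.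
    - by rewrite normalizeP// -nm_gt0.
    - exact: perpZ.
    - rewrite NZ cabs_real gtr0_norm ?invr_gt0// ler_pdivrMl//.
      apply: le_trans Ny _.
      have : d' <= d0 / (2 * K) by rewrite ge_min lexx orbT.
      rewrite ler_pdivlMr ?mulr_gt0//.
      by have := ler_wpM2r (ltW d00) y2; lra.
  have := le_lt_trans yF sd.
  rewrite opxZ innerZl innerZr conjc_real !creZ mulrA -invfM mulrC ltr_pdivrMr ?mulr_gt0//.
  by rewrite DE innerDl innerZl creD creZ innerNl creN -nm_sqr; lra.
have hh : nm h ^+ 2 <= 4 * eta * m'.
  have Dh : cre (inner (D h) h) <= m' * nm h ^+ 2.
    apply: le_trans (ler_norm _) (le_trans (Re_inner_le _ _) _).
    by rewrite expr2 mulrA ler_wpM2r ?nm_ge0.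
  have Dyy : cre (inner (D y) y) =
      cre (inner h x) - 2 * t * nm h ^+ 2 + t ^+ 2 * cre (inner (D h) h).
    have Dhx : inner (D h) x = inner h h by rewrite hD hE.
    rewrite /y opxB opxZ -hE !innerE Dhx conjc_real.
    by rewrite !(creD, creN, creZ) nm_sqr; ring.
  move: Dy; rewrite Dyy.
  have -> : cre (inner h x) = b + eta - cre (inner (B x) x).
    by rewrite hE DE !innerE creD creZ creN -nm_sqr x1 expr1n mulr1.
  have tm : t * m' = 2^-1 by rewrite /t invfM mulrAC mulfK// gt_eqF.
  move: Dh bx; have := sqr_ge0 (nm h).
  move: (nm h ^+ 2) (cre (inner (D h) h)) (cre (inner (B x) x)) => p q r p0 qp br H1.
  have h2 : t * q <= 2^-1 * p by rewrite -tm -mulrA ler_wpM2l// ltW.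
  have H2 : 0 <= 2 * eta - t * p * 2 + t * (2^-1 * p).
    by have := ler_wpM2l (ltW t0) h2; lra.
  have H3 : 0 <= 2 * eta * m' - 3 / 2 * (t * m') * p.
    by have := mulr_ge0 (ltW m'0) H2; lra.
  by move: H3; rewrite tm; lra.
have hm : nm h <= e / 4.
  rewrite -(ler_pXn2r (n := 2)) ?nnegrE ?nm_ge0 ?divr_ge0 ?(ltW e0)//.
  exact: le_trans hh eta3.
exists x; split=> //.
  by apply: sub_perp xs' => z; rewrite !mem_cat => ->.
have -> : B x - b%:C *: x = eta%:C *: x - h.
  rewrite hE DE rmorphD/= scalerDl opprB addrCA; congr (_ + _).
  by rewrite opprD addrCA subrr addr0.
have d'e : d' <= e / 2 by rewrite ge_min lexx.
by have := nmBD (eta%:C *: x) h; rewrite nmZr x1 gtr0_norm//; lra.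
Qed.

Lemma orthonormal_sequence (Q : nat -> H -> Prop) :
  (forall n (s : seq H), exists x, [/\ nm x = 1, perp x s & Q n x]) ->
  exists2 g : nat -> H,
    forall m n, inner (g m) (g n) = (m == n)%:R & forall n, Q n (g n).
Proof.
move=> hQ; have /choice[F FP] : forall p : nat * seq H, exists x,
    [/\ nm x = 1, perp x p.2 & Q p.1 x] by move=> [n s]; exact: hQ.
(* The recursion carries the list of all vectors chosen so far. *)
pose L := fix L n := if n is k.+1 then F (k, L k) :: L k else [::].
have gL m n : (m < n)%N -> F (m, L m) \in L n.
  elim: n => // n IH; rewrite ltnS leq_eqVlt => /predU1P[->|/IH mn].
    by rewrite /= in_cons eqxx.
  by rewrite /= in_cons mn orbT.
have lt m n : (m < n)%N -> inner (F (n, L n)) (F (m, L m)) = 0.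
  by move=> mn; have [_ + _] := FP (n, L n); apply; exact: gL.
exists (fun n => F (n, L n)) => [m n|n]; last by have [] := FP (n, L n).
have [mn|mn|<-] := ltngtP m n; [|exact: lt|].
  exact/inner_eq0_sym/lt.
by have [x1 _ _] := FP (m, L m); rewrite inner_self x1 expr1n.
Qed.

End ApproximateSpectrum.

(** * Finite rank operators and the essential spectrum *)

Section FiniteRank.
Variables (R : realType) (H : hilbertType R).
Implicit Types (x y z v w : H) (S T U : bounded_op H).

Lemma rank1_bounded v w : (fun x => inner x v *: w) \in @bounded_linear _ H.
Proof.
apply/asboolP; split=> [a x y|]; first by rewrite !innerE scalerDl scalerA.
exists (nm v * nm w)%:C => x; rewrite !normE -rmorphM/= lecR nmZ.
by rewrite mulrAC ler_wpM2r ?nm_ge0// mulrC cauchy_schwarz.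
Qed.

Definition rank1 v w : bounded_op H := BoundedOp (rank1_bounded v w).

Lemma rank1E v w x : rank1 v w x = inner x v *: w. Proof. by []. Qed.

Lemma op_sum (I : Type) (s : seq I) (P : pred I) (F : I -> bounded_op H) x :
  (\sum_(i <- s | P i) F i) x = \sum_(i <- s | P i) F i x.
Proof. by apply: (big_morph (fun T : bounded_op H => T x)). Qed.

Lemma adjoint_rank1 v w : adjoint_of (rank1 v w) (rank1 w v).
Proof. by move=> x y; rewrite !rank1E !innerE -inner_sym mulrC. Qed.

Lemma adjoint_sum n (F G : 'I_n -> bounded_op H) :
  (forall i, adjoint_of (F i) (G i)) -> adjoint_of (\sum_i F i) (\sum_i G i).
Proof.
move=> FG x y; rewrite !op_sum inner_suml inner_sumr.
by apply: eq_bigr => i _; exact: FG.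
Qed.

(** The disc lies in the continuous image of a square, a product of two real segments. *)
Lemma complex_disc_compact (r : R) :
  exists2 D : set R[i]^o, compact D & [set c : R[i] | `|c| <= r%:C] `<=` D.
Proof.
pose f (p : R * R) := (p.1 +i* p.2 : R[i]^o).
exists (f @` (`[- r, r]%classic `*` `[- r, r]%classic)).
  apply: continuous_compact; last by apply: compact_setX; exact: segment_compact.
  apply: continuous_subspaceT => -[a b]; apply/cvgrPdist_lt => e.
  rewrite ltcE => /= /andP[/eqP ei e0].
  have e20 : 0 < cre e / 2 by rewrite divr_gt0.
  exists ([set u | `|a - u| < cre e / 2], [set u | `|b - u| < cre e / 2]).
    by split; [exact: (@nbhsx_ballx _ _ a _ e20)|exact: (@nbhsx_ballx _ _ b _ e20)].
  move=> [u v] [/= ua vb]; rewrite cabsE ltcE /= ei eqxx/=.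
  have -> : f (a, b) - f (u, v) = (a - u)%:C + (0 +i* 1) * (b - v)%:C.
    rewrite -[LHS]/((a +i* b : R[i]) - (u +i* v)).
    by apply: complex_eq; rewrite !(creD, creN, creM, cimD, cimN, cimM) /=; ring.
  apply: le_lt_trans (cabsD _ _) _; rewrite cabsM !cabs_real.
  by rewrite cabs_i mul1r; lra.
move=> c /=; rewrite cabsE lecR => cr; exists (cre c, cim c); last first.
  by rewrite /f; case: c {cr}.
by split; rewrite /= in_itv /= -ler_norml; apply: le_trans cr;
  [exact: cabs_Re_le|exact: cabs_Im_le].
Qed.

Lemma rank1_compact v w : rank1 v w \in @compact_op _ H.
Proof.
have [D cD sD] := complex_disc_compact (nm v).
apply/asboolP; apply: (@compact_sub _ _ _ ((fun c : R[i]^o => c *: w) @` D)).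
  by apply: continuous_compact => //; apply/continuous_subspaceT/scalel_continuous.
move=> _ [x + <-]; rewrite /unit_ball /= normE lecR => x1.
exists (inner x v) => //; apply: sD; rewrite /= cabsE lecR.
by apply: le_trans (cauchy_schwarz _ _) _; rewrite ler_piMl ?nm_ge0.
Qed.

Definition orthonormal n (e : 'I_n -> H) :=
  forall i j, inner (e i) (e j) = (i == j)%:R.

Definition span_proj n (e : 'I_n -> H) : bounded_op H := \sum_i rank1 (e i) (e i).

Lemma span_projE n (e : 'I_n -> H) x : span_proj e x = \sum_i inner x (e i) *: e i.
Proof. by rewrite /span_proj op_sum. Qed.

Lemma inner_span_proj n (e : 'I_n -> H) x i : orthonormal e ->
  inner (span_proj e x) (e i) = inner x (e i).
Proof.
move=> he; rewrite span_projE inner_suml (bigD1 i)//= big1 => [|j ji].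
  by rewrite addr0 innerZl he eqxx mulr1.
by rewrite innerZl he (negbTE ji) mulr0.
Qed.

Lemma span_proj_id n (e : 'I_n -> H) i : orthonormal e -> span_proj e (e i) = e i.
Proof.
move=> he; rewrite span_projE (bigD1 i)//= big1 => [|j ji].
  by rewrite addr0 he eqxx scale1r.
by rewrite he eq_sym (negbTE ji) scale0r.
Qed.

Lemma span_projP n (e : 'I_n -> H) : orthonormal e -> projection (span_proj e).
Proof.
move=> he; split; last by apply: adjoint_sum => i; exact: adjoint_rank1.
apply: bounded_op_inj => x; rewrite opM [RHS]span_projE span_projE.
by apply: eq_bigr => i _; rewrite inner_span_proj.
Qed.

Lemma span_proj_compact n (e : 'I_n -> H) : span_proj e \in @compact_op _ H.
Proof. by apply: rpred_sum => i _; exact: rank1_compact. Qed.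

(** The span of [s] is recorded only through orthogonality, so a vector depending on the others can
    simply be dropped. *)
Lemma gram_schmidt (s : seq H) : exists n, exists2 e : 'I_n -> H,
  orthonormal e & forall x, (forall i, inner x (e i) = 0) -> perp x s.
Proof.
elim: s => [|y s [n [e he es]]]; first by exists 0, (fun=> 0) => // -[].
pose v := y - span_proj e y.
have ve i : inner v (e i) = 0 by rewrite innerBl inner_span_proj// subrr.
have perp_y x : (forall i, inner x (e i) = 0) -> inner x v = 0 -> inner x y = 0.
  move=> xe; rewrite innerBr span_projE inner_sumr big1 ?subr0// => i _.
  by rewrite innerZr xe mulr0.
have [v0|v0] := eqVneq v 0.
  exists n, e => // x xe z; rewrite in_cons => /predU1P[->|]; last exact: es.
  by apply: perp_y => //; rewrite v0 inner0r.
exists n.+1, (fun i => if unlift ord0 i is Some j then e j else (nm v)^-1%:C *: v).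
  move=> i j; case: unliftP => [i'|] ->; case: unliftP => [j'|] ->.
  - by rewrite he (inj_eq lift_inj).
  - by rewrite innerZr inner_eq0_sym// mulr0 eq_sym (negbTE (neq_lift _ _)).
  - by rewrite innerZl ve mulr0 (negbTE (neq_lift _ _)).
  - by rewrite inner_self normalizeP// expr1n eqxx.
move=> x xe; have xe' i : inner x (e i) = 0 by have := xe (lift ord0 i); rewrite liftK.
move=> z; rewrite in_cons => /predU1P[->|]; last exact: es.
apply: perp_y => //; have := xe ord0; rewrite unlift_none innerZr conjc_real.
move/eqP; rewrite mulf_eq0 => /orP[/eqP/(congr1 (@complex.Re R))/= h|/eqP//].
by move: h => /eqP; rewrite invr_eq0 nm_eq0 (negbTE v0).
Qed.

(* Solving [(T - sum_i rank1 (v i) (w i)) x = y] reduces to a square linear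
   system for the coordinates [inner x (v i)]. *)
Lemma finite_rank_perturbation T n (v w : 'I_n -> H) :
  (forall y, exists x, T x = y) ->
  (forall x, (T - \sum_i rank1 (v i) (w i)) x = 0 -> x = 0) ->
  forall y, exists x, (T - \sum_i rank1 (v i) (w i)) x = y.
Proof.
move=> Tsurj inj y.
have FE x : (T - \sum_i rank1 (v i) (w i)) x = T x - \sum_i inner x (v i) *: w i.
  by rewrite opB op_sum.
have [y' Ty'] := Tsurj y.
have /choice[u Tu] : forall i, exists x, T x = w i by move=> i; exact: Tsurj.
pose A : 'M[R[i]]_n := \matrix_(i, j) inner (u i) (v j).
pose d : 'rV[R[i]]_n := \row_j inner y' (v j).
have coord (c : 'rV[R[i]]_n) j : inner (\sum_i c 0 i *: u i) (v j) = (c *m A) 0 j.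
  by rewrite inner_suml mxE; apply: eq_bigr => i _; rewrite innerZl mxE.
have Tc (c : 'rV[R[i]]_n) : T (\sum_i c 0 i *: u i) = \sum_i c 0 i *: w i.
  by rewrite opx_sum; apply: eq_bigr => i _; rewrite opxZ Tu.
have Aunit : 1%:M - A \in unitmx.
  rewrite -row_free_unit -kermx_eq0; apply/eqP/row_matrixP => i; rewrite row0.
  set c := row i _; have : c *m (1%:M - A) = 0 by rewrite -row_mul mulmx_ker row0.
  rewrite mulmxBr mulmx1 => /eqP; rewrite subr_eq0 => /eqP cA.
  have x0 : \sum_i c 0 i *: u i = 0.
    apply: inj; rewrite FE Tc; apply/eqP; rewrite subr_eq0; apply/eqP.
    by apply: eq_bigr => j _; rewrite coord -cA.
  by apply/rowP => j; rewrite cA -coord x0 inner0l mxE.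
pose c := d *m invmx (1%:M - A).
have cE : c - c *m A = d by rewrite -{1}[c]mulmx1 -mulmxBr mulmxKV.
exists (y' + \sum_i c 0 i *: u i).
rewrite FE opxD Ty' Tc -addrA -sumrB big1 ?addr0// => i _.
rewrite innerDl coord -scalerBl.
have := congr1 (fun m : 'rV_n => m 0 i) cE; rewrite !mxE => <-.
by rewrite subrK subrr scale0r.
Qed.

End FiniteRank.

Lemma coercive_inverse (R : realType) (H : hilbertType R) (T : bounded_op H) (r : R) :
  0 < r -> (forall x, r * nm x ^+ 2 <= cre (inner (T x) x)) ->
  exists2 S, T * S = 1 & S * T = 1.
Proof.
move=> r0 cT; have /choice[g Tg] := lax_milgram r0 cT.
have bT x : r * nm x <= nm (T x) by exact: coercive_below.
have injT x y : T x = T y -> x = y.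
  move=> Txy; apply/eqP; rewrite -subr_eq0 -nm_eq0 eq_le nm_ge0 andbT.
  by have := bT (x - y); rewrite opxB Txy subrr nm0 pmulr_rle0.
have [a x y|x|S SE] := @bounded_op_build R H g r^-1.
- by apply: injT; rewrite Tg opxD opxZ !Tg.
- by rewrite mulrC ler_pdivlMr// mulrC (le_trans (bT _))// Tg.
by exists S; apply: bounded_op_inj => x; rewrite opM SE; [rewrite Tg|apply: injT; rewrite Tg].
Qed.

Section EssentialSpectrum.
Variables (R : realType) (H : hilbertType R).
Implicit Types (x y z : H) (S T U : bounded_op H) (c : R[i]).

Lemma calkin_piB1 U c :
  calkin_pi U - c *: (1 : calkin H) = calkin_pi (U - c *: (1 : bounded_op H)).
Proof.
rewrite -[c *: (1 : calkin H)]/(calkin_scale c (calkin_pi 1)) -calkin_piZ.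
by apply/eqP; rewrite subr_eq -calkin_piD subrK.
Qed.

Lemma calkin_pi_mul S T : calkin_pi S * calkin_pi T = calkin_pi (S * T).
Proof. by rewrite calkin_piM. Qed.

Definition ess_approx U c := approx_null setT (fun x => nm (U x - c *: x)).

(* A left inverse [B] of [U - c] modulo the compacts maps [(U - c) g_n] near
   [0] for an orthonormal sequence [g], so that a compact operator moves [g_n]
   near [- g_n], whose terms are at distance [sqrt 2]. *)
Lemma ess_approx_spectrum U c : ess_approx U c -> ess_spectrum U c.
Proof.
move=> Uc [b [_]]; rewrite calkin_piB1 -[b]calkin_piK calkin_pi_mul.
set B := repr b => /calkin_piE; set K := _ - 1 => /asboolP[A KA [cA _]].
have [M M0 BM] := op_bound B.
have [n s|g gg Qg] := @orthonormal_sequence _ H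
    (fun _ x => nm (U x - c *: x) <= (8 * M)^-1).
  have M8 : 0 < (8 * M)^-1 by rewrite invr_gt0 mulr_gt0.
  by have [//|x [x1 xs Ux]] := Uc s _ _ M8; exists x.
have Kg n : nm (K (g n) + g n) <= 8^-1.
  have -> : K (g n) + g n = B (U (g n) - c *: g n) by rewrite /K opB subrK.
  apply: le_trans (BM _) _; rewrite mulrC -ler_pdivlMr// -invfM.
  exact: Qg.
have F : ProperFilter ((K \o g) @ \oo) by exact: fmap_proper_filter.
have [|p [_ clp]] := cA _ F.
  exists 0 => // n _ /=; apply: KA; exists (g n) => //.
  rewrite /unit_ball /= normE lecR -(ler_pXn2r (n := 2)) ?nnegrE ?nm_ge0//.
  by rewrite nm_sqr gg eqxx expr1n.
have near_p N : exists2 n, (N <= n)%N & nm (p - K (g n)) < 4^-1.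
  pose tail := [set K (g n) | n in [set n | (N <= n)%N]].
  have [||_ [[n Nn <-] pn]] := clp tail (ball p (4^-1)%:C).
  - by exists N => // n Nn; exists n.
  - by apply: nbhsx_ballx; rewrite ltcR invr_gt0.
  by exists n => //; move: pn; rewrite -ball_normE /= normE ltcR.
have [m _ pm] := near_p 0; have [n mn pn] := near_p m.+1.
have : nm (g m - g n) ^+ 2 = 2.
  rewrite nm_sqrB !nm_sqr !gg !eqxx (ltn_eqF mn) /=; lra.
have : nm (g m - g n) <= 1.
  have -> : g m - g n = (K (g m) + g m - (K (g n) + g n)) - (K (g m) - K (g n)).
    by rewrite opprD addrACA [K _ - _ + _]addrC addrK.
  have := nmBD (K (g m) + g m - (K (g n) + g n)) (K (g m) - K (g n)).
  have := nmBD (K (g m) + g m) (K (g n) + g n).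
  have := nmD (K (g m) - p) (p - K (g n)).
  rewrite addrA subrK (nmB (K (g m)) p).
  by have := Kg m; have := Kg n; lra.
by have := nm_ge0 (g m - g n); nra.
Qed.

Lemma sub_scalar_comm U V a b : U * V = V * U ->
  (U - a *: (1 : bounded_op H)) * (V - b *: (1 : bounded_op H)) =
  (V - b *: (1 : bounded_op H)) * (U - a *: (1 : bounded_op H)).
Proof.
move=> UVC; apply: bounded_op_inj => x.
have := congr1 (fun T : bounded_op H => T x) UVC.
rewrite !opM !opB !opZ !op1 !opxB !opxZ => ->; rewrite !scalerBr !scalerA mulrC.
by rewrite !opprB addrACA [RHS]addrACA; congr (_ + _); exact: addrC.
Qed.

Lemma not_approx_null_below T : ~ approx_null setT (fun x => nm (T x)) ->
  exists s : seq H, exists2 e : R, 0 < e & forall x, perp x s -> e * nm x <= nm (T x).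
Proof.
move=> nT; apply: contrapT => h; apply: nT => s _ e e0; apply: contrapT => hx.
apply: h; exists s, e => // x xs; have [->|x0] := eqVneq x 0.
  by rewrite nm0 mulr0 nm_ge0.
rewrite -ler_pdivlMr ?nm_gt0// leNgt; apply/negP => Tx; apply: hx.
exists ((nm x)^-1%:C *: x); split; [exact: normalizeP|exact: perpZ|].
by rewrite opxZ nmZr ger0_norm ?invr_ge0 ?nm_ge0// mulrC ltW.
Qed.

(* If [N] is bounded below by [e] on the orthocomplement of a finite set, then
   [N* N + Q] is coercive for the finite rank projection [Q] onto its span. *)
Lemma approx_null_spectrum U V c : adjoint_of U V -> U * V = V * U ->
  ess_spectrum U c -> ess_approx U c.
Proof.
move=> UV UVC; apply: contraPP => Uc; apply.
pose N := U - c *: (1 : bounded_op H); pose N' := V - conjc c *: (1 : bounded_op H).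
have NN' : adjoint_of N N' by apply/adjointB/adjointZ/adjoint1.
have NC : N * N' = N' * N by exact: sub_scalar_comm.
have {}Uc : ~ approx_null setT (fun x => nm (N x)) by [].
rewrite calkin_piB1 -/N; clearbody N N'; clear UV UVC.
have [s [e e0 sN]] := not_approx_null_below Uc; clear Uc.
have [n [f hf fs]] := gram_schmidt s.
pose Q := span_proj f; have [QQ hQ] := span_projP hf.
pose G := N' * N + Q.
have [M M0 NM] := op_bound N.
(* Splitting [x] along [Q] gives [e |x| <= |N x| + (M + e) |Q x|], and the square of the right side
   is at most [2 (1 + (M + e)^2) (|N x|^2 + |Q x|^2)]. *)
pose k := 2 * (1 + (M + e) ^+ 2) / e ^+ 2.
have k0 : 0 < k.
  by rewrite divr_gt0 ?exprn_gt0// mulr_gt0// ltr_wpDr// sqr_ge0.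
have GE x : cre (inner (G x) x) = nm (N x) ^+ 2 + nm (Q x) ^+ 2.
  have QxE : inner (Q x) (Q x) = inner (Q x) x.
    by rewrite -hQ -[Q (Q x)]/((Q * Q) x) QQ.
  by rewrite opD innerDl creD !nm_sqr opM (adjoint_sym NN') QxE.
have cG x : k^-1 * nm x ^+ 2 <= cre (inner (G x) x).
  rewrite GE ler_pdivrMl// /k mulrAC ler_pdivlMr ?exprn_gt0//.
  have xQ : e * nm (x - Q x) <= nm (N (x - Q x)).
    by apply/sN/fs => i; rewrite innerBl inner_span_proj// subrr.
  have h1 := nmBD (N x) (N (Q x)); rewrite -opxB in h1.
  have h2 := nmD (x - Q x) (Q x); rewrite subrK in h2.
  have h3 : e * nm x <= nm (N x) + (M + e) * nm (Q x).
    by have := ler_wpM2l (ltW e0) h2; have := NM (Q x); lra.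
  have h4 : (e * nm x) ^+ 2 <= (nm (N x) + (M + e) * nm (Q x)) ^+ 2.
    by rewrite ler_pXn2r ?nnegrE// ?addr_ge0 ?mulr_ge0 ?nm_ge0// ?addr_ge0 ?ltW.
  move: h4; rewrite mulrC -exprMn mulrC.
  move: (nm (N x)) (nm (Q x)) (M + e) => p q r h4; apply: le_trans h4 _.
  have := sqr_ge0 (p - r * q); have := sqr_ge0 q; have := sqr_ge0 (r * p).
  by nra.
have k'0 : 0 < k^-1 by rewrite invr_gt0.
have [G' GG' G'G] := coercive_inverse k'0 cG.
have cQ : Q \in @compact_op _ H := span_proj_compact f.
have GE0 : G = N' * N + Q by [].
clearbody G Q.
have l1 : calkin_pi (G' * N') * calkin_pi N = 1.
  rewrite calkin_pi_mul; apply/calkin_piE.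
  rewrite (_ : G' * N' * N - 1 = - (G' * Q)) ?rpredN ?compact_op_comp_l//.
  by rewrite -G'G GE0 mulrDr mulrA opprD addrA subrr add0r.
(* Normality makes [N' * G'] a right inverse; a left and a right inverse then coincide. *)
have r1 : calkin_pi N * calkin_pi (N' * G') = 1.
  rewrite calkin_pi_mul; apply/calkin_piE.
  rewrite (_ : N * (N' * G') - 1 = - (Q * G')) ?rpredN ?compact_op_comp_r//.
  by rewrite -GG' GE0 mulrDl mulrA NC opprD addrA subrr add0r.
exists (calkin_pi (G' * N')); split=> //.
have -> // : calkin_pi (G' * N') = calkin_pi (N' * G').
by rewrite -[LHS]mulr1 -r1 mulrA l1 mul1r.
Qed.

End EssentialSpectrum.

(** * Sufficiency *)

Section CommonNorm.
Variables (R : realType) (H : hilbertType R).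
Implicit Types (x y z : H) (P S T U V L : bounded_op H) (a b : R[i]).

Lemma projK P x : projection P -> P (P x) = P x.
Proof. by case=> PP _; rewrite -opM PP. Qed.

Lemma proj_pythagoras P x : projection P ->
  nm x ^+ 2 = nm (P x) ^+ 2 + nm (x - P x) ^+ 2.
Proof.
move=> hP; rewrite -pythagoras ?subrKC//; case: (hP) => _ sP.
by rewrite sP opxB projK// subrr inner0r.
Qed.

Lemma proj_le P x : projection P -> nm (P x) <= nm x.
Proof.
move=> hP; rewrite -(ler_pXn2r (n := 2)) ?nnegrE ?nm_ge0//.
by rewrite (proj_pythagoras x hP) lerDl sqr_ge0.
Qed.

Lemma proj_inner P x : projection P -> inner (P x) (P x) = inner (P x) x.
Proof. by move=> hP; case: (hP) => _ sP; rewrite -sP projK. Qed.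

Lemma comm_opZ a S T : S * T = T * S -> (a *: S) * T = T * (a *: S).
Proof.
by move=> ST; apply: bounded_op_inj => x; rewrite !(opM, opZ) opxZ -!opM ST.
Qed.

Lemma corner_affine P U a b : projection P ->
  P * (a *: (1 : bounded_op H) + b *: U) * (1 - P) = b *: (P * U * (1 - P)).
Proof.
move=> hP; apply: bounded_op_inj => x; rewrite !(opM, opZ, opD) opxD !opxZ op1.
by rewrite [P ((1 - P) x)]opxB projK// subrr scaler0 add0r.
Qed.

Lemma common_norm_affine U a b : common_norm U ->
  common_norm (a *: (1 : bounded_op H) + b *: U).
Proof.
move=> hU P hP; have P'P : 1 - (1 - P) = P by rewrite opprB addrC subrK.
rewrite corner_affine// -[X in _ = opnorm (_ * X)]P'P.
rewrite corner_affine; last exact: projection1B.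
by rewrite P'P !opnormZ hU.
Qed.

Lemma adjoint_corner P U V : projection P -> adjoint_of U V ->
  adjoint_of (P * U * (1 - P)) ((1 - P) * V * P).
Proof.
move=> hP UV; rewrite -[_ * V * P]mulrA.
apply: adjointM; first by apply: adjointM => //; case: hP.
by case: (projection1B hP).
Qed.

Lemma self_adjoint_common_norm L : self_adjoint L -> common_norm L.
Proof. by move=> hL P hP; exact/opnorm_adjoint/adjoint_corner. Qed.

(** [V] stands for the adjoint of [U], carried as an argument because adjoints are given by a
    relation. *)
Definition re_part U V : bounded_op H := (2^-1)%:C *: (U + V).
Definition im_part U V : bounded_op H := (0 -i* 2^-1) *: (U - V).

Lemma re_part_self_adjoint U V : adjoint_of U V -> self_adjoint (re_part U V).
Proof.
move=> UV; apply: self_adjointZ => x y.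
by rewrite !opD !innerE UV (adjoint_sym UV) addrC.
Qed.

Lemma im_part_self_adjoint U V : adjoint_of U V -> self_adjoint (im_part U V).
Proof.
move=> UV x y; rewrite !opZ !opB !innerE UV (adjoint_sym UV) -opprB mulrN -mulNr.
by congr (_ * _); apply: complex_eq; rewrite /= ?oppr0.
Qed.

Lemma re_im_partE U V x : U x = re_part U V x + (0 +i* 1) *: im_part U V x.
Proof.
rewrite /re_part /im_part !opZ scalerA.
rewrite (_ : (0 +i* 1) * (0 -i* 2^-1) = (2^-1)%:C :> R[i]); last first.
  by apply: complex_eq; rewrite ?(creM, cimM) /=; ring.
rewrite -scalerDr opB opD addrACA subrr addr0 scalerDr -scalerDl.
rewrite (_ : _ + _ = 1) ?scale1r//.
by apply: complex_eq; rewrite ?(creD, cimD) /=; field.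
Qed.

Lemma re_im_part_adjE U V x : V x = re_part U V x - (0 +i* 1) *: im_part U V x.
Proof.
rewrite /re_part /im_part !opZ scalerA.
rewrite (_ : (0 +i* 1) * (0 -i* 2^-1) = (2^-1)%:C :> R[i]); last first.
  by apply: complex_eq; rewrite ?(creM, cimM) /=; ring.
rewrite -scalerBr opB opD opprB [U x + V x]addrC addrACA subrr addr0.
rewrite scalerDr -scalerDl (_ : _ + _ = 1) ?scale1r//.
by apply: complex_eq; rewrite ?(creD, cimD) /=; field.
Qed.

Lemma unitary_nm U V x : adjoint_of U V -> V * U = 1 -> nm (U x) = nm x.
Proof.
move=> UV VU; apply/eqP; rewrite -(eqrXn2 (n := 2)) ?nm_ge0//.
by rewrite !nm_sqr UV -opM VU op1.
Qed.

(* Otherwise the real part of [U] has an essential approximate eigenvalue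
   not above [- e], which extends to one of [U] itself. *)
Lemma ess_lower_bound U V (e : R) : adjoint_of U V -> U * V = V * U ->
  ess_spectrum U `<=` [set z | 0 <= cre z] -> 0 < e ->
  exists s : seq H, forall x, perp x s -> - e * nm x ^+ 2 <= cre (inner (U x) x).
Proof.
move=> UV UVC sU e0; apply: contrapT => hs.
pose B := - re_part U V; pose C := im_part U V.
have hB : self_adjoint B by apply/adjointN/re_part_self_adjoint.
have hC : self_adjoint C by exact: im_part_self_adjoint.
have cB x : cre (inner (B x) x) = - cre (inner (U x) x).
  rewrite /B opN innerNl creN opZ innerZl creZ opD innerDl creD (adjoint_sym UV).
  by rewrite (Re_inner_sym x); lra.
have BC x : B (C x) = C (B x).
  have : B * C = C * B; last by move/(congr1 (fun T : bounded_op H => T x)).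
  rewrite /B mulNr mulrN; congr (- _); apply: comm_opZ; apply/esym/comm_opZ.
  rewrite mulrBl mulrBr !mulrDr !mulrDl UVC !opprD !addrA.
  by congr (_ + _).
have ex (s : seq H) : exists x, [/\ nm x = 1, perp x s & e <= cre (inner (B x) x)].
  apply: contrapT => h; apply: hs; exists s => x xs.
  have [->|x0] := eqVneq x 0; first by rewrite nm0 expr0n mulr0 inner0r.
  rewrite leNgt; apply/negP => hx; apply: h.
  exists ((nm x)^-1%:C *: x); split; [exact: normalizeP|exact: perpZ|].
  rewrite cB opxZ innerZl innerZr conjc_real !creZ mulrA -expr2 exprVn -mulrN.
  by rewrite mulrC ler_pdivlMr ?exprn_gt0 ?nm_gt0// lerNr -mulNr ltW.
(* With the zero gauge only orthogonality constrains the vectors, and [ex] then forces [e <= b]. *)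
have [b b1 /(_ e) be] : exists2 b : R,
    approx_null setT (fun x => 0 + nm (B x - b%:C *: x)) &
    forall c, (forall s : seq H, (forall y, y \in s -> [set: H] y) ->
      forall d : R, 0 < d -> exists x,
        [/\ nm x = 1, perp x s, 0 <= d & c <= cre (inner (B x) x)]) -> c <= b.
  apply: (@joint_spectral_value _ _ setT (fun=> 0) B 0) => //.
  - by move=> x y; rewrite addr0.
  - by move=> a x; rewrite mulr0.
  - by move=> x; rewrite mulr0.
  - by move=> s _ d d0; have [x [x1 xs _]] := ex s; exists x; rewrite (ltW d0).
have {}be : e <= b.
  by apply: be => s _ d d0; have [x [x1 xs ex']] := ex s; exists x; rewrite (ltW d0).
pose N x := nm (B x - b%:C *: x).
have [M M0 CM] := op_bound C.
(* [C] commutes with [B] and so respects the gauge [N]; its value [c] completes [- b] to an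
   essential approximate eigenvalue [- b + i c] of [U]. *)
have [||||||c c1 _] := @joint_spectral_value _ _ setT N C M hC.
- by [].
- move=> x y; rewrite /N opxD scalerDr opprD addrACA; exact: nmD.
- by move=> a x; rewrite /N opxZ scalerA mulrC -scalerA -scalerBr nmZ.
- exact: ltW.
- by move=> x; rewrite /N BC -opxZ -opxB CM.
- by apply: approx_nullW b1 => x; rewrite add0r.
have /ess_approx_spectrum/sU /= : ess_approx U (- b +i* c).
  apply: approx_nullW c1 => x; rewrite /N.
  have -> : U x - (- b +i* c) *: x =
      (0 +i* 1) *: (C x - c%:C *: x) - (B x - b%:C *: x).
    rewrite [(- b +i* c) *: x](_ : _ = (0 +i* 1) *: (c%:C *: x) - b%:C *: x).
      rewrite (re_im_partE U V x) /B opN scalerBr !opprB opprK addrACA [RHS]addrC.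
      by congr (_ + _); exact: addrC.
    rewrite scalerA -scalerBl; congr (_ *: _).
    by apply: complex_eq; rewrite /= ?(creD, creM, creN, cimD, cimM, cimN)/=; ring.
  by apply: le_trans (nmBD _ _) _; rewrite nmZ addrC cabs_i mul1r.
by rewrite oppr_ge0 leNgt (lt_le_trans e0 be).
Qed.

(** [U] is isometric, so what [P U P x] misses of the norm of [P x] is the corner, at most [q] times
    that norm. Adding [1 - P] extends the compression to all of [H] without affecting lower bounds
    below [1]. *)
Lemma corner_bounded_below P U V : projection P -> adjoint_of U V -> V * U = 1 ->
  let q := opnorm ((1 - P) * U * P) in
  let A := P * U * P + (1 - P) in
  forall x, (1 - q ^+ 2) * nm x ^+ 2 <= nm (A x) ^+ 2.
Proof.
move=> hP UV VU q A x; case: (hP) => _ sP.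
have Ax : A x = P (U (P x)) + (x - P x) by [].
have -> : nm (A x) ^+ 2 = nm (P (U (P x))) ^+ 2 + nm (x - P x) ^+ 2.
  by rewrite Ax; apply: pythagoras; rewrite sP opxB projK// subrr inner0r.
have h1 := proj_pythagoras (U (P x)) hP.
have h2 := proj_pythagoras x hP.
rewrite (unitary_nm _ UV VU) in h1.
have h3 : nm (U (P x) - P (U (P x))) <= q * nm (P x).
  by have := opnorm_ub ((1 - P) * U * P) (P x); rewrite !opM projK.
have h4 : nm (U (P x) - P (U (P x))) ^+ 2 <= q ^+ 2 * nm (P x) ^+ 2.
  by rewrite -exprMn ler_pXn2r ?nnegrE ?mulr_ge0 ?nm_ge0 ?opnorm_ge0.
have h5 : 0 <= q ^+ 2 * nm (x - P x) ^+ 2 by rewrite mulr_ge0 ?sqr_ge0.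
by rewrite h2; lra.
Qed.

(** [Re U] is almost nonnegative off a finite-dimensional space, and the finite rank [F] compensates
    on that space, so [A + t + F] is onto by coercivity. As [t < a], [A + t] is injective, and [F]
    can be removed. *)
Lemma corner_surjective P U V (a t : R) : projection P -> adjoint_of U V ->
  V * U = 1 -> U * V = 1 -> ess_spectrum U `<=` [set z | 0 <= cre z] ->
  let A := P * U * P + (1 - P) in
  (forall x, a * nm x <= nm (A x)) -> 0 < t -> t < a ->
  forall y, exists x, A x + t%:C *: x = y.
Proof.
move=> hP UV VU UV1 sU A Aa t0 ta y; case: (hP) => _ sP.
(* The form of [U] costs [2 d], which leaves [d] out of [t = 3 d]. *)
pose d := t / 3; have d0 : 0 < d by rewrite divr_gt0.
have [s sP'] := ess_lower_bound UV (etrans UV1 (esym VU)) sU d0.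
have [n [e he es]] := gram_schmidt s.
(* [d^-1] absorbs the cross terms between [u - Q u] and [Q u], and [1] absorbs the form of [U] at
   [Q u]. *)
pose k := d^-1 + 1; have k0 : 0 < k by rewrite addr_gt0 ?invr_gt0.
(* Compressing by [P] makes the form of [F] equal to [k |Q P x|^2], as needed for [low (P x)]. *)
pose v i := k%:C *: P (e i); pose w i := P (e i).
pose F := \sum_i rank1 (v i) (w i).
pose X := A + t%:C *: (1 : bounded_op H) + F.
pose Q := span_proj e; have [QQ hQ] := span_projP he.
have Ure x u : `|cre (inner (U x) u)| <= nm x * nm u.
  by rewrite -(unitary_nm x UV VU) Re_inner_le.
have low u : - (2 * d) * nm u ^+ 2 <= cre (inner (U u) u) + k * nm (Q u) ^+ 2.
  pose u0 := u - Q u.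
  have uE : u = u0 + Q u by rewrite subrK.
  have h1 : - d * nm u0 ^+ 2 <= cre (inner (U u0) u0).
    by apply/sP'/es => i; rewrite /u0 innerBl inner_span_proj// subrr.
  have h2 := Ure u0 (Q u); have h3 := Ure (Q u) u0; have h4 := Ure (Q u) (Q u).
  have h5 := proj_pythagoras u (conj QQ hQ); rewrite -/Q -/u0 in h5.
  have -> : cre (inner (U u) u) = cre (inner (U u0) u0) + cre (inner (U u0) (Q u))
      + cre (inner (U (Q u)) u0) + cre (inner (U (Q u)) (Q u)).
    by rewrite {1 2}uE opxD !innerE !creD; ring.
  move: h2 h3 h4; rewrite !ler_norml => /andP[h2 _] /andP[h3 _] /andP[h4 _].
  have h6 : 2 * (nm u0 * nm (Q u)) <= d * nm u0 ^+ 2 + d^-1 * nm (Q u) ^+ 2.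
    have -> : d * nm u0 ^+ 2 + d^-1 * nm (Q u) ^+ 2 =
        d^-1 * (d * nm u0 - nm (Q u)) ^+ 2 + 2 * (nm u0 * nm (Q u)).
      by field; rewrite gt_eqF.
    by rewrite lerDr mulr_ge0 ?sqr_ge0// invr_ge0 ltW.
  have h7 : 0 <= d * nm (Q u) ^+ 2 by rewrite mulr_ge0 ?sqr_ge0// ltW.
  by rewrite h5 /k; lra.
have FE x : cre (inner (F x) x) = k * nm (Q (P x)) ^+ 2.
  rewrite nm_sqr hQ -opM QQ /Q span_projE inner_sumr /F op_sum inner_suml.
  rewrite !Re_sum mulr_sumr; apply: eq_bigr => i _.
  rewrite rank1E /v /w innerZl !innerZr conjc_real -sP -mulrA creZ.
  by rewrite [inner (P (e i)) x]inner_sym -sP; congr (k * cre _); exact: mulrC.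
have cX x : d * nm x ^+ 2 <= cre (inner (X x) x).
  have -> : cre (inner (X x) x) = cre (inner (U (P x)) (P x)) +
      nm (x - P x) ^+ 2 + t * nm x ^+ 2 + k * nm (Q (P x)) ^+ 2.
    have Ax : cre (inner (A x) x) = cre (inner (U (P x)) (P x)) + nm (x - P x) ^+ 2.
      rewrite opD innerDl creD !opM sP; congr (_ + _).
      by rewrite nm_sqr -[x - P x]/((1 - P) x) proj_inner//; exact: projection1B.
    have Xx : X x = A x + t%:C *: x + F x by [].
    by rewrite Xx innerDl innerDl !creD FE Ax innerZl creZ -nm_sqr.
  have := low (P x); have := proj_pythagoras x hP.
  have := sqr_ge0 (nm (x - P x)); have := sqr_ge0 (nm (P x)).
  have -> : t = 3 * d by rewrite /d; field.
  move: (nm x ^+ 2) (nm (P x) ^+ 2) (nm (x - P x) ^+ 2) => p q r q0 r0 ->.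
  have := mulr_ge0 (ltW d0) r0; lra.
have Xsurj := lax_milgram d0 cX.
have XF x : (X - F) x = A x + t%:C *: x by rewrite /X addrK.
have [x|x] := @finite_rank_perturbation _ H X n v w Xsurj _ y.
  rewrite XF => /eqP; rewrite addr_eq0 => /eqP Ax.
  have := Aa x; rewrite Ax nmN nmZr gtr0_norm// -subr_le0 -mulrBl.
  rewrite pmulr_rle0 ?subr_gt0// => x0; apply/eqP.
  by rewrite -nm_eq0 eq_le x0 nm_ge0.
by rewrite XF; exists x.
Qed.

(** Surjectivity of [A + t] carries the lower bound [a] of [A] over to its adjoint [A'], which
    bounds the corner of [V], adjoint to the left-hand side. Assuming the contrary gives [q < 1], so
    that [a] is positive. *)
Lemma unitary_corner_le U P : unitary U ->
  ess_spectrum U `<=` [set z | 0 <= cre z] -> projection P ->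
  opnorm (P * U * (1 - P)) <= opnorm ((1 - P) * U * P).
Proof.
move=> [V [UV VU UV1]] sU hP; rewrite leNgt; apply/negP.
set q := opnorm ((1 - P) * U * P) => qlt.
have q0 : 0 <= q := opnorm_ge0 _.
case: (hP) => _ sP; have [_ sP'] := projection1B hP.
have q1 : q < 1.
  apply: lt_le_trans qlt _; apply: opnorm_le => // x; rewrite mul1r !opM.
  apply: le_trans (proj_le _ hP) _; rewrite (unitary_nm _ UV VU).
  exact: proj_le (projection1B hP).
have a20 : 0 < 1 - q ^+ 2 by rewrite subr_gt0 expr_lt1.
pose a := Num.sqrt (1 - q ^+ 2); have a0 : 0 < a by rewrite sqrtr_gt0.
have a2 : a ^+ 2 = 1 - q ^+ 2 by rewrite sqr_sqrtr// ltW.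
pose A := P * U * P + (1 - P); pose A' := P * V * P + (1 - P).
have AA' : adjoint_of A A'.
  apply: adjointD => //; rewrite -[X in adjoint_of _ X]mulrA.
  by apply: adjointM => //; exact: adjointM.
have Aa x : a * nm x <= nm (A x).
  rewrite -(ler_pXn2r (n := 2)) ?nnegrE ?nm_ge0 ?mulr_ge0 ?nm_ge0 ?(ltW a0)//.
  by rewrite exprMn a2; exact: corner_bounded_below UV VU _.
have A'a y : a * nm y <= nm (A' y).
  have [->|y0] := eqVneq y 0; first by rewrite nm0 mulr0 nm_ge0.
  have ny0 : 0 < nm y by rewrite nm_gt0.
  apply/ler_addgt0Pr => e e0.
  (* The estimate below is [(a - t) |y| <= |A' y| + t |y|], which loses [2 t |y|]. *)
  pose t := Num.min (a / 2) (e / (2 * nm y)).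
  have t0 : 0 < t by rewrite lt_min !divr_gt0// mulr_gt0.
  have ta : t < a by rewrite gt_min ltr_pdivrMr// ltr_pMr// ltr1n.
  have te : t * (2 * nm y) <= e by rewrite -ler_pdivlMr ?mulr_gt0// ge_min lexx orbT.
  have [x xE] := corner_surjective hP UV VU UV1 sU Aa t0 ta y.
  have xy : (a - t) * nm x <= nm y.
    rewrite -xE mulrBl; apply: le_trans (lerD (Aa x) (lexx _)) _.
    by have := nmB_ge (A x) (- (t%:C *: x)); rewrite opprK nmN nmZr gtr0_norm.
  have : nm y ^+ 2 <= nm x * (nm (A' y) + t * nm y).
    rewrite nm_sqr -{1}xE innerDl AA' innerZl.
    have -> : inner x (A' y) + t%:C * inner x y = inner x (A' y + t%:C *: y).
      by rewrite [RHS]innerDr innerZr conjc_real.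
    apply: le_trans (ler_norm _) (le_trans (Re_inner_le _ _) _).
    rewrite ler_wpM2l ?nm_ge0// (le_trans (nmD _ _))// nmZr gtr0_norm//.
  move=> h; have : (a - t) * nm y <= nm (A' y) + t * nm y.
    rewrite -(ler_pM2r ny0) -mulrA -expr2.
    have at0 : 0 <= a - t by rewrite subr_ge0 ltW.
    have c0 : 0 <= nm (A' y) + t * nm y by rewrite addr_ge0 ?mulr_ge0 ?nm_ge0// ltW.
    by have := ler_wpM2l at0 h; have := ler_wpM2r c0 xy; lra.
  by lra.
suff : opnorm ((1 - P) * V * P) <= q.
  by rewrite -(opnorm_adjoint (adjoint_corner hP UV)) leNgt qlt.
apply: opnorm_le => // x; rewrite -(ler_pXn2r (n := 2)) ?nnegrE ?mulr_ge0 ?nm_ge0//.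
pose y := P x; have Py : P y = y by exact: projK.
have h1 : nm y ^+ 2 = nm (P (V y)) ^+ 2 + nm (V y - P (V y)) ^+ 2.
  by rewrite -(proj_pythagoras _ hP) (unitary_nm _ (adjoint_sym UV) UV1).
have h2 : a ^+ 2 * nm y ^+ 2 <= nm (P (V y)) ^+ 2.
  rewrite -exprMn ler_pXn2r ?nnegrE ?nm_ge0 ?mulr_ge0 ?nm_ge0 ?(ltW a0)//.
  by apply: le_trans (A'a y) _; rewrite /A' opD !opM opB op1 Py subrr addr0.
have h3 : nm y ^+ 2 <= nm x ^+ 2 by rewrite ler_pXn2r ?nnegrE ?nm_ge0// proj_le.
have h4 := ler_wpM2l (sqr_ge0 q) h3.
by rewrite exprMn !opM opB op1 -/y; move: h2; rewrite a2; lra.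
Qed.

Lemma unitary_common_norm U : unitary U ->
  ess_spectrum U `<=` [set z | 0 <= cre z] -> common_norm U.
Proof.
move=> hU sU P hP; have P'P : 1 - (1 - P) = P by rewrite opprB addrC subrK.
apply/eqP; rewrite eq_le unitary_corner_le//=.
by have := unitary_corner_le hU sU (projection1B hP); rewrite P'P.
Qed.

End CommonNorm.

(** * Corners of rank one and two *)

Section RankTwo.
Variables (R : realType) (H : hilbertType R).
Implicit Types (x y z : H) (P S T V : bounded_op H) (a b : R[i]).

(** At [x + T x] the cross terms of the form add up to twice the square of [nm (T x)]. *)
Lemma self_adjoint_form_eq0 T : self_adjoint T ->
  (forall x, cre (inner (T x) x) = 0) -> T = 0.
Proof.
move=> hT T0; apply: bounded_op_inj => x; apply/eqP; rewrite -nm_eq0 -sqrf_eq0.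
have := T0 (x + T x); rewrite opxD !innerE !creD !T0 (hT (T x)) -nm_sqr.
by move=> h; apply/eqP; lra.
Qed.

(** For the projection onto a unit vector [u], the corners have norms [|T u - P T u|] and
    [|V u - P V u|], while [P T u] and [P V u] always have equal norms. *)
Lemma common_norm_adjoint_nm T V x : adjoint_of T V -> common_norm T ->
  nm (T x) = nm (V x).
Proof.
move=> TV cT; have [->|x0] := eqVneq x 0; first by rewrite !opx0.
suff unit u : nm u = 1 -> nm (T u) = nm (V u).
  have -> : x = (nm x)%:C *: ((nm x)^-1%:C *: x).
    by rewrite scalerA -rmorphM/= divff ?scale1r// nm_eq0.
  by rewrite 2!(opxZ _ (nm x)%:C) !nmZ unit// normalizeP.
move=> u1; pose P := span_proj (fun _ : 'I_1 => u).
have hP : projection P.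
  by apply: span_projP => i j; rewrite !ord1 eqxx inner_self u1 expr1n.
have PE z : P z = inner z u *: u by rewrite /P span_projE big_ord1.
have Pu : P u = u by rewrite PE inner_self u1 expr1n scale1r.
have corner S : opnorm ((1 - P) * S * P) = nm (S u - P (S u)).
  apply/eqP; rewrite eq_le; apply/andP; split.
    apply: opnorm_le => [|z]; first exact: nm_ge0.
    rewrite !opM PE !opxZ nmZ mulrC ler_wpM2l ?nm_ge0//.
    by apply: le_trans (cauchy_schwarz _ _) _; rewrite u1 mulr1.
  by have := opnorm_ub ((1 - P) * S * P) u; rewrite !opM Pu u1 mulr1.
have := cT P hP; rewrite (opnorm_adjoint (adjoint_corner hP TV)) !corner => h.
apply/eqP; rewrite -(eqrXn2 (n := 2)) ?nm_ge0//.
rewrite (proj_pythagoras (T u) hP) (proj_pythagoras (V u) hP) h !PE !nmZ u1 !mulr1.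
by rewrite (adjoint_sym TV) cabs_inner_sym.
Qed.

Lemma common_norm_normal T V : adjoint_of T V -> common_norm T -> T * V = V * T.
Proof.
move=> TV cT; apply/eqP; rewrite -subr_eq0; apply/eqP.
have VT := adjoint_sym TV.
apply: self_adjoint_form_eq0 => [|x].
  by apply: adjointB; exact: adjointM.
rewrite opB !opM innerBl creD creN (TV (V x)) (VT (T x)) -!nm_sqr.
by rewrite (common_norm_adjoint_nm x TV cT) subrr.
Qed.

(* [L] is the largest eigenvalue of the Gram matrix of [v1] and [v2], hence a
   root of its characteristic polynomial. *)
Lemma gram_top_eigenvalue (v1 v2 : H) (L : R) :
  (forall a b, nm (a *: v1 + b *: v2) ^+ 2 <= L * (cabs a ^+ 2 + cabs b ^+ 2)) ->
  (forall m, (forall a b, nm (a *: v1 + b *: v2) ^+ 2 <=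
     m * (cabs a ^+ 2 + cabs b ^+ 2)) -> L <= m) ->
  (L - nm v1 ^+ 2) * (L - nm v2 ^+ 2) = cabs (inner v1 v2) ^+ 2.
Proof.
move=> hL minL; set g := cabs (inner v1 v2); have g0 : 0 <= g := cabs_ge0 _.
have E a b : nm (a *: v1 + b *: v2) ^+ 2 = cabs a ^+ 2 * nm v1 ^+ 2 +
    cre (a * conjc b * inner v1 v2) *+ 2 + cabs b ^+ 2 * nm v2 ^+ 2.
  by rewrite nm_sqrD !nmZ innerZl innerZr !exprMn mulrA.
(* The phase makes the off-diagonal entry real, so real coefficients suffice as tests. *)
have [u u1 ug] := cabs_phase (inner v1 v2); rewrite -/g in ug.
have lin (p q : R) : p ^+ 2 * nm v1 ^+ 2 + p * q * g *+ 2 + q ^+ 2 * nm v2 ^+ 2 <=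
    L * (p ^+ 2 + q ^+ 2).
  have := hL (p%:C * u) q%:C; rewrite E conjc_real.
  rewrite (_ : p%:C * u * q%:C * inner v1 v2 = p%:C * (q%:C * (u * inner v1 v2))).
    rewrite ug !creZ !cabsM u1 !cabs_real mulr1 !real_normK ?num_real// [cre _]/=.
    by rewrite mulrA.
  by ring.
have bnd a b : cre (a * conjc b * inner v1 v2) <= cabs a * cabs b * g.
  by apply: le_trans (Re_le_cabs _) _; rewrite !cabsM cabsJ.
have a0 : 0 <= L - nm v1 ^+ 2.
  by have := lin 1 0; rewrite !(expr1n, expr0n, mulr0, mul0r, mul1r)/=; lra.
have c0 : 0 <= L - nm v2 ^+ 2.
  by have := lin 0 1; rewrite !(expr1n, expr0n, mulr0, mul0r, mul1r)/=; lra.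
move: a0 c0 lin minL E bnd; move: (nm v1 ^+ 2) (nm v2 ^+ 2) => g1 g2.
move=> a0 c0 lin minL E bnd.
have acg : g ^+ 2 <= (L - g1) * (L - g2).
  have [c'0|c'0] := eqVneq (L - g2) 0; last first.
    have cp : 0 < L - g2 by rewrite lt_neqAle eq_sym c'0.
    rewrite -(ler_pM2r cp); have := lin (L - g2) g; lra.
  rewrite c'0 mulr0; have [->|gn0] := eqVneq g 0; first by rewrite expr0n.
  have gp : 0 < g by rewrite lt_neqAle eq_sym gn0.
  (* When [L = g2] the form is affine in the second coefficient; this value exceeds the bound by
     [1]. *)
  have := lin 1 ((L - g1 + 1) / (2 * g)).
  have -> : 1 * ((L - g1 + 1) / (2 * g)) * g *+ 2 = L - g1 + 1 by field.
  have -> : g2 = L by lra.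
  lra.
apply/eqP; rewrite eq_le acg andbT leNgt; apply/negP => lt.
have sp : 0 < (L - g1) + (L - g2).
  rewrite lt_neqAle addr_ge0// andbT eq_sym; apply/negP => /eqP s0.
  have g1L : L - g1 = 0 by lra.
  by move: lt; rewrite g1L mul0r ltNge sqr_ge0.
(* Determinant over trace of [L] minus the Gram matrix: lowering [L] by [eta] leaves the determinant
   [eta ^+ 2] and hence an upper bound, against minimality. *)
pose eta := ((L - g1) * (L - g2) - g ^+ 2) / ((L - g1) + (L - g2)).
have eta0 : 0 < eta by rewrite divr_gt0// subr_gt0.
have etaE : eta * ((L - g1) + (L - g2)) = (L - g1) * (L - g2) - g ^+ 2.
  by rewrite mulfVK// gt_eqF.
have ea : eta <= L - g1.
  by rewrite ler_pdivrMr//; have := sqr_ge0 g; have := sqr_ge0 (L - g1); nra.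
have ec : eta <= L - g2.
  by rewrite ler_pdivrMr//; have := sqr_ge0 g; have := sqr_ge0 (L - g2); nra.
suff : L <= L - eta by lra.
apply: minL => a b; rewrite E; have := bnd a b.
move: (cre _) (cabs a) (cabs b) => r p q rpq.
have key : 0 <= (L - g1 - eta) * p ^+ 2 + (L - g2 - eta) * q ^+ 2 - 2 * (p * q * g).
  pose A := L - g1 - eta; pose C := L - g2 - eta.
  have A0 : 0 <= A by rewrite subr_ge0.
  have C0 : 0 <= C by rewrite subr_ge0.
  have AC : A * C = g ^+ 2 + eta ^+ 2.
    by move: etaE; rewrite /A /C; lra.
  have [A'0|An0] := eqVneq A 0.
    by move: AC; rewrite A'0 mul0r; have := sqr_ge0 g; have := exprn_gt0 2 eta0; lra.
  have Ap : 0 < A by rewrite lt_neqAle eq_sym An0.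
  rewrite -/A -/C -(pmulr_rge0 _ Ap).
  have -> : A * (A * p ^+ 2 + C * q ^+ 2 - 2 * (p * q * g)) =
      (A * p - g * q) ^+ 2 + (A * C - g ^+ 2) * q ^+ 2 by ring.
  rewrite AC [_ + _ - _]addrAC subrr add0r.
  by apply: addr_ge0; [|apply: mulr_ge0]; exact: sqr_ge0.
lra.
Qed.

End RankTwo.

(** * Polynomial identities for compressions to a plane *)

Section RealAlgebra.
Variable R : realFieldType.
Implicit Types (b c m : R).

(** With [n] the cross product of [b] and [c]: if [n = 0], [b] and [c] are parallel and their inner
    products are coefficients; otherwise Cramer's rule expresses [m], and [- |n|^2] is its
    coefficient. *)
Lemma triple_product_dependent b1 b2 b3 c1 c2 c3 m1 m2 m3 :
  b1 * (c2 * m3 - c3 * m2) - b2 * (c1 * m3 - c3 * m1) + b3 * (c1 * m2 - c2 * m1) = 0 ->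
  exists p : R * R * R, [/\ p != (0, 0, 0),
    p.1.1 * b1 + p.1.2 * c1 + p.2 * m1 = 0,
    p.1.1 * b2 + p.1.2 * c2 + p.2 * m2 = 0 &
    p.1.1 * b3 + p.1.2 * c3 + p.2 * m3 = 0].
Proof.
move=> det0.
pose n1 := b2 * c3 - b3 * c2; pose n2 := b3 * c1 - b1 * c3; pose n3 := b1 * c2 - b2 * c1.
have [/andP[/andP[/eqP z1 /eqP z2] /eqP z3]|nz] :=
    boolP ((n1 == 0) && (n2 == 0) && (n3 == 0)).
  have [/andP[/andP[/eqP-> /eqP->] /eqP->]|bz] :=
      boolP ((b1 == 0) && (b2 == 0) && (b3 == 0)).
    exists (1, 0, 0); rewrite /= !mul0r !mulr0 !addr0; split=> //.
    by rewrite !xpair_eqE oner_eq0.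
  exists (b1 * c1 + b2 * c2 + b3 * c3, - (b1 ^+ 2 + b2 ^+ 2 + b3 ^+ 2), 0) => /=.
  split.
  - rewrite !xpair_eqE eqxx andbT; apply: contraNN bz => /andP[_].
    by rewrite oppr_eq0 !paddr_eq0 ?addr_ge0 ?sqr_ge0// !sqrf_eq0.
  - transitivity (n3 * b2 - n2 * b3); first by rewrite /n2 /n3; ring.
    by rewrite z2 z3 !mul0r subrr.
  - transitivity (n1 * b3 - n3 * b1); first by rewrite /n1 /n3; ring.
    by rewrite z1 z3 !mul0r subrr.
  - transitivity (n2 * b1 - n1 * b2); first by rewrite /n1 /n2; ring.
    by rewrite z1 z2 !mul0r subrr.
have dn : m1 * n1 + m2 * n2 + m3 * n3 = 0 by rewrite -det0 /n1 /n2 /n3; ring.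
exists ((m2 * c3 - m3 * c2) * n1 + (m3 * c1 - m1 * c3) * n2 + (m1 * c2 - m2 * c1) * n3,
  (b2 * m3 - b3 * m2) * n1 + (b3 * m1 - b1 * m3) * n2 + (b1 * m2 - b2 * m1) * n3,
  - (n1 ^+ 2 + n2 ^+ 2 + n3 ^+ 2)) => /=; split.
- rewrite !xpair_eqE; apply: contraNN nz => /andP[_].
  clearbody n1 n2 n3.
  by rewrite oppr_eq0 !paddr_eq0 ?addr_ge0 ?sqr_ge0// !sqrf_eq0.
- transitivity (- n1 * (m1 * n1 + m2 * n2 + m3 * n3)).
    by rewrite /n1 /n2 /n3; ring.
  by rewrite dn mulr0.
- transitivity (- n2 * (m1 * n1 + m2 * n2 + m3 * n3)).
    by rewrite /n1 /n2 /n3; ring.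
  by rewrite dn mulr0.
- transitivity (- n3 * (m1 * n1 + m2 * n2 + m3 * n3)).
    by rewrite /n1 /n2 /n3; ring.
  by rewrite dn mulr0.
Qed.

(* [b + i c] and [m] are the entries of the compressions of [T] and of [T^* T]
   to a plane; the hypotheses say that [L] is an eigenvalue of the Gram matrices
   of the two off-diagonal corners. *)
Lemma gram_triple_product L b1 b2 b3 b4 c1 c2 c3 c4 m1 m2 m3 m4 :
  (L - (m1 - (b1 ^+ 2 + c1 ^+ 2) - ((b2 - c3) ^+ 2 + (b3 + c2) ^+ 2))) *
  (L - (m4 - ((b2 + c3) ^+ 2 + (c2 - b3) ^+ 2) - (b4 ^+ 2 + c4 ^+ 2))) =
    (m2 - (b1 * (b2 + c3) + c1 * (c2 - b3)) -
      ((b2 - c3) * b4 + (b3 + c2) * c4)) ^+ 2 +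
    (m3 - (c1 * (b2 + c3) - b1 * (c2 - b3)) -
      ((b3 + c2) * b4 - (b2 - c3) * c4)) ^+ 2 ->
  (L - (m1 - (b1 ^+ 2 + c1 ^+ 2) - ((b2 + c3) ^+ 2 + (c2 - b3) ^+ 2))) *
  (L - (m4 - ((b2 - c3) ^+ 2 + (b3 + c2) ^+ 2) - (b4 ^+ 2 + c4 ^+ 2))) =
    (m2 - (b1 * (b2 - c3) + c1 * (b3 + c2)) -
      ((b2 + c3) * b4 + (c2 - b3) * c4)) ^+ 2 +
    (m3 - (b1 * (b3 + c2) - c1 * (b2 - c3)) -
      ((b2 + c3) * c4 - (c2 - b3) * b4)) ^+ 2 ->
  (b1 - b4) * (c2 * m3 - c3 * m2) - b2 * ((c1 - c4) * m3 - c3 * (m1 - m4)) +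
    b3 * ((c1 - c4) * m2 - c2 * (m1 - m4)) = 0.
Proof.
move=> /eqP; rewrite -subr_eq0 => /eqP h1 /eqP; rewrite -subr_eq0 => /eqP h2.
apply: (@mulfI _ (- 4)); first by rewrite oppr_eq0 pnatr_eq0.
by rewrite mulr0 -[RHS](subrr 0) -{1}h1 -h2; ring.
Qed.

End RealAlgebra.

Section Pencil.
Variables (R : realType) (H : hilbertType R).
Implicit Types (x y z : H) (P S T V : bounded_op H) (a b : R[i]).

Definition quad T V (k : 'I_4) : bounded_op H :=
  nth 0 [:: 1; re_part T V; im_part T V; V * T] k.

(* [V] stands for the adjoint of [T].  For a normal [T], [pencil T V p = 0] says
   that the spectrum lies on the line or circle with coefficients [p]. *)
Definition pencil T V (p : 'rV[R]_4) : bounded_op H :=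
  \sum_k (p 0 k)%:C *: quad T V k.

Lemma pencil_row T V (s : seq R) : pencil T V (\row_k s`_k) =
  (s`_0)%:C *: (1 : bounded_op H) + (s`_1)%:C *: re_part T V +
  (s`_2)%:C *: im_part T V + (s`_3)%:C *: (V * T).
Proof. by rewrite /pencil !big_ord_recl big_ord0 /quad !mxE /= addr0 !addrA. Qed.

Lemma quad_self_adjoint T V k : adjoint_of T V -> self_adjoint (quad T V k).
Proof.
move=> TV; case: k => -[|[|[|[|//]]]] ? /=.
- exact: adjoint1.
- exact: re_part_self_adjoint.
- exact: im_part_self_adjoint.
- by apply: adjointM => //; exact: adjoint_sym.
Qed.

Lemma pencil_self_adjoint T V p : adjoint_of T V -> self_adjoint (pencil T V p).
Proof.
by move=> TV; apply: adjoint_sum => k; exact/self_adjointZ/quad_self_adjoint.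
Qed.

(** The corner maps [a x + b y] to [a (v x) + b (v y)], so its squared norm is the largest
    eigenvalue of the Gram matrix of [v x] and [v y]. *)
Lemma corner_rank2 T x y (P := span_proj (fun i : 'I_2 => if i == 0 then x else y))
    (L := opnorm ((1 - P) * T * P) ^+ 2) (v := fun z => T z - P (T z)) :
  nm x = 1 -> nm y = 1 -> inner x y = 0 ->
  (L - nm (v x) ^+ 2) * (L - nm (v y) ^+ 2) = cabs (inner (v x) (v y)) ^+ 2.
Proof.
move=> x1 y1 xy; have yx := inner_eq0_sym xy.
have he : orthonormal (fun i : 'I_2 => if i == 0 then x else y).
  by case=> -[|[|//]] ? [] [|[|//]] ? /=; rewrite ?xy ?yx ?inner_self ?x1 ?y1 ?expr1n.
have hP : projection P := span_projP he.
have PE z : P z = inner z x *: x + inner z y *: y.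
  by rewrite /P span_projE !big_ord_recl big_ord0 addr0.
have fE a b : ((1 - P) * T * P) (a *: x + b *: y) = a *: v x + b *: v y.
  have -> : ((1 - P) * T * P) (a *: x + b *: y) =
      (1 - P) (T (P (a *: x + b *: y))) by [].
  rewrite PE !innerE xy yx !inner_self x1 y1 !expr1n !(mulr0, mulr1) addr0 add0r.
  by rewrite opxD !opxZ opxD !opxZ.
have nE a b : nm (a *: x + b *: y) ^+ 2 = cabs a ^+ 2 + cabs b ^+ 2.
  by rewrite pythagoras ?innerZl ?innerZr ?xy ?mulr0// !nmZ x1 y1 !mulr1.
apply: gram_top_eigenvalue => [a b|m hm].
  rewrite -fE -nE /L -exprMn ler_pXn2r ?nnegrE ?mulr_ge0 ?nm_ge0 ?opnorm_ge0//.
  exact: opnorm_ub.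
have m0 : 0 <= m.
  have := hm 1 0; rewrite cabs0 cabs1 expr0n expr1n addr0 mulr1.
  exact/le_trans/sqr_ge0.
rewrite /L -(sqr_sqrtr m0) ler_pXn2r ?nnegrE ?opnorm_ge0 ?sqrtr_ge0//.
apply: opnorm_le => [|z]; first exact: sqrtr_ge0.
rewrite -(ler_pXn2r (n := 2)) ?nnegrE ?mulr_ge0 ?nm_ge0 ?sqrtr_ge0//.
rewrite exprMn sqr_sqrtr//.
have -> : ((1 - P) * T * P) z = ((1 - P) * T * P) (P z) by rewrite !opM projK.
rewrite PE fE (le_trans (hm _ _))// -nE -PE ler_wpM2l//.
by rewrite ler_pXn2r ?nnegrE ?nm_ge0// proj_le.
Qed.

Lemma inner_corner x y u w : nm x = 1 -> nm y = 1 -> inner x y = 0 ->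
  let P := span_proj (fun i : 'I_2 => if i == 0 then x else y) in
  inner (u - P u) (w - P w) = inner u w - inner u x * conjc (inner w x) -
    inner u y * conjc (inner w y).
Proof.
move=> x1 y1 xy P; have yx := inner_eq0_sym xy.
have PE z : P z = inner z x *: x + inner z y *: y.
  by rewrite /P span_projE !big_ord_recl big_ord0 addr0.
rewrite !PE !innerE xy yx !inner_self x1 y1 !expr1n.
by rewrite [inner x w]inner_sym [inner y w]inner_sym; ring.
Qed.

(** The corners of [T] and [V] have equal norms, so [L] solves both characteristic equations. Their
    difference is a triple product of the vectors (diagonal difference, real and imaginary
    off-diagonal part) of [Re T], [Im T], [T^* T]; a relation between these becomes a pencil once
    the coefficient of [1] is chosen to cancel the entry at [x]. *)
Lemma common_norm_pencil_orthonormal T V x y :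
  adjoint_of T V -> common_norm T -> nm x = 1 -> nm y = 1 -> inner x y = 0 ->
  exists2 p : 'rV[R]_4, p != 0 & [/\ inner (pencil T V p x) x = 0,
    inner (pencil T V p y) y = 0 & inner (pencil T V p x) y = 0].
Proof.
move=> TV cT x1 y1 xy; have TVC := common_norm_normal TV cT.
have yx := inner_eq0_sym xy.
pose B := re_part T V; pose C := im_part T V.
have hB : self_adjoint B := re_part_self_adjoint TV.
have hC : self_adjoint C := im_part_self_adjoint TV.
have hM : self_adjoint (V * T) by apply: adjointM => //; exact: adjoint_sym.
have TE u v : inner (T u) v = inner (B u) v + (0 +i* 1) * inner (C u) v.
  by rewrite [T u](re_im_partE T V) innerDl; congr (_ + _); exact: innerZl.
have real_diag S u : self_adjoint S -> exists r, inner (S u) u = r%:C.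
  move=> hS; exists (cre (inner (S u) u)).
  by apply: complex_eq => //; rewrite self_adjoint_Im.
have [b1 bxx] := real_diag B x hB; have [b4 byy] := real_diag B y hB.
have [c1 cxx] := real_diag C x hC; have [c4 cyy] := real_diag C y hC.
have [m1 mxx] := real_diag _ x hM; have [m4 myy] := real_diag _ y hM.
case bxy: (inner (B x) y) => [b2 b3].
case cxy: (inner (C x) y) => [c2 c3].
case mxy: (inner ((V * T) x) y) => [m2 m3].
have Txx : inner (T x) x = b1 +i* c1.
  by rewrite TE bxx cxx; apply: complex_eq; rewrite ?(creD, cimD, creM, cimM) /=; ring.
have Txy : inner (T x) y = (b2 - c3) +i* (b3 + c2).
  by rewrite TE bxy cxy; apply: complex_eq; rewrite ?(creD, cimD, creM, cimM) /=; ring.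
have Tyx : inner (T y) x = (b2 + c3) +i* (c2 - b3).
  rewrite TE hB hC ![inner y _]inner_sym bxy cxy.
  by apply: complex_eq; rewrite ?(creD, cimD, creM, cimM) /=; ring.
have Tyy : inner (T y) y = b4 +i* c4.
  by rewrite TE byy cyy; apply: complex_eq; rewrite ?(creD, cimD, creM, cimM) /=; ring.
have MV u w : inner (V u) (V w) = inner ((V * T) u) w by rewrite -TVC -TV.
have MT u w : inner (T u) (T w) = inner ((V * T) u) w.
  exact/esym/(adjoint_sym TV).
have VE u w : inner (V u) w = conjc (inner (T w) u).
  by rewrite (adjoint_sym TV) -inner_sym.
have he : orthonormal (fun i : 'I_2 => if i == 0 then x else y).
  by case=> -[|[|//]] ? [] [|[|//]] ? /=; rewrite ?xy ?yx ?inner_self ?x1 ?y1 ?expr1n.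
have hP := span_projP he.
have := corner_rank2 V x1 y1 xy; have := corner_rank2 T x1 y1 xy.
rewrite -(opnorm_adjoint (adjoint_corner hP TV)) -(cT _ hP).
move: (opnorm _ ^+ 2) => L.
rewrite 4!nm_sqr 6?inner_corner// 2!cabs_sqr.
rewrite (MV x x) (MV x y) (MV y y) (MT x x) (MT x y) (MT y y) mxx myy mxy.
rewrite (VE x x) (VE x y) (VE y x) (VE y y) Txx Txy Tyx Tyy.
rewrite !(creD, creN, creM, cimD, cimN, cimM, creJ, cimJ) /= => eqT eqV.
have /triple_product_dependent[[[p1 p2] p3] [/= p0 e1 e2 e3]] :
    (b1 - b4) * (c2 * m3 - c3 * m2) - b2 * ((c1 - c4) * m3 - c3 * (m1 - m4)) +
    b3 * ((c1 - c4) * m2 - c2 * (m1 - m4)) = 0.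
  apply: (@gram_triple_product _ L).
    by apply: etrans (etrans _ eqT) _; ring.
  by apply: etrans (etrans _ eqV) _; ring.
pose p : 'rV[R]_4 := \row_k [:: - (p1 * b1 + p2 * c1 + p3 * m1); p1; p2; p3]`_k.
exists p.
  apply: contraNneq p0 => /rowP r0; have := r0 1; have := r0 (inord 2).
  have := r0 (inord 3); rewrite !mxE !inordK//= => -> -> ->.
  exact: eqxx.
have pE u w : inner (pencil T V p u) w =
    (- (p1 * b1 + p2 * c1 + p3 * m1))%:C * inner u w + p1%:C * inner (B u) w +
    p2%:C * inner (C u) w + p3%:C * inner ((V * T) u) w.
  by rewrite /p pencil_row !opD !innerDl !opZ !innerZl.
rewrite !pE bxx byy bxy cxx cyy cxy mxx myy mxy xy !inner_self x1 y1 !expr1n.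
split; apply: complex_eq; rewrite !(creD, creN, creM, cimD, cimN, cimM) /=.
- by ring.
- by ring.
- by lra.
- by ring.
- by lra.
- by lra.
Qed.

End Pencil.

(** * The spectrum lies on a line or on a circle *)

(** A maximal independent family taken from [Z] either has [n] members or spans a proper subspace
    containing [Z]. *)
Lemma spanning_or_annihilated (F : fieldType) n (Z : set 'rV[F]_n) :
  (exists2 p : 'rV[F]_n, p != 0 & forall v, Z v -> v *m p^T = 0) \/
  (exists2 A : 'M[F]_n, A \in unitmx & forall i, Z (row i A)).
Proof.
pose ok k := exists2 A : 'M[F]_(k, n), row_free A & forall i, Z (row i A).
have ok_le k : ok k -> (k <= n)%N.
  by case=> A /eqP freeA _; rewrite -{1}freeA rank_leq_col.
have ok0 : ok 0 by exists 0 => [|[]//]; rewrite /row_free mxrank0.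
have [k okk maxk] : exists2 k, ok k & ~ ok k.+1.
  apply: contrapT => h; have okn k : ok k.
    elim: k => // k okk; apply: contrapT => nk; apply: h; by exists k.
  by have := ok_le _ (okn n.+1); rewrite ltnn.
case: okk => A freeA AZ.
have [kn|nk] := ltnP k n; last first.
  right; have kn : k = n.
    apply/eqP; rewrite eqn_leq nk andbT; apply: ok_le; by exists A.
  by move: A freeA AZ; rewrite kn => A freeA AZ; exists A; rewrite // -row_free_unit.
left; have /rowV0Pn[p pker p0] : kermx A^T != 0.
  by rewrite kermx_eq0 /row_free mxrank_tr neq_ltn (leq_ltn_trans (rank_leq_row _)).
exists p => // v Zv.
have pA : A *m p^T = 0.
  by apply: trmx_inj; rewrite trmx_mul trmxK trmx0; exact/sub_kermxP.
have [/submxP[D ->]|vA] := boolP (v <= A)%MS; first by rewrite -mulmxA pA mulmx0.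
exfalso; apply: maxk; rewrite -addn1; exists (col_mx A v) => [|i].
  have : (\rank A < \rank (col_mx A v))%N.
    by rewrite -addsmxE rank_ltmx// ltmxE addsmxSl addsmx_sub submx_refl.
  rewrite (eqP freeA) /row_free eqn_leq rank_leq_row /=.
  by apply: leq_trans; rewrite addn1.
by case: (split_ordP i) => j ->; rewrite ?rowKu ?rowKd ?ord1 ?row_id.
Qed.

Section NormalPencil.
Variables (R : realType) (H : hilbertType R).
Implicit Types (x y : H) (S T V : bounded_op H) (a z : R[i]).

Lemma common_norm_pencil T V x y : adjoint_of T V -> common_norm T ->
  x != 0 -> (forall a, y <> a *: x) ->
  exists2 p : 'rV[R]_4, p != 0 & [/\ inner (pencil T V p x) x = 0,
    inner (pencil T V p y) y = 0 & inner (pencil T V p x) y = 0].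
Proof.
move=> TV cT x0 xy.
pose x' := (nm x)^-1%:C *: x; have x'1 : nm x' = 1 by exact: normalizeP.
pose v := y - inner y x' *: x'.
have v0 : v != 0.
  apply/eqP => /eqP; rewrite subr_eq0 => /eqP; rewrite /x' scalerA; exact: xy.
have vx' : inner x' v = 0.
  by rewrite innerBr innerZr inner_self x'1 expr1n mulr1 -inner_sym subrr.
pose y' := (nm v)^-1%:C *: v; have y'1 : nm y' = 1 by exact: normalizeP.
have x'y' : inner x' y' = 0 by rewrite innerZr vx' mulr0.
have [p p0 [px py pxy]] := common_norm_pencil_orthonormal TV cT x'1 y'1 x'y'.
exists p => //; have hE := pencil_self_adjoint p TV.
have pyx : inner (pencil T V p y') x' = 0 by rewrite hE; exact: inner_eq0_sym.
have xE : x = (nm x)%:C *: x'.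
  by rewrite /x' scalerA -rmorphM/= divff ?scale1r// nm_eq0.
have yE : y = inner y x' *: x' + (nm v)%:C *: y'.
  by rewrite /y' scalerA -rmorphM/= divff ?nm_eq0// scale1r addrC subrK.
move: xE yE px py pxy pyx; move: (pencil T V p) => E.
clearbody y' v x'; move: (inner y x') (nm x)%:C (nm v)%:C => a c d -> -> px py pxy pyx.
by rewrite !(opxD, opxZ, innerE) px py pxy pyx !(mulr0, addr0).
Qed.

Definition approx_spectrum T : set R[i] :=
  [set z | forall e : R, 0 < e -> exists2 x, nm x = 1 & nm (T x - z *: x) <= e].

Definition quad_value (z : R[i]) : 'rV[R]_4 :=
  \row_k [:: 1; cre z; cim z; cabs z ^+ 2]`_k.

Lemma normal_nm T V x : adjoint_of T V -> T * V = V * T -> nm (T x) = nm (V x).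
Proof.
move=> TV TVC; apply/eqP; rewrite -(eqrXn2 (n := 2)) ?nm_ge0// !nm_sqr.
by rewrite TV (adjoint_sym TV) -!opM TVC.
Qed.

Lemma normal_eigenvector_adjoint T V z x : adjoint_of T V -> T * V = V * T ->
  nm (V x - conjc z *: x) = nm (T x - z *: x).
Proof.
move=> TV TVC; pose N := T - z *: (1 : bounded_op H).
pose N' := V - conjc z *: (1 : bounded_op H).
have NN' : adjoint_of N N' by apply/adjointB/adjointZ/adjoint1.
apply/esym; apply: (normal_nm (T := N) (V := N')) => //.
exact: sub_scalar_comm.
Qed.

(** By normality an approximate eigenvector of [T] at [z] is one of [V] at the conjugate of [z],
    hence of all four operators. *)
Lemma quad_approx T V z : adjoint_of T V -> T * V = V * T ->
  exists2 c : R, 0 < c & forall x k,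
    nm (quad T V k x - (quad_value z 0 k)%:C *: x) <= c * nm (T x - z *: x).
Proof.
move=> TV TVC; have [M M0 VM] := op_bound V.
exists (1 + M + cabs z) => [|x k]; first by rewrite ltr_wpDr ?cabs_ge0// addr_gt0.
have VN := normal_eigenvector_adjoint z x TV TVC.
pose d := nm (T x - z *: x); have d0 : 0 <= d := nm_ge0 _.
have Md : 0 <= M * d by rewrite mulr_ge0// ltW.
have zd : 0 <= cabs z * d by rewrite mulr_ge0// cabs_ge0.
rewrite -/d mxE /quad; case: k => -[|[|[|[|//]]]] ? /=.
- rewrite (_ : _ - _ = 0); [rewrite nm0; lra|by rewrite scale1r; exact: subrr].
- have -> : re_part T V x - (cre z)%:C *: x =
      (2^-1)%:C *: ((T x - z *: x) + (V x - conjc z *: x)).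
    rewrite addrACA -opprD -scalerDl scalerBr scalerA; congr (_ - _ *: _).
    by apply: complex_eq; rewrite !(creD, creM, cimD, cimM, creJ, cimJ) /=; field.
  rewrite nmZr ger0_norm ?invr_ge0//; have := nmD (T x - z *: x) (V x - conjc z *: x).
  by rewrite VN -/d; lra.
- have -> : im_part T V x - (cim z)%:C *: x =
      (0 -i* 2^-1) *: ((T x - z *: x) - (V x - conjc z *: x)).
    rewrite [- (V x - _)]opprD opprK addrACA -!scaleNr -scalerDl scalerDr scalerA.
    congr (_ + _ *: _).
    by apply: complex_eq; rewrite !(creD, creN, creM, cimD, cimN, cimM, creJ, cimJ) /=; field.
  rewrite nmZ (_ : cabs _ = 2^-1); last first.
    apply/eqP; rewrite -(eqrXn2 (n := 2)) ?cabs_ge0 ?invr_ge0//.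
    by rewrite cabs_sqr /= expr0n add0r sqrrN.
  have := nmBD (T x - z *: x) (V x - conjc z *: x).
  by rewrite VN -/d; lra.
- have -> : (V * T) x - (cabs z ^+ 2)%:C *: x =
      V (T x - z *: x) + z *: (V x - conjc z *: x).
    by rewrite opxB opxZ scalerBr scalerA mulJc addrA subrK.
  apply: le_trans (nmD _ _) _; rewrite nmZ VN -/d.
  by have := VM (T x - z *: x); rewrite -/d; lra.
Qed.

End NormalPencil.

Lemma cabs_sum (R : realType) (I : Type) (s : seq I) (P : pred I) (F : I -> R[i]) :
  cabs (\sum_(k <- s | P k) F k) <= \sum_(k <- s | P k) cabs (F k).
Proof.
elim/big_rec2: _ => [|k y1 y2 _ h]; first by rewrite cabs0.
by apply: le_trans (cabsD _ _) _; rewrite lerD2l.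
Qed.

Lemma nm_sum (R : realType) (H : hilbertType R) (I : Type) (s : seq I)
    (P : pred I) (F : I -> H) :
  nm (\sum_(k <- s | P k) F k) <= \sum_(k <- s | P k) nm (F k).
Proof.
elim/big_rec2: _ => [|k y1 y2 _ h]; first by rewrite nm0.
by apply: le_trans (nmD _ _) _; rewrite lerD2l.
Qed.

(** The inverse of [1] plus all the inverses also works for empty [I]. *)
Lemma positive_lower_bound (R : realFieldType) (I : finType) (f : I -> R) :
  (forall k, 0 < f k) -> exists2 e, 0 < e & forall k, e <= f k.
Proof.
move=> f0; have s0 : 0 <= \sum_k (f k)^-1.
  by apply: sumr_ge0 => k _; rewrite invr_ge0 ltW.
exists (1 + \sum_k (f k)^-1)^-1 => [|k]; first by rewrite invr_gt0 ltr_wpDr.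
rewrite -[leRHS]invrK lef_pV2 ?posrE ?invr_gt0 ?ltr_wpDr//.
rewrite (bigD1 k)//= addrCA lerDl addr_ge0// sumr_ge0// => j _.
by rewrite invr_ge0 ltW.
Qed.

Section Plane.
Variable R : realType.

(** On the plane of [plane_x] and [plane_y], a real diagonal form [r] has the entries
    [r0 + r2 + r3], [r1 + r2 + r3] and [r2 - i r3]. They determine [r], each [r j] being a
    combination of at most three of the bounded real numbers. *)
Definition plane_x (j : 'I_4) : R[i] := [:: 1; 0; 1; 1]`_j.
Definition plane_y (j : 'I_4) : R[i] := [:: 0; 1; 1; 0 +i* 1]`_j.

Lemma plane_bounds (r : 'I_4 -> R) (t : R) :
  cabs (\sum_j plane_x j * conjc (plane_x j) * (r j)%:C) <= 16 * t ->
  cabs (\sum_j plane_y j * conjc (plane_y j) * (r j)%:C) <= 16 * t ->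
  cabs (\sum_j plane_x j * conjc (plane_y j) * (r j)%:C) <= 16 * t ->
  forall j, `|r j| <= 48 * t.
Proof.
rewrite !big_ord_recl !big_ord0 /plane_x /plane_y /=.
set i1 : 'I_4 := lift ord0 ord0; set i2 : 'I_4 := lift ord0 (lift ord0 ord0).
set i3 : 'I_4 := lift ord0 (lift ord0 (lift ord0 ord0)).
move=> /(le_trans (cabs_Re_le _)) h1 /(le_trans (cabs_Re_le _)) h2 h.
have h4 := le_trans (cabs_Im_le _) h; have h3 := le_trans (cabs_Re_le _) h.
move=> j; have [->|->|->|->] : [\/ j = ord0, j = i1, j = i2 | j = i3].
  case: j => -[|[|[|[|//]]]] ?; [constructor 1|constructor 2|constructor 3|constructor 4];
    exact: val_inj.
all: move: (r ord0) (r i1) (r i2) (r i3) h1 h2 h3 h4 => r0 r1 r2 r3.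
all: rewrite {h} !(creD, creN, creM, cimD, cimN, cimM) /= !ler_norml.
all: move=> /andP[? ?] /andP[? ?] /andP[? ?] /andP[? ?]; apply/andP; split; lra.
Qed.

End Plane.

Section FourPoints.
Variables (R : realType) (H : hilbertType R).
Implicit Types (x y : H) (S T V : bounded_op H) (a z : R[i]).

Lemma eigenvectors_orthogonal T V z w x y : adjoint_of T V -> T * V = V * T ->
  nm x = 1 -> nm y = 1 ->
  cabs (z - w) * cabs (inner x y) <= nm (T x - z *: x) + nm (T y - w *: y).
Proof.
move=> TV TVC x1 y1; rewrite -cabsM.
have -> : (z - w) * inner x y = inner x (V y - conjc w *: y) - inner (T x - z *: x) y.
  by rewrite !innerE conjcK TV; ring.
apply: le_trans (cabsD _ _) _; rewrite cabsN addrC.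
apply: lerD; apply: le_trans (cauchy_schwarz _ _) _; rewrite ?y1 ?x1 ?mulr1//.
by rewrite mul1r (normal_eigenvector_adjoint w y TV TVC).
Qed.

Lemma approx_eigenvectors T V (z : 'I_4 -> R[i]) (eta : R) :
  adjoint_of T V -> T * V = V * T -> injective z ->
  (forall k, approx_spectrum T (z k)) -> 0 < eta ->
  exists e : 'I_4 -> H, [/\ forall k, nm (e k) = 1,
    forall j k, j != k -> cabs (inner (e j) (e k)) <= eta &
    forall k l, nm (quad T V l (e k) - (quad_value (z k) 0 l)%:C *: e k) <= eta].
Proof.
move=> TV TVC zinj zT eta0.
have /choice[c cP] : forall k, exists c : R, 0 < c /\ forall x l,
    nm (quad T V l x - (quad_value (z k) 0 l)%:C *: x) <= c * nm (T x - z k *: x).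
  by move=> k; have [c c0 cP] := quad_approx (z k) TV TVC; exists c.
have [d1 d10 d1P] : exists2 e, 0 < e & forall k, e <= eta / c k.
  by apply: positive_lower_bound => k; rewrite divr_gt0//; case: (cP k).
(* The value [1] on the diagonal is a dummy: only pairs of distinct points constrain [d2]. *)
have [d2 d20 d2P] : exists2 e, 0 < e & forall jk : 'I_4 * 'I_4,
    e <= if jk.1 == jk.2 then 1 else eta * cabs (z jk.1 - z jk.2) / 2.
  apply: positive_lower_bound => -[j k] /=; case: eqVneq => // jk.
  rewrite divr_gt0// mulr_gt0// lt_neqAle cabs_ge0 eq_sym cabs_eq0 subr_eq0 andbT.
  by apply: contraNneq jk => /zinj ->.
pose d := Num.min d1 d2; have d0 : 0 < d by rewrite lt_min d10.
have /choice[e eP] : forall k, exists x, nm x = 1 /\ nm (T x - z k *: x) <= d.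
  by move=> k; have [x x1 xT] := zT k d d0; exists x.
exists e; split=> [k|j k jk|k l]; first by case: (eP k).
- have [ej1 ejT] := eP j; have [ek1 ekT] := eP k.
  have := d2P (j, k); rewrite /= (negbTE jk) => dd.
  have d_d2 : d <= d2 by rewrite ge_min lexx orbT.
  have zjk : 0 < cabs (z j - z k).
    rewrite lt_neqAle cabs_ge0 eq_sym cabs_eq0 subr_eq0 andbT.
    by apply: contraNneq jk => /zinj ->.
  rewrite -(ler_pM2l zjk).
  have := eigenvectors_orthogonal (z j) (z k) TV TVC ej1 ek1; lra.
- have [ek1 ekT] := eP k; have [c0 ck] := cP k.
  apply: le_trans (ck (e k) l) _; rewrite mulrC -ler_pdivlMr//.
  by apply: le_trans ekT (le_trans _ (d1P k)); rewrite ge_min lexx.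
Qed.

(* On the (almost orthogonal) almost eigenvectors [e k], the pencil is almost
   diagonal with entries [p . quad_value (z k)]; its vanishing on the plane
   spanned by [e 0 + e 2 + e 3] and [e 1 + e 2 + i e 3] makes these small. *)
Lemma quad_values_dependent T V (A : 'M[R]_4) : adjoint_of T V -> common_norm T ->
  A \in unitmx ->
  (forall k, exists2 z, approx_spectrum T z & row k A = quad_value z) -> False.
Proof.
move=> TV cT Aunit hA; have TVC := common_norm_normal TV cT.
have /choice[z zP] : forall k, exists z, approx_spectrum T z /\ row k A = quad_value z.
  by move=> k; have [z zT zA] := hA k; exists z.
have zinj : injective z.
  move=> j k zjk; have : row j A = row k A.
    by rewrite (zP j).2 (zP k).2 zjk.
  rewrite !rowE => /(can_inj (mulmxK Aunit))/rowP/(_ j).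
  by rewrite !mxE !eqxx/=; case: eqVneq => // _ /eqP; rewrite oner_eq0.
(* [B] recovers the coefficients [p] from the diagonal values [r j]. *)
pose a := \sum_j \sum_k `|A j k|; pose B := invmx A^T; pose b := \sum_j \sum_k `|B j k|.
have a0 : 0 <= a by apply: sumr_ge0 => j _; exact: sumr_ge0.
have b0 : 0 <= b by apply: sumr_ge0 => j _; exact: sumr_ge0.
(* [1 / 16] makes the two test vectors independent; the other bound gives
   [48 * b * (1 + a) * eta < 1], so that [n1 <= 48 * tau * b] forces [n1 = 0]. *)
pose eta := Num.min (16^-1) (48 * b * (1 + a) + 1)^-1.
have c0 : 0 < 48 * b * (1 + a) + 1 by rewrite ltr_wpDl// !mulr_ge0// addr_ge0.
have eta0 : 0 < eta by rewrite lt_min !invr_gt0 c0 andbT.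
have [e [e1 eo eq]] := approx_eigenvectors TV TVC zinj (fun k => (zP k).1) eta0.
have AE j k : A j k = quad_value (z j) 0 k by rewrite -(zP j).2 mxE.
have comb_inner (al : 'I_4 -> R[i]) k : (forall j, cabs (al j) <= 1) ->
    cabs (inner (\sum_j al j *: e j) (e k) - al k) <= 4 * eta.
  move=> al1; have -> : inner (\sum_j al j *: e j) (e k) - al k =
      \sum_(j | j != k) al j * inner (e j) (e k).
    rewrite inner_suml (bigD1 k)//= innerZl inner_self e1 expr1n mulr1.
    by rewrite addrAC subrr add0r; apply: eq_bigr => j _; rewrite innerZl.
  apply: le_trans (cabs_sum _ _ _) _.
  apply: (@le_trans _ _ (\sum_(j : 'I_4) eta)).
    rewrite big_mkcond/=; apply: ler_sum => j _; case: ifP => [jk|_]; last exact: ltW.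
    by rewrite cabsM -[leRHS]mul1r ler_pM ?cabs_ge0// eo.
  by rewrite sumr_const card_ord mulr_natl.
pose al := @plane_x R; pose be := @plane_y R.
have al1 j : cabs (al j) <= 1.
  by case: j => -[|[|[|[|//]]]] ?; rewrite /al /plane_x /= ?cabs1 ?cabs0.
have be1 j : cabs (be j) <= 1.
  case: j => -[|[|[|[|//]]]] ?; rewrite /be /plane_y /= ?cabs1 ?cabs0//.
  by rewrite cabs_i.
pose x := \sum_j al j *: e j; pose y := \sum_j be j *: e j.
have eta16 : eta <= 16^-1 by rewrite ge_min lexx.
have [x0 x1 y0 y1] : [/\ cabs (inner x (e 0) - 1) <= 4^-1, cabs (inner x (e 1)) <= 4^-1,
    cabs (inner y (e 0)) <= 4^-1 & cabs (inner y (e 1) - 1) <= 4^-1].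
  have e4 : 4 * eta <= 4^-1 by lra.
  split; apply: le_trans e4.
  - exact: comb_inner al 0 al1.
  - by have := comb_inner al 1 al1; rewrite subr0.
  - by have := comb_inner be 0 be1; rewrite subr0.
  - exact: comb_inner be 1 be1.
have one_le (c : R[i]) : cabs (c - 1) <= 4^-1 -> 3 / 4 <= cabs c.
  by have := cabsD c (- (c - 1)); rewrite cabsN opprB addrC subrK cabs1; lra.
have [||p p0 [px py pxy]] := @common_norm_pencil _ H T V x y TV cT.
- apply/eqP => xz; have := one_le _ x0; rewrite xz inner0l cabs0; lra.
- move=> c yx; have := one_le _ x0; have := one_le _ y1; move: x1 y0.
  rewrite yx !innerZl !cabsM; have := cabs_ge0 c.
  have := cabs_ge0 (inner x (e 0)); have := cabs_ge0 (inner x (e 1)).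
  by move: (cabs c) (cabs _) (cabs _) => u v w; nra.
pose n1 := \sum_k `|p 0 k|.
have n10 : 0 <= n1 by exact: sumr_ge0.
pose r j := \sum_k p 0 k * A j k.
pose tau := n1 * (eta * (1 + a)).
have A_le j k : `|A j k| <= a.
  rewrite /a (bigD1 j)//= (bigD1 k)//= -addrA lerDl.
  by apply: addr_ge0; apply: sumr_ge0 => // l _; exact: sumr_ge0.
have rb j : `|r j| <= n1 * a.
  apply: le_trans (ler_norm_sum _ _ _) _; rewrite mulr_suml; apply: ler_sum => k _.
  by rewrite normrM ler_wpM2l.
have Eerr j : nm (pencil T V p (e j) - (r j)%:C *: e j) <= n1 * eta.
  have -> : pencil T V p (e j) - (r j)%:C *: e j =
      \sum_k (p 0 k)%:C *: (quad T V k (e j) - (A j k)%:C *: e j).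
    rewrite /r rmorph_sum scaler_suml /pencil op_sum -sumrB.
    by apply: eq_bigr => k _; rewrite opZ scalerBr scalerA rmorphM.
  apply: le_trans (nm_sum _ _ _) _; rewrite mulr_suml; apply: ler_sum => k _.
  by rewrite nmZr ler_wpM2l// AE.
have diag j k : cabs (inner (pencil T V p (e j)) (e k) -
    (if j == k then (r j)%:C else 0)) <= tau.
  have er u : nm u = 1 ->
      cabs (inner (pencil T V p (e j) - (r j)%:C *: e j) u) <= n1 * eta.
    by move=> u1; apply: le_trans (cauchy_schwarz _ _) _; rewrite u1 mulr1.
  have := er _ (e1 k); rewrite innerBl innerZl; case: eqVneq => [->|jk].
    rewrite inner_self e1 expr1n mulr1 => /le_trans; apply; rewrite /tau ler_wpM2l//.
    by rewrite mulrDr mulr1 lerDl mulr_ge0// ltW.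
  rewrite subr0 => h; rewrite -[inner _ _](subrK ((r j)%:C * inner (e j) (e k))).
  apply: le_trans (cabsD _ _) _; rewrite cabsM cabs_real.
  have : `|r j| * cabs (inner (e j) (e k)) <= n1 * a * eta.
    by rewrite ler_pM ?cabs_ge0 ?eo.
  by rewrite /tau; lra.
have comb (f g : 'I_4 -> R[i]) : (forall j, cabs (f j) <= 1) ->
    (forall j, cabs (g j) <= 1) ->
    cabs (inner (pencil T V p (\sum_j f j *: e j)) (\sum_j g j *: e j) -
      \sum_j f j * conjc (g j) * (r j)%:C) <= 16 * tau.
  move=> f1 g1; have -> : inner (pencil T V p (\sum_j f j *: e j)) (\sum_j g j *: e j) -
      \sum_j f j * conjc (g j) * (r j)%:C = \sum_j \sum_k f j * conjc (g k) *
      (inner (pencil T V p (e j)) (e k) - (if j == k then (r j)%:C else 0)).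
    rewrite opx_sum inner_suml -sumrB; apply: eq_bigr => j _.
    rewrite inner_sumr; under [RHS]eq_bigr do rewrite mulrBr.
    rewrite sumrB; congr (_ - _).
      by apply: eq_bigr => k _; rewrite opxZ innerZl innerZr mulrA.
    rewrite (bigD1 j)//= eqxx big1 ?addr0// => k kj.
    by rewrite eq_sym (negbTE kj) mulr0.
  apply: le_trans (cabs_sum _ _ _) _.
  have -> : 16 * tau = \sum_(j < 4) \sum_(k < 4) tau.
    by rewrite !sumr_const !card_ord -mulrnA mulr_natl.
  apply: ler_sum => j _; apply: le_trans (cabs_sum _ _ _) _.
  apply: ler_sum => k _; rewrite !cabsM cabsJ -[leRHS]mul1r.
  by rewrite ler_pM ?mulr_ge0 ?cabs_ge0// -[leRHS]mul1r ler_pM ?cabs_ge0.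
have h1 := comb _ _ al1 al1; have h2 := comb _ _ be1 be1.
have h3 := comb _ _ al1 be1; rewrite -/x -/y px py pxy !sub0r !cabsN in h1 h2 h3.
have r48 : forall j, `|r j| <= 48 * tau by exact: plane_bounds h1 h2 h3.
have pr : p = (\row_j r j) *m B.
  have -> : \row_j r j = p *m A^T.
    by apply/rowP => j; rewrite !mxE; apply: eq_bigr => k _; rewrite mxE.
  by rewrite mulmxK// unitmx_tr.
have tau0 : 0 <= tau by rewrite mulr_ge0// mulr_ge0 ?addr_ge0// ltW.
have n1le : n1 <= 48 * tau * b.
  apply: (@le_trans _ _ (\sum_k \sum_j `|r j| * `|B j k|)).
    apply: ler_sum => k _; rewrite {1}pr mxE; apply: le_trans (ler_norm_sum _ _ _) _.
    by apply: ler_sum => j _; rewrite normrM mxE.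
  rewrite exchange_big/= /b mulr_sumr; apply: ler_sum => j _.
  by rewrite mulr_sumr; apply: ler_sum => k _; rewrite ler_wpM2r.
have n1z : n1 = 0.
  apply/eqP; rewrite eq_le n10 andbT.
  have : eta <= (48 * b * (1 + a) + 1)^-1 by rewrite ge_min lexx orbT.
  rewrite -[_^-1]mul1r ler_pdivlMr// => etab.
  have : n1 * (1 - 48 * b * (1 + a) * eta) <= 0 by move: n1le; rewrite /tau; lra.
  by rewrite pmulr_lle0//; lra.
move: p0; apply/negP; rewrite negbK; apply/eqP/rowP => k; rewrite mxE.
apply/eqP; rewrite -normr_eq0 eq_le normr_ge0 andbT -[leRHS]n1z /n1 (bigD1 k)//= lerDl.
exact: sumr_ge0.
Qed.

End FourPoints.

(** * From a relation on the spectrum to an operator relation *)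

Section PencilRelation.
Variables (R : realType) (H : hilbertType R).
Implicit Types (x y : H) (S T V : bounded_op H) (z : R[i]).

Lemma comm_re_part S T V : S * T = T * S -> S * V = V * S ->
  S * re_part T V = re_part T V * S.
Proof.
by move=> ST SV; apply/esym/comm_opZ; rewrite mulrDl mulrDr ST SV.
Qed.

Lemma comm_im_part S T V : S * T = T * S -> S * V = V * S ->
  S * im_part T V = im_part T V * S.
Proof.
by move=> ST SV; apply/esym/comm_opZ; rewrite mulrBl mulrBr ST SV.
Qed.

Lemma comm_pencil S T V p : S * T = T * S -> S * V = V * S ->
  S * pencil T V p = pencil T V p * S.
Proof.
move=> ST SV; rewrite mulr_sumr mulr_suml; apply: eq_bigr => k _.
apply/esym/comm_opZ; rewrite /quad; case: k => -[|[|[|[|//]]]] ? /=.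
- by rewrite mulr1 mul1r.
- by rewrite comm_re_part.
- by rewrite comm_im_part.
- by rewrite -mulrA -ST !mulrA SV.
Qed.

(** The square of the defect is at most [s^4 - s^2 |S x|^2], small when [|S x|] is close to [s].
    Using the square of [S] avoids a choice of sign for the eigenvalue. *)
Lemma opnorm_attained S (e : R) : self_adjoint S -> S != 0 -> 0 < e ->
  exists2 x, nm x = 1 & nm ((opnorm S ^+ 2)%:C *: x - S (S x)) <= e.
Proof.
move=> hS S0 e0; set s := opnorm S.
have s0 : 0 < s.
  rewrite lt_neqAle opnorm_ge0 andbT eq_sym; apply: contraNneq S0 => s0.
  apply/eqP/bounded_op_inj => x; apply/eqP; rewrite -nm_eq0 eq_le nm_ge0 andbT.
  by have := opnorm_ub S x; rewrite -/s s0 mul0r.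
pose d := Num.min s (e ^+ 2 / (2 * s ^+ 3)).
have d0 : 0 < d by rewrite lt_min s0 divr_gt0 ?exprn_gt0// mulr_gt0// exprn_gt0.
have ds : d <= s by rewrite ge_min lexx.
have de : s ^+ 2 * (2 * s * d) <= e ^+ 2.
  have : d <= e ^+ 2 / (2 * s ^+ 3) by rewrite ge_min lexx orbT.
  by rewrite ler_pdivlMr ?mulr_gt0 ?exprn_gt0//; lra.
have [x x1 Sx] : exists2 x, nm x = 1 & s - d <= nm (S x).
  apply: contrapT => h; suff : s <= s - d by lra.
  apply: opnorm_le => [|x]; first by rewrite subr_ge0.
  have [->|x0] := eqVneq x 0; first by rewrite opx0 nm0 mulr0.
  rewrite -ler_pdivrMr ?nm_gt0// leNgt; apply/negP => Sx; apply: h.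
  exists ((nm x)^-1%:C *: x); first exact: normalizeP.
  by rewrite opxZ nmZr ger0_norm ?invr_ge0 ?nm_ge0// mulrC ltW.
exists x => //; rewrite -(ler_pXn2r (n := 2)) ?nnegrE ?nm_ge0 ?(ltW e0)//.
rewrite nm_sqrB nmZr x1 mulr1 innerZl creZ -hS -nm_sqr ger0_norm ?sqr_ge0//.
have h1 : nm (S (S x)) ^+ 2 <= s ^+ 2 * nm (S x) ^+ 2.
  by rewrite -exprMn ler_pXn2r ?nnegrE ?nm_ge0 ?mulr_ge0 ?nm_ge0 ?(ltW s0)// opnorm_ub.
have h2 : (s - d) ^+ 2 <= nm (S x) ^+ 2.
  by rewrite ler_pXn2r ?nnegrE ?nm_ge0 ?subr_ge0.
apply: le_trans de; have := ler_wpM2l (sqr_ge0 s) h2.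
have := mulr_ge0 (sqr_ge0 s) (sqr_ge0 d); nra.
Qed.

(* Otherwise a norming approximate eigenvector of the pencil can be chosen to
   be one of [T] as well. *)
Lemma pencil_annihilated T V p : adjoint_of T V -> T * V = V * T ->
  (forall z, approx_spectrum T z -> quad_value z *m p^T = 0) ->
  pencil T V p = 0.
Proof.
move=> TV TVC pZ; apply/eqP/negPn/negP; set S := pencil T V p => S0.
have hS : self_adjoint S := pencil_self_adjoint p TV.
have hB := re_part_self_adjoint TV; have hC := im_part_self_adjoint TV.
set B := re_part T V in hB; set C := im_part T V in hC.
have TB : T * B = B * T by exact: comm_re_part.
have VB : V * B = B * V by apply: comm_re_part.
have BS : B * S = S * B by apply: comm_pencil; apply/esym.
have CS : C * S = S * C.
  by apply: comm_pencil; apply/esym; exact: comm_im_part.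
have CB : C * B = B * C.
  by apply: comm_re_part; apply/esym; exact: comm_im_part.
have TE x : T x = B x + (0 +i* 1) *: C x by exact: re_im_partE.
have SE : S = pencil T V p by [].
clearbody B C S.
have happ (X Y : bounded_op H) x : X * Y = Y * X -> X (Y x) = Y (X x).
  by move=> XY; rewrite -!opM XY.
have [MB MB0 BM] := op_bound B; have [MC MC0 CM] := op_bound C.
(* Norming vectors of [S] are refined to approximate eigenvectors of [B] and then of [C]; both
   commute with [S], so the gauges are respected. *)
pose s2 := opnorm S ^+ 2.
pose N0 x := nm (s2%:C *: x - S (S x)).
have N0D x y : N0 (x + y) <= N0 x + N0 y.
  by rewrite /N0 scalerDr !opxD opprD addrACA nmD.
have N0Z a x : N0 (a *: x) = cabs a * N0 x.
  by rewrite /N0 !opxZ !scalerA mulrC -scalerA -scalerBr nmZ.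
have [||||||b b1 _] := @joint_spectral_value _ _ set0 N0 B MB hB.
- by [].
- exact: N0D.
- exact: N0Z.
- exact: ltW.
- move=> x; rewrite /N0 -!(happ B S)// -opxZ -opxB; exact: BM.
- move=> t tW e e0; have [x x1 Sx] := opnorm_attained hS S0 e0.
  by exists x; split=> // y /tW.
pose N1 x := N0 x + nm (B x - b%:C *: x).
have N0_ge0 x : 0 <= N0 x := nm_ge0 _.
have [||||||c c1 _] := @joint_spectral_value _ _ set0 N1 C MC hC.
- by [].
- move=> x y; rewrite /N1 addrACA; apply: lerD; first exact: N0D.
  by rewrite scalerDr opxD opprD addrACA nmD.
- move=> a x; rewrite /N1 N0Z mulrDr; congr (_ + _).
  by rewrite opxZ scalerA mulrC -scalerA -scalerBr nmZ.
- exact: ltW.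
- move=> x; rewrite /N1 /N0 -!(happ C S)// -(happ C B)// -!opxZ -!opxB mulrDr.
  by apply: lerD; exact: CM.
- exact: b1.
pose z : R[i] := b +i* c.
have Tz x : nm (T x - z *: x) <= nm (B x - b%:C *: x) + nm (C x - c%:C *: x).
  have -> : T x - z *: x = (B x - b%:C *: x) + (0 +i* 1) *: (C x - c%:C *: x).
    rewrite TE scalerBr addrACA -opprD; congr (_ - _).
    rewrite scalerA -scalerDl; congr (_ *: _).
    by apply: complex_eq; rewrite !(creD, creM, cimD, cimM) /=; ring.
  by apply: le_trans (nmD _ _) _; rewrite nmZ cabs_i mul1r.
have zT : approx_spectrum T z.
  move=> e e0; have [//|x [x1 _ Nx]] := c1 [::] _ e e0.
  exists x => //; apply: le_trans (Tz x) (le_trans _ Nx).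
  by rewrite /N1 lerD2r lerDr.
have [k k0 kP] := quad_approx z TV TVC.
pose n1 := \sum_j `|p 0 j|; have n10 : 0 <= n1 by exact: sumr_ge0.
have Sz x : nm (S x) <= n1 * k * nm (T x - z *: x).
  have -> : S x = \sum_j (p 0 j)%:C *: (quad T V j x - (quad_value z 0 j)%:C *: x).
    transitivity (S x - (\sum_j p 0 j * quad_value z 0 j)%:C *: x).
      have := pZ z zT => /rowP/(_ 0); rewrite !mxE.
      rewrite (eq_bigr (fun j => p 0 j * quad_value z 0 j)) => [->|j _].
        by rewrite scale0r subr0.
      by rewrite mulrC mxE.
    rewrite rmorph_sum scaler_suml SE /pencil op_sum -sumrB.
    by apply: eq_bigr => j _; rewrite opZ scalerBr scalerA rmorphM.
  apply: le_trans (nm_sum _ _ _) _; rewrite -mulrA mulr_suml; apply: ler_sum => j _.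
  by rewrite nmZr ler_wpM2l.
have [M M0 SM] := op_bound S.
have s20 : 0 < s2.
  rewrite exprn_gt0// lt_neqAle opnorm_ge0 andbT eq_sym; apply: contraNneq S0 => s0.
  apply/eqP/bounded_op_inj => x; apply/eqP; rewrite -nm_eq0 eq_le nm_ge0 andbT.
  by have := opnorm_ub S x; rewrite s0 mul0r.
have K0 : 0 < 1 + M * (n1 * k) by rewrite ltr_wpDr// !mulr_ge0// ltW.
(* With this tolerance the estimate [h1] reads [s2 <= s2 / 2]. *)
have e0 : 0 < s2 / (2 * (1 + M * (n1 * k))) by rewrite divr_gt0// mulr_gt0.
have [//|x [x1 _ Nx]] := c1 [::] _ _ e0.
move: Nx; rewrite ler_pdivlMr ?mulr_gt0// /N1.
set d0 := N0 x; set d := nm (B x - _); set d' := nm (C x - _) => Nx.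
have h1 : s2 <= d0 + M * (n1 * k * (d + d')).
  have : s2 <= d0 + nm (S (S x)).
    have := nmB_ge (s2%:C *: x) (S (S x)).
    by rewrite nmZr x1 mulr1 (gtr0_norm s20) -/(N0 x) -/d0; lra.
  move=> /le_trans; apply; rewrite lerD2l (le_trans (SM _))// ler_wpM2l ?(ltW M0)//.
  by apply: le_trans (Sz x) _; rewrite ler_wpM2l ?Tz// mulr_ge0// ltW.
have d00 : 0 <= d0 := N0_ge0 x.
have : 0 <= d0 * (M * (n1 * k)) by rewrite !mulr_ge0// ltW.
have : 0 <= d + d' by rewrite addr_ge0 ?nm_ge0.
by lra.
Qed.

(* A line if [p3 = 0], otherwise a circle. *)
Lemma pencil_eq0_affine T V (p0 p1 p2 p3 : R) : adjoint_of T V -> T * V = V * T ->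
  (p0, p1, p2, p3) != (0, 0, 0, 0) ->
  (forall x, p0%:C *: x + p1%:C *: re_part T V x + p2%:C *: im_part T V x +
     p3%:C *: V (T x) = 0) ->
  (exists (lambda mu : R[i]) L, self_adjoint L /\
     T = lambda *: (1 : bounded_op H) + mu *: L) \/
  (exists (lambda mu : R[i]) U, [/\ mu != 0, unitary U &
     T = lambda *: (1 : bounded_op H) + mu *: U]).
Proof.
move=> TV TVC pn0 pT.
have hB := re_part_self_adjoint TV; have hC := im_part_self_adjoint TV.
have TE x := re_im_partE T V x; have VE x := re_im_part_adjE T V x.
move: hB hC TE VE pT; move: (re_part T V) (im_part T V) => B C hB hC TE VE pT.
have self_adjoint0 : self_adjoint (0 : bounded_op H).
  by move=> x y; rewrite inner0l inner0r.
have [p30|p30] := eqVneq p3 0.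
  left; have pT' x : p1%:C *: B x + p2%:C *: C x = - (p0%:C *: x).
    apply/eqP; rewrite -addr_eq0 addrC addrA.
    by have := pT x; rewrite p30 scale0r addr0 => ->.
  have [/andP[/eqP p10 /eqP p20]|wn0] := boolP ((p1 == 0) && (p2 == 0)).
    have p00 : p0%:C != 0.
      by apply: contraNneq pn0 => -[->]; rewrite p10 p20 p30.
    exists 0, 0, 0; split=> //; apply: bounded_op_inj => x.
    have x0 : x = 0.
      have := pT' x; rewrite p10 p20 !scale0r addr0 => /esym/eqP.
      by rewrite oppr_eq0 scaler_eq0 (negbTE p00) => /eqP.
    by rewrite x0 !opx0.
  (* The real part of [w T] is [p1 B + p2 C = - p0], and its imaginary part is the self-adjoint
     operator sought. *)
  pose w : R[i] := p1 -i* p2; have w0 : w != 0.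
    by apply: contraNneq wn0 => -[-> /eqP]; rewrite oppr_eq0 => ->; rewrite eqxx.
  exists (w^-1 * (- p0)%:C), (w^-1 * (0 +i* 1)), (p1%:C *: C - p2%:C *: B); split.
    by apply: adjointB; exact: self_adjointZ.
  apply: bounded_op_inj => x; apply: (scalerI w0).
  rewrite opD !opZ op1 scalerDr !scalerA !mulrA !divff// !mul1r opB !opZ.
  rewrite rmorphN scaleNr -pT' [T x]TE scalerDr scalerBr !scalerA.
  rewrite [in RHS](addrC (_ *: C x)) addrACA -scalerBl -scalerDl.
  congr (_ *: _ + _ *: _).
    by apply: complex_eq; rewrite !(creD, creN, creM, cimD, cimN, cimM) /=; ring.
  by apply: complex_eq; rewrite !(creD, creN, creM, cimD, cimN, cimM) /=; ring.
have p3c : p3%:C != 0 by apply: contraNneq p30 => -[->].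
(* Completing the square: [l] is the centre of the circle and [rho] its squared radius. *)
pose l : R[i] := (- (p1 / (2 * p3))) +i* (- (p2 / (2 * p3))).
pose N := T - l *: (1 : bounded_op H); pose N' := V - conjc l *: (1 : bounded_op H).
have NN' : adjoint_of N N' by apply/adjointB/adjointZ/adjoint1.
have NC : N * N' = N' * N by exact: sub_scalar_comm.
pose rho := cabs l ^+ 2 - p0 / p3.
have e1 : p3%:C * (l + conjc l) = - p1%:C.
  by apply: complex_eq; rewrite !(creD, creN, creM, cimD, cimN, cimM) /=; field.
have e2 : p3%:C * ((0 +i* 1) * (l - conjc l)) = p2%:C.
  by apply: complex_eq; rewrite !(creD, creN, creM, cimD, cimN, cimM) /=; field.
have e3 : p3%:C * rho%:C = p3%:C * (l * conjc l) - p0%:C.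
  by rewrite mulJc -!rmorphM -rmorphB/=; congr _%:C; rewrite /rho; field.
clearbody rho l.
have N'N x : N' (N x) = rho%:C *: x.
  apply: inner_inj => y.
  have -> : N' (N x) = V (T x) - l *: V x - conjc l *: (T x - l *: x).
    by rewrite /N' /N !opB !opZ !op1 opxB opxZ.
  have h : inner (p0%:C *: x + p1%:C *: B x + p2%:C *: C x + p3%:C *: V (T x)) y = 0.
    by rewrite pT inner0l.
  rewrite !innerDl !innerZl in h.
  rewrite [V x]VE !innerE.
  rewrite [inner (T x) y](_ : _ = inner (B x) y + (0 +i* 1) * inner (C x) y); last first.
    by rewrite [T x]TE innerDl innerZl.
  move: h; move: (inner x y) (inner (B x) y) (inner (C x) y) (inner (V (T x)) y).
  move=> X BX CX U h; apply: (mulfI p3c); apply/eqP; rewrite -subr_eq0; apply/eqP.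
  rewrite [p3%:C * (rho%:C * X)]mulrA e3.
  transitivity (p3%:C * U - p3%:C * (l + conjc l) * BX +
      p3%:C * ((0 +i* 1) * (l - conjc l)) * CX + p0%:C * X); first by ring.
  by rewrite e1 e2 -[RHS]h; ring.
have TN : T = l *: (1 : bounded_op H) + N by rewrite /N addrC subrK.
clearbody N N'.
have nN x : nm (N x) ^+ 2 = rho * nm x ^+ 2.
  by rewrite nm_sqr -(adjoint_sym NN') N'N innerZl creZ -nm_sqr.
(* The circle degenerates to at most a point, and [T] is the scalar [l]. *)
have [rho0|rho0] := lerP rho 0.
  left; exists l, 0, 0; split=> //; rewrite scale0r addr0 TN.
  rewrite (_ : N = 0) ?addr0//; apply: bounded_op_inj => x; apply/eqP.
  rewrite -nm_eq0 -sqrf_eq0 eq_le sqr_ge0 andbT nN.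
  by rewrite mulr_le0_ge0// sqr_ge0.
right; pose s := Num.sqrt rho; have s0 : 0 < s by rewrite sqrtr_gt0.
have sc : s%:C != 0 by apply/eqP => -[s0']; rewrite s0' ltxx in s0.
have rs : (s^-1)%:C * ((s^-1)%:C * rho%:C) = 1.
  rewrite -!rmorphM/= mulrA -expr2 exprVn sqr_sqrtr ?ltW// mulVf//.
  by rewrite gt_eqF.
exists l, s%:C, (s^-1%:C *: N); split=> //.
  exists (s^-1%:C *: N'); split.
  - by rewrite -{2}[s^-1%:C]conjc_real; exact: adjointZ.
  - by apply: bounded_op_inj => x; rewrite opM !opZ opxZ N'N !scalerA -mulrA rs scale1r.
  - apply: bounded_op_inj => x; rewrite opM !opZ opxZ -[N (N' x)]opM NC opM N'N.
    by rewrite !scalerA -mulrA rs scale1r.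
by rewrite scalerA -rmorphM/= divff ?gt_eqF// scale1r.
Qed.

End PencilRelation.

(** * The essential spectrum lies on a half-circle *)

Section HalfPlane.
Variable R : realType.
Implicit Types (z w : R[i]) (m s x y : R).

(** For angles in [[0, pi]], [m <= x] says that [x + i y] has the smaller angle, and [s x - m y] is
    the sine of the difference. *)
Lemma unit_circle_order m s x y : m ^+ 2 + s ^+ 2 = 1 -> x ^+ 2 + y ^+ 2 = 1 ->
  0 <= s -> 0 <= y -> m <= x -> m * y <= s * x.
Proof.
move=> ms xy s0 y0 mx; have [m0|m0] := lerP 0 m.
  have ys : y <= s.
    rewrite -(ler_pXn2r (n := 2)) ?nnegrE//.
    have : m ^+ 2 <= x ^+ 2 by rewrite ler_pXn2r ?nnegrE ?(le_trans m0).
    lra.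
  have := ler_wpM2l m0 ys; have := ler_wpM2l s0 mx; lra.
have [x0|x0] := lerP 0 x.
  by have := mulr_ge0 s0 x0; have := mulr_le0_ge0 (ltW m0) y0; lra.
have sy : s <= y.
  rewrite -(ler_pXn2r (n := 2)) ?nnegrE//.
  have : (- x) ^+ 2 <= (- m) ^+ 2
    by rewrite ler_pXn2r ?nnegrE ?oppr_ge0 ?(ltW x0) ?(ltW m0)// lerN2.
  by rewrite !sqrrN; lra.
by have := ler_wpM2l s0 mx; have := ler_wnM2l (ltW m0) sy; lra.
Qed.

(** For angles in [(0, pi)], a negative sum of cosines means that the angles add up to more than
    [pi]; the conclusion is about the sine of their sum. *)
Lemma unit_circle_crossing x x' y y' : x ^+ 2 + y ^+ 2 = 1 -> x' ^+ 2 + y' ^+ 2 = 1 ->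
  0 < y -> 0 < y' -> x + x' < 0 -> x * y' + x' * y < 0.
Proof.
have main (u u' v v' : R) : u ^+ 2 + v ^+ 2 = 1 -> u' ^+ 2 + v' ^+ 2 = 1 ->
    0 < v -> 0 < v' -> u + u' < 0 -> u' < 0 -> u * v' + u' * v < 0.
  move=> uv uv' v0 v0' uu u'0; have [u0|u0] := lerP u 0.
    by have := mulr_le0_ge0 u0 (ltW v0'); have := nmulr_rlt0 v u'0; rewrite v0; lra.
  have d0 : 0 < u * v' - u' * v.
    by have := mulr_gt0 u0 v0'; have := nmulr_rlt0 v u'0; rewrite v0; lra.
  rewrite -(pmulr_rlt0 _ d0).
  have -> : (u * v' - u' * v) * (u * v' + u' * v) = (u - u') * (u + u').
    have -> : (u * v' - u' * v) * (u * v' + u' * v) =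
      u ^+ 2 * v' ^+ 2 - u' ^+ 2 * v ^+ 2 by ring.
    have -> : v' ^+ 2 = 1 - u' ^+ 2 by lra.
    have -> : v ^+ 2 = 1 - u ^+ 2 by lra.
    by ring.
  by rewrite pmulr_rlt0//; lra.
move=> xy xy' y0 y0' xx; have [x'0|x'0] := ltrP x' 0; first exact: main.
rewrite addrC; apply: main => //; lra.
Qed.

(** Three distinct points keep the weight of the shift nonzero; the fourth may repeat one of
    them. *)
Definition positive_relation (S : set R[i]) (z : 'I_4 -> R[i]) (a : 'I_4 -> R) :=
  [/\ forall k, S (z k), forall k, 0 < a k, \sum_k (a k)%:C * z k = 0 &
      [/\ z 0 != z 1, z 1 != z (inord 2) & z (inord 2) != z 0]].

(* [0] is interior to the triangle [1, w, w'], unless [-1] is needed as a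
   fourth vertex. *)
Lemma positive_relation1 (S : set R[i]) :
  (forall z, S z -> cabs z = 1) -> S 1 ->
  (forall w, cabs w = 1 -> exists2 z, S z & cre (w * z) < 0) ->
  exists (z : 'I_4 -> R[i]) a, positive_relation S z a.
Proof.
move=> S1 S_1 hS.
have circ z : S z -> cre z ^+ 2 + cim z ^+ 2 = 1.
  by move=> /S1 z1; rewrite -cabs_sqr z1 expr1n.
have cabs_imag (r : R) : r ^+ 2 = 1 -> cabs (0 +i* r) = 1.
  move=> r1; apply/eqP; rewrite -(eqrXn2 (n := 2)) ?cabs_ge0//.
  by rewrite cabs_sqr /= expr0n add0r r1 expr1n.
(* With the weights [- cim w'] and [cim w] the imaginary parts of [w] and [w'] cancel; [1] and [z4]
   then have to balance a real number. *)
suff [w [w' [Sw Sw' w0 w'0 [r1 [r2 [z4 [S4 r10 r20 rE]]]]]]] :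
    exists w w', [/\ S w, S w', 0 < cim w, cim w' < 0 &
      exists (r1 r2 : R) z4, [/\ S z4, 0 < r1, 0 < r2 &
        r1%:C + r2%:C * z4 = - (cre w * - cim w' + cre w' * cim w)%:C]].
  exists (fun k => [:: 1; w; w'; z4]`_k), (fun k => [:: r1; - cim w'; cim w; r2]`_k).
  split.
  - by case=> -[|[|[|[|//]]]].
  - by case=> -[|[|[|[|//]]]] ? //=; rewrite oppr_gt0.
  - rewrite !big_ord_recl big_ord0 /= mulr1 addr0.
    rewrite [r1%:C + _]addrC -!addrA [r2%:C * _ + _]addrC rE.
    by apply: complex_eq; rewrite !(creD, creN, creM, cimD, cimN, cimM) /=; ring.
  - rewrite !inordK//=; split; apply/eqP => /(congr1 (@complex.Im R)) /=; lra.
have [wu Swu wu0] : exists2 w, S w & 0 < cim w.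
  have [z Sz] := hS _ (cabs_imag 1 (expr1n _ _)).
  by rewrite creM /= => h; exists z => //; lra.
have [wl Swl wl0] : exists2 w, S w & cim w < 0.
  have [|z Sz] := hS (0 +i* (-1)); first by rewrite cabs_imag// sqrrN expr1n.
  by rewrite creM /= => h; exists z => //; lra.
(* With [z4 = -1] only the difference of [r1] and [r2] is prescribed, so any points above and below
   the real axis do. *)
have [Sm1|Sm1] := pselect (S (-1)).
  exists wu, wl; split=> //; set rho := _ + _.
  exists ((`|rho| - rho) / 2 + 1), ((`|rho| + rho) / 2 + 1), (-1); split=> //.
  - have := ler_norm rho; lra.
  - have := ler_norm (- rho); rewrite normrN; lra.
  - by apply: complex_eq; rewrite !(creD, creN, creM, cimD, cimN, cimM) /=; field.
have [w [w' [Sw Sw' w0 w'0 ww']]] : exists w w',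
    [/\ S w, S w', 0 <= cim w, cim w' <= 0 & cre w + cre w' < 0].
  apply: contrapT => h.
  (* Otherwise, with [m] the infimum of [X] and [m + i s] on the upper half-circle, all of [S] lies
     on one side of the line through [0] and [m + i s], against [hS]. *)
  pose X := [set cre w | w in [set w | S w /\ 0 <= cim w]].
  have X1 : X 1 by exists 1.
  have Xlb x : X x -> -1 <= x.
    move=> [w [Sw _] <-]; have := cabs_Re_le w; rewrite S1// ler_norml.
    by case/andP.
  have Xinf : has_inf X by split; [exists 1|exists (-1) => x /Xlb].
  pose m := inf X.
  have mX x : X x -> m <= x by move=> Xx; apply: ge_inf => //; case: Xinf.
  have Xm y : (forall x, X x -> y <= x) -> y <= m by apply: lb_le_inf; case: Xinf.
  clearbody m; have m1 : m <= 1 by exact: mX.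
  have m1' : -1 <= m by exact: Xm.
  have m2 : 0 <= 1 - m ^+ 2.
    have -> : 1 - m ^+ 2 = (1 - m) * (1 - - m) by ring.
    by rewrite mulr_ge0// subr_ge0// lerNl.
  pose s := Num.sqrt (1 - m ^+ 2); have s0 : 0 <= s := sqrtr_ge0 _.
  have ms : m ^+ 2 + s ^+ 2 = 1 by rewrite sqr_sqrtr//; lra.
  have [|z Sz] := hS (s +i* m).
    by apply/eqP; rewrite -(eqrXn2 (n := 2)) ?cabs_ge0// cabs_sqr /= addrC ms expr1n.
  rewrite creM /= ltNge => /negP; apply; rewrite subr_ge0.
  have cz := circ z Sz; have [z0|z0] := lerP 0 (cim z).
    by apply: unit_circle_order => //; apply: mX; exists z.
  rewrite -[m * _]mulrNN; apply: unit_circle_order; rewrite ?sqrrN ?oppr_ge0 ?(ltW z0)//.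
  rewrite lerNl; apply: Xm => _ [w [Sw w0] <-]; rewrite leNgt; apply/negP => wz; apply: h.
  exists w, z; split=> //; [exact: ltW|lra].
have not_real z : S z -> cre z < 1 -> cim z != 0.
  move=> Sz z1; apply: contra_notN Sm1 => /eqP z0; have := circ z Sz.
  rewrite z0 expr0n addr0 => /eqP; rewrite sqrf_eq1 => /orP[/eqP ze|/eqP ze].
    by rewrite ze ltxx in z1.
  by rewrite (_ : -1 = z)//; apply: complex_eq; rewrite ?z0 ?ze /= ?oppr0.
have le1 z : S z -> - cre z <= 1.
  by move=> Sz; have := cabs_Re_le z; rewrite S1// ler_norml; lra.
have {}w0 : 0 < cim w.
  by rewrite lt_neqAle w0 eq_sym not_real//; have := le1 _ Sw'; lra.
have {}w'0 : cim w' < 0.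
  by rewrite lt_neqAle w'0 not_real//; have := le1 _ Sw; lra.
have rho0 : cre w * - cim w' + cre w' * cim w < 0.
  apply: unit_circle_crossing => //; rewrite ?oppr_gt0 ?sqrrN//; exact: circ.
exists w, w'; split=> //; move: rho0; set rho := _ + _ => rho0.
exists (- rho / 2), (- rho / 2), 1; split=> //; [lra|lra|].
by apply: complex_eq; rewrite !(creD, creN, creM, cimD, cimN, cimM) /=; field.
Qed.

(** Dividing by a point [p] of [S] brings [1] into the set. *)
Lemma positive_relation_exists (S : set R[i]) :
  (forall z, S z -> cabs z = 1) ->
  (forall w, cabs w = 1 -> exists2 z, S z & cre (w * z) < 0) ->
  exists (z : 'I_4 -> R[i]) a, positive_relation S z a.
Proof.
move=> S1 hS; have [p Sp _] := hS 1 (cabs1 R).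
have p0 : p != 0 by rewrite -cabs_eq0 S1// oner_eq0.
have [|||z [a [Sz a0 az [z01 z12 z20]]]] :=
    @positive_relation1 [set w | S (p * w)].
- by move=> w /S1; rewrite cabsM (S1 p Sp) mul1r.
- by rewrite /= mulr1.
- move=> w w1; have [|z Sz wz] := hS (w / p).
    by rewrite cabsM cabsV (S1 p Sp) invr1 mulr1.
  by exists (p^-1 * z); rewrite /= ?mulrA ?divff ?mul1r.
exists (fun k => p * z k), a; split=> //.
  rewrite (eq_bigr (fun k => p * ((a k)%:C * z k))) => [|k _]; last by rewrite mulrCA.
  by rewrite -mulr_sumr az mulr0.
by rewrite !(inj_eq (mulfI p0)).
Qed.

(* The coefficients of the vectors [f_n = sum_i al_i e_(i,n) + be_i e_(i,n+1)]
   on which a diagonal operator with eigenvalues [z] compresses to a multiple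
   of the shift. *)
Lemma shift_coefficients (S : set R[i]) (z : 'I_4 -> R[i]) a :
  (forall w, S w -> cabs w = 1) -> positive_relation S z a ->
  exists al be : 'I_4 -> R[i],
    [/\ \sum_k (al k * conjc (al k) + be k * conjc (be k)) = 1,
        \sum_k be k * conjc (al k) = 0,
        \sum_k z k * (al k * conjc (al k) + be k * conjc (be k)) = 0,
        \sum_k z k * (al k * conjc (be k)) = 0 &
        \sum_k z k * (be k * conjc (al k)) != 0].
Proof.
move=> S1 [Sz a0 az [z01 z12 z20]].
pose A := \sum_k a k.
have A0 : 0 < A.
  by rewrite /A (bigD1 0)//= ltr_pwDl// sumr_ge0// => k _; exact: ltW.
pose c k := a k / A.
have c0 k : 0 < c k by rewrite divr_gt0.
pose z0 := z 0; pose z1 := z 1; pose z2 := z (inord 2).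
(* The cyclic differences make the sums of [b k] and of [z k * conjc (b k)] vanish, while that of
   [z k * b k] is a Vandermonde product up to a unimodular factor. *)
pose b (k : 'I_4) : R[i] := [:: conjc z2 - conjc z1; conjc z0 - conjc z2;
  conjc z1 - conjc z0; 0]`_k.
have [t t0 tb] : exists2 t : R, 0 < t & forall k, 2 * t * cabs (b k) <= c k.
  have [k|t t0 tP] := @positive_lower_bound R _ (fun k => c k / (2 * (cabs (b k) + 1))).
    by rewrite divr_gt0// mulr_gt0// ltr_wpDl// cabs_ge0.
  exists t => // k; have := tP k.
  have bk : 0 < 2 * (cabs (b k) + 1) by rewrite mulr_gt0// ltr_wpDl// cabs_ge0.
  by rewrite ler_pdivlMr//; lra.
have hsum (F : 'I_4 -> R[i]) : \sum_k F k = F 0 + F 1 + F (inord 2) + F (inord 3).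
  rewrite !big_ord_recl big_ord0 addr0 !addrA.
  by congr (F _ + F _ + F _ + F _); apply: val_inj; rewrite /= ?inordK.
(* Prescribing both [be k * conjc (al k) = t b k] and the total weight [c k] gives a quadratic
   equation for [al k ^+ 2]; the smallness of [t] makes its discriminant nonnegative. *)
have /choice[al alP] : forall k, exists r : R, 0 < r /\
    r ^+ 2 + t ^+ 2 * cabs (b k) ^+ 2 / r ^+ 2 = c k.
  move=> k; pose u := t * cabs (b k).
  have D0 : 0 <= c k ^+ 2 - 4 * u ^+ 2.
    have u0 : 0 <= u by rewrite mulr_ge0 ?cabs_ge0// ltW.
    have := tb k; have := c0 k; rewrite -mulrA -/u; move: (c k) => ck; nra.
  pose D := Num.sqrt (c k ^+ 2 - 4 * u ^+ 2); have DD : D ^+ 2 = c k ^+ 2 - 4 * u ^+ 2.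
    by rewrite sqr_sqrtr.
  have r20 : 0 < (c k + D) / 2 by rewrite divr_gt0// ltr_pwDl// sqrtr_ge0.
  exists (Num.sqrt ((c k + D) / 2)); rewrite sqrtr_gt0; split=> //.
  rewrite sqr_sqrtr ?ltW// -exprMn -/u.
  have -> : u ^+ 2 = (c k ^+ 2 - D ^+ 2) / 4 by rewrite DD; field.
  by field; rewrite gt_eqF//; move: r20; rewrite pmulr_lgt0 ?invr_gt0.
have al0 k : (al k)%:C != 0.
  by apply/eqP => -[alk]; have [] := alP k; rewrite alk ltxx.
pose be k := (t / al k)%:C * b k.
have tal k : (t / al k)%:C * (al k)%:C = t%:C.
  by rewrite -rmorphM/= divfK//; apply: contra_neq (al0 k) => ->.
have beal k : be k * conjc (al k)%:C = t%:C * b k.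
  by rewrite conjc_real /be -(tal k); ring.
have albe k : (al k)%:C * conjc (be k) = t%:C * conjc (b k).
  have -> : conjc (be k) = conjc (t / al k)%:C * conjc (b k) by rewrite -rmorphM.
  by rewrite conjc_real -(tal k); ring.
have sq k : (al k)%:C * conjc (al k)%:C + be k * conjc (be k) = (c k)%:C.
  have [_ <-] := alP k; rewrite !mulJc cabs_real /be cabsM cabs_real -rmorphD.
  congr _%:C; rewrite exprMn !real_normK ?num_real// expr_div_n.
  by rewrite mulrAC.
have b3 : b (inord 3) = 0 by rewrite /b inordK.
have b2 : b (inord 2) = conjc z1 - conjc z0 by rewrite /b inordK.
have zJ k : conjc (z k) = (z k)^-1.
  have zn0 : z k != 0 by rewrite -cabs_eq0 S1// oner_eq0.
  by apply: (mulfI zn0); rewrite mulJc S1// expr1n divff.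
have zn0 k : z k != 0 by rewrite -cabs_eq0 S1// oner_eq0.
exists (fun k => (al k)%:C), be; split.
- rewrite (eq_bigr (fun k => (c k)%:C)) => [|k _]; last exact: sq.
  by rewrite -rmorph_sum/= -mulr_suml -/A divff ?gt_eqF.
- rewrite (eq_bigr (fun k => t%:C * b k)) => [|k _]; last exact: beal.
  by rewrite -mulr_sumr hsum b3 b2 /b /=; ring.
- rewrite (eq_bigr (fun k => A^-1%:C * ((a k)%:C * z k))) => [|k _].
    by rewrite -mulr_sumr az mulr0.
  by rewrite sq /c rmorphM/=; ring.
- rewrite (eq_bigr (fun k => t%:C * (z k * conjc (b k)))) => [|k _]; last first.
    by rewrite albe; ring.
  rewrite -mulr_sumr hsum b3 conjc0 b2 /b /= !rmorphB/= !conjcK -/z0 -/z1 -/z2.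
  by ring.
- rewrite (eq_bigr (fun k => t%:C * (z k * b k))) => [|k _]; last first.
    by rewrite beal; ring.
  rewrite -mulr_sumr mulf_neq0//; first by apply/eqP => -[t0']; rewrite t0' ltxx in t0.
  rewrite hsum b3 b2 /b /= /z0 /z1 /z2 !zJ.
  rewrite (_ : _ + _ = - ((z 0 - z 1) * (z 1 - z (inord 2)) * (z (inord 2) - z 0)) /
      (z 0 * z 1 * z (inord 2))).
    by rewrite mulf_neq0 ?invr_neq0 ?oppr_eq0 ?mulf_neq0 ?zn0// subr_eq0.
  by field; rewrite !zn0.
Qed.

End HalfPlane.

(** * Compressions close to a weighted shift *)

Section ClosedSpan.
Variables (R : realType) (H : hilbertType R).
Implicit Types (x y : H) (f : nat -> H) (u : nat -> H).

Definition tends u x := forall e : R, 0 < e ->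
  exists N, forall n, (N <= n)%N -> nm (u n - x) < e.

Lemma tends_unique u x y : tends u x -> tends u y -> x = y.
Proof.
move=> ux uy; apply/eqP; rewrite -subr_eq0 -nm_eq0 eq_le nm_ge0 andbT.
apply/ler_addgt0Pr => e e0; rewrite add0r.
have e20 : 0 < e / 2 by rewrite divr_gt0.
have [N Nx] := ux _ e20; have [M My] := uy _ e20.
have := Nx _ (leq_maxl N M); have := My _ (leq_maxr N M).
have -> : x - y = (u (maxn N M) - y) - (u (maxn N M) - x).
  by rewrite opprB [RHS]addrC addrA subrK.
have := nmBD (u (maxn N M) - y) (u (maxn N M) - x); lra.
Qed.

Lemma tends_eventually u x N : (forall n, (N <= n)%N -> u n = x) -> tends u x.
Proof. by move=> ux e e0; exists N => n /ux ->; rewrite subrr nm0. Qed.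

Lemma nm_orthonormal_sum n (v : 'I_n -> H) (c : 'I_n -> R[i]) : orthonormal v ->
  nm (\sum_k c k *: v k) ^+ 2 = \sum_k cabs (c k) ^+ 2.
Proof.
move=> hv; rewrite nm_sqr inner_suml Re_sum; apply: eq_bigr => k _.
rewrite inner_sumr (bigD1 k)//= big1 ?addr0 => [|j jk].
  by rewrite innerZl innerZr hv eqxx mulr1 mulJc.
by rewrite innerZl innerZr hv eq_sym (negbTE jk) !mulr0.
Qed.

(** By Pythagoras the squared norms of the partial sums increase and control their differences; they
    are bounded by that of [x], so the partial sums converge. *)
Lemma closed_span_projection f :
  (forall m n, inner (f m) (f n) = (m == n)%:R) ->
  exists P : bounded_op H, [/\ projection P, forall n, P (f n) = f n &
    forall x, tends (fun n => \sum_(k < n) inner x (f k) *: f k) (P x)].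
Proof.
move=> hf; have ho n : orthonormal (fun k : 'I_n => f k) by move=> j k; rewrite hf.
pose s n : bounded_op H := span_proj (fun k : 'I_n => f k).
have sE n x : s n x = \sum_(k < n) inner x (f k) *: f k by rewrite span_projE.
have sP n : projection (s n) := span_projP (ho n).
have ss m n x : (n <= m)%N -> s n (s m x) = s n x.
  move=> nm'; rewrite !sE; apply: eq_bigr => k _; congr (_ *: _).
  have -> : \sum_(j < m) inner x (f j) *: f j = s m x by rewrite sE.
  exact: (inner_span_proj x (widen_ord nm' k) (ho m)).
have sf k n : (k < n)%N -> s n (f k) = f k.
  by move=> kn; exact: (span_proj_id (Ordinal kn) (ho n)).
have diff m n x : (n <= m)%N ->
    nm (s m x - s n x) ^+ 2 = nm (s m x) ^+ 2 - nm (s n x) ^+ 2.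
  by move=> nm'; rewrite (proj_pythagoras (s m x) (sP n)) ss// [RHS]addrC addKr.
have cv x : exists l, tends (fun n => s n x) l.
  pose X := range (fun n => nm (s n x) ^+ 2).
  have Xsup : has_sup X.
    split; first by exists (nm (s 0 x) ^+ 2), 0.
    exists (nm x ^+ 2) => _ [n _ <-].
    by rewrite ler_pXn2r ?nnegrE ?nm_ge0// proj_le.
  apply: cauchy_limit => e e0.
  have [_ [N _ <-] Ne] := sup_adherent (exprn_gt0 2 e0) Xsup.
  have near_N m n : (N <= n)%N -> (n <= m)%N -> nm (s m x - s n x) < e.
    move=> Nn nm'; rewrite -(ltr_pXn2r (n := 2)) ?nnegrE ?nm_ge0 ?ltW//.
    rewrite diff//.
    have h1 : nm (s m x) ^+ 2 <= sup X by apply: ub_le_sup; [case: Xsup|exists m].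
    have h2 : 0 <= nm (s n x) ^+ 2 - nm (s N x) ^+ 2 by rewrite -diff// sqr_ge0.
    by move: Ne; lra.
  exists N => m n Nm Nn; have [mn|/ltnW nm'] := leqP m n; last exact: near_N.
  by rewrite nmB near_N.
have /choice[g gP] := cv.
have [a x y|x|P PE] := @bounded_op_build R H g 1.
- apply: (tends_unique (gP _)) => e e0.
  have ca0 : 0 < cabs a + 1 by rewrite ltr_wpDl ?cabs_ge0.
  have [N1 h1] := gP x _ (divr_gt0 (divr_gt0 e0 (ltr0n R 2)) ca0).
  have [N2 h2] := gP y _ (divr_gt0 e0 (ltr0n R 2)).
  exists (maxn N1 N2) => n; rewrite geq_max => /andP[/h1 {}h1 /h2 {}h2].
  rewrite opxD opxZ opprD addrACA -scalerBr; apply: le_lt_trans (nmD _ _) _.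
  rewrite nmZ; move: h1; rewrite ltr_pdivlMr// => h1.
  by have := nm_ge0 (s n x - g x); lra.
- rewrite mul1r; apply/ler_addgt0Pr => e e0; have [N h] := gP x _ e0.
  have := h N (leqnn N); have := nmB_ge (g x) (s N x); have := proj_le x (sP N).
  by rewrite (nmB (g x)); lra.
have Pt x : tends (fun n => s n x) (P x) by rewrite PE.
have Pf k : P (f k) = f k.
  apply: (tends_unique (Pt _)); apply: (tends_eventually (N := k.+1)) => n; exact: sf.
have hP : self_adjoint P.
  move=> x y; apply/eqP; rewrite -subr_eq0 -cabs_eq0 eq_le cabs_ge0 andbT.
  apply/ler_addgt0Pr => e e0; rewrite add0r.
  have c0 : 0 < nm x + nm y + 1 by rewrite ltr_wpDl// addr_ge0 ?nm_ge0.
  have [N1 h1] := Pt x _ (divr_gt0 e0 c0); have [N2 h2] := Pt y _ (divr_gt0 e0 c0).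
  have {}h1 := h1 _ (leq_maxl N1 N2); have {}h2 := h2 _ (leq_maxr N1 N2).
  move: (maxn N1 N2) h1 h2 => n h1 h2; have [_ hs] := sP n.
  have -> : inner (P x) y - inner x (P y) =
      inner x (s n y - P y) - inner (s n x - P x) y.
    by rewrite innerBr innerBl hs; ring.
  apply: le_trans (cabsD _ _) _; rewrite cabsN.
  have := cauchy_schwarz x (s n y - P y); have := cauchy_schwarz (s n x - P x) y.
  move: h1 h2; rewrite !ltr_pdivlMr// => h1 h2.
  have := nm_ge0 x; have := nm_ge0 y.
  have := nm_ge0 (s n y - P y); have := nm_ge0 (s n x - P x).
  move: (nm x) (nm y) (nm _) (nm _) (cabs _) (cabs _) h1 h2 => p q r t u v; nra.
exists P; split=> // [|x]; last first.
  by move=> e e0; have [N h] := Pt x e e0; exists N => n; rewrite -sE; exact: h.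
split=> //; apply: bounded_op_inj => x; rewrite opM.
apply: (tends_unique (Pt _)); move=> e e0; have [N h] := Pt x e e0.
exists N => n Nn; rewrite (_ : s n (P x) = s n x); first exact: h.
by rewrite !sE; apply: eq_bigr => k _; rewrite hP Pf.
Qed.

End ClosedSpan.

Section ShiftCompression.
Variables (R : realType) (H : hilbertType R).
Implicit Types (x y : H) (P U V : bounded_op H).

Definition comb (E : 'I_4 -> nat -> H) (a b : 'I_4 -> R[i]) n : H :=
  \sum_k (a k *: E k n + b k *: E k n.+1).

Lemma inner_comb E a b a' b' m n :
  (forall j k m n, inner (E j m) (E k n) = ((j == k) && (m == n))%:R) ->
  inner (comb E a b m) (comb E a' b' n) =
    (m == n)%:R * \sum_k (a k * conjc (a' k) + b k * conjc (b' k)) +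
    (m.+1 == n)%:R * \sum_k b k * conjc (a' k) +
    (m == n.+1)%:R * \sum_k a k * conjc (b' k).
Proof.
move=> hE; rewrite /comb inner_suml !mulr_sumr -!big_split/=; apply: eq_bigr => j _.
rewrite inner_sumr (bigD1 j)//= big1 => [|k kj].
  rewrite !innerDl !innerDr !innerZl !innerZr !hE !eqxx eqSS /=; ring.
by rewrite !innerDl !innerDr !innerZl !innerZr !hE eq_sym (negbTE kj) !mulr0 !addr0.
Qed.

Lemma geometric_sum (e : R) N : 0 <= e -> \sum_(k < N) e / 2 ^+ k <= 2 * e.
Proof.
move=> e0; suff -> : \sum_(k < N) e / 2 ^+ k = 2 * e - 2 * e / 2 ^+ N.
  by rewrite gerBl divr_ge0 ?mulr_ge0 ?exprn_ge0.
elim: N => [|N IH]; first by rewrite big_ord0 expr0 divr1 subrr.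
rewrite big_ord_recr/= IH exprS; field.
by rewrite expf_neq0 ?pnatr_eq0.
Qed.

(* An orthonormal sequence [f] on which the compression of [U] is close to the
   multiple [c] of the unilateral shift. *)
Lemma shift_like_sequence U (z : 'I_4 -> R[i]) (al be : 'I_4 -> R[i]) (eta : R) :
  (forall k, ess_approx U (z k)) -> 0 < eta ->
  \sum_k (al k * conjc (al k) + be k * conjc (be k)) = 1 ->
  \sum_k be k * conjc (al k) = 0 ->
  \sum_k z k * (al k * conjc (al k) + be k * conjc (be k)) = 0 ->
  \sum_k z k * (al k * conjc (be k)) = 0 ->
  exists f h : nat -> H, [/\ forall m n, inner (f m) (f n) = (m == n)%:R,
    forall m n, inner (h m) (f n) =
      (m.+1 == n)%:R * \sum_k z k * (be k * conjc (al k)) &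
    forall n, nm (U (f n) - h n) <= eta / 2 ^+ n].
Proof.
move=> zU eta0 s1 s2 s3 s4.
(* The index modulo [4] selects the eigenvalue, so one orthonormal sequence interleaves four. Each
   [f n] has eight terms, whence the tolerance [eta / 8]. *)
have z4 n : (n %% 4 < 4)%N by rewrite ltn_mod.
have eta80 : 0 < eta / 8 by rewrite divr_gt0.
have [n s|g gg gU] := @orthonormal_sequence _ H (fun n x =>
    nm (U x - z (Ordinal (z4 n)) *: x) <= eta / 8 / 2 ^+ n).
  have en : 0 < eta / 8 / 2 ^+ n by rewrite divr_gt0// exprn_gt0.
  by have [//|x [x1 xs Ux]] := zU (Ordinal (z4 n)) s _ _ en; exists x.
pose E (k : 'I_4) n := g (n * 4 + k)%N.
have hE j k m n : inner (E j m) (E k n) = ((j == k) && (m == n))%:R.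
  rewrite /E gg; congr (_%:R); congr (nat_of_bool _).
  apply/eqP/andP => [h|[/eqP-> /eqP->]//].
  have jk : (j : nat) = k.
    by have := congr1 (modn^~ 4) h; rewrite !modnMDl !modn_small.
  by split; [exact/eqP/val_inj|move: h; rewrite jk => /addIn/eqP; rewrite eqn_pmul2r].
have EU k n : nm (U (E k n) - z k *: E k n) <= eta / 8 / 2 ^+ n.
  have := gU (n * 4 + k)%N; rewrite (_ : Ordinal _ = k); last first.
    by apply: val_inj; rewrite /= modnMDl modn_small.
  move=> /le_trans; apply; rewrite ler_wpM2l ?(ltW eta80)//.
  rewrite lef_pV2 ?posrE ?exprn_gt0// ler_eXn2l ?ltr1n//.
  by rewrite (leq_trans _ (leq_addr _ _))// leq_pmulr.
have s1' k : cabs (al k) <= 1 /\ cabs (be k) <= 1.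
  have S : \sum_k (cabs (al k) ^+ 2 + cabs (be k) ^+ 2) = 1 :> R.
    rewrite -[RHS]/(cre (1 : R[i])) -s1 Re_sum.
    by apply: eq_bigr => j _; rewrite !mulJc.
  have le1 : cabs (al k) ^+ 2 + cabs (be k) ^+ 2 <= 1.
    rewrite -S (bigD1 k)//= lerDl sumr_ge0// => j _.
    by rewrite addr_ge0// sqr_ge0.
  have := sqr_ge0 (cabs (al k)); have := sqr_ge0 (cabs (be k)).
  by split; rewrite -(ler_pXn2r (n := 2)) ?nnegrE ?cabs_ge0// expr1n; lra.
have s2' : \sum_k al k * conjc (be k) = 0.
  transitivity (conjc (\sum_k be k * conjc (al k))); last by rewrite s2 conjc0.
  by rewrite rmorph_sum; apply: eq_bigr => k _; rewrite rmorphM /= conjcK mulrC.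
exists (comb E al be), (comb E (fun k => z k * al k) (fun k => z k * be k)).
split=> [m n|m n|n].
- by rewrite inner_comb// s1 s2 s2' !mulr0 !addr0 mulr1.
- rewrite inner_comb//.
  rewrite (eq_bigr (fun k => z k * (al k * conjc (al k) + be k * conjc (be k)))); last first.
    by move=> k _; ring.
  rewrite s3 mulr0 add0r.
  rewrite [X in _ + _ * X](eq_bigr (fun k => z k * (al k * conjc (be k)))); last first.
    by move=> k _; ring.
  rewrite s4 mulr0 addr0; congr (_ * _); apply: eq_bigr => k _; ring.
- have -> : U (comb E al be n) - comb E (fun k => z k * al k) (fun k => z k * be k) n =
      \sum_k (al k *: (U (E k n) - z k *: E k n) +
              be k *: (U (E k n.+1) - z k *: E k n.+1)).
    rewrite /comb opx_sum -sumrB; apply: eq_bigr => k _.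
    rewrite opxD !opxZ !scalerBr !scalerA ![z k * _]mulrC opprD addrACA.
    by [].
  apply: le_trans (nm_sum _ _ _) _.
  have -> : eta / 2 ^+ n = \sum_(k < 4) eta / 4 / 2 ^+ n.
    by rewrite sumr_const card_ord -[RHS]mulr_natl; field; rewrite expf_neq0 ?pnatr_eq0.
  apply: ler_sum => k _; apply: le_trans (nmD _ _) _; rewrite !nmZ.
  have [a1 b1] := s1' k.
  have h1 : cabs (al k) * nm (U (E k n) - z k *: E k n) <= eta / 8 / 2 ^+ n.
    by rewrite -[leRHS]mul1r ler_pM ?cabs_ge0 ?nm_ge0.
  have h2 : cabs (be k) * nm (U (E k n.+1) - z k *: E k n.+1) <= eta / 8 / 2 ^+ n.
    rewrite -[leRHS]mul1r ler_pM ?cabs_ge0 ?nm_ge0//; apply: le_trans (EU _ _) _.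
    rewrite ler_wpM2l ?(ltW eta80)//.
    by rewrite lef_pV2 ?posrE ?exprn_gt0// ler_eXn2l ?ltr1n.
  have -> : eta / 4 / 2 ^+ n = eta / 8 / 2 ^+ n + eta / 8 / 2 ^+ n.
    by field; rewrite expf_neq0 ?pnatr_eq0.
  exact: lerD.
Qed.

(** On the closed span of [f], [P U] is within [|c| / 4] of [c] times the shift. So it is bounded
    below by [3 |c| / 4], while [P V (f 0)] has norm at most [|c| / 4] because [f 0] is orthogonal
    to the range of the shift. The squared corner norms are thus at most [1 - (3 |c| / 4)^2] and at
    least [1 - (|c| / 4)^2]. *)
Lemma shift_contradiction U V (f h : nat -> H) (c : R[i]) : adjoint_of U V ->
  V * U = 1 -> U * V = 1 -> common_norm U -> c != 0 ->
  (forall m n, inner (f m) (f n) = (m == n)%:R) ->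
  (forall m n, inner (h m) (f n) = (m.+1 == n)%:R * c) ->
  (forall n, nm (U (f n) - h n) <= cabs c / 8 / 2 ^+ n) -> False.
Proof.
move=> UV VU UV1 cU c0 ff hf fh.
have [P [hP Pf Pt]] := closed_span_projection ff.
have cp : 0 < cabs c by rewrite lt_neqAle cabs_ge0 eq_sym cabs_eq0 c0.
pose y x N := \sum_(k < N) inner x (f k) *: f k.
pose w x N := \sum_(k < N) inner x (f k) *: h k.
have f1 k : nm (f k) = 1.
  by apply/eqP; rewrite -(eqrXn2 (n := 2)) ?nm_ge0// nm_sqr ff eqxx expr1n.
(* The geometric tolerances add up to at most [2 (|c| / 8)], whatever [N] is. *)
have Uy x N : nm (U (y x N) - w x N) <= cabs c / 4 * nm x.
  have -> : U (y x N) - w x N = \sum_(k < N) inner x (f k) *: (U (f k) - h k).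
    by rewrite /y opx_sum -sumrB; apply: eq_bigr => k _; rewrite opxZ scalerBr.
  apply: le_trans (nm_sum _ _ _) _.
  apply: (@le_trans _ _ (nm x * \sum_(k < N) cabs c / 8 / 2 ^+ k)).
    rewrite mulr_sumr; apply: ler_sum => k _; rewrite nmZ ler_pM ?cabs_ge0 ?nm_ge0//.
    by apply: le_trans (cauchy_schwarz _ _) _; rewrite f1 mulr1.
  rewrite mulrC ler_wpM2r ?nm_ge0//; apply: le_trans (geometric_sum _ _) _; last lra.
  by rewrite divr_ge0 ?cabs_ge0.
have Ph k : P (h k) = c *: f k.+1.
  apply: (tends_unique (Pt _)); apply: (tends_eventually (N := k.+2)) => n kn.
  rewrite (bigD1 (Ordinal kn))//= big1 => [|j jk]; first by rewrite hf eqxx mul1r addr0.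
  rewrite hf eq_sym (_ : (j == k.+1 :> nat) = false) ?mul0r ?scale0r//.
  by apply: contraNF jk => /eqP jk; apply/eqP/val_inj.
have Pw x N : nm (P (w x N)) = cabs c * nm (y x N).
  have -> : P (w x N) = c *: \sum_(k < N) inner x (f k) *: f k.+1.
    rewrite opx_sum scaler_sumr; apply: eq_bigr => k _.
    by rewrite opxZ Ph !scalerA mulrC.
  rewrite nmZ; congr (_ * _); apply/eqP; rewrite -(eqrXn2 (n := 2)) ?nm_ge0//.
  rewrite /y (nm_orthonormal_sum (v := fun k : 'I_N => f k.+1)) => [|j k].
    by rewrite (nm_orthonormal_sum (v := fun k : 'I_N => f k)) => [|j k]; rewrite ?ff.
  by rewrite ff eqSS.
have Un x : nm (U x) = nm x := unitary_nm x UV VU.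
have low x : P x = x -> 3 / 4 * cabs c * nm x <= nm (P (U x)).
  move=> Px; apply/ler_addgt0Pr => e e0.
  have c10 : 0 < cabs c + 1 by rewrite ltr_wpDl ?cabs_ge0.
  have [N hN] := Pt x _ (divr_gt0 e0 c10); have {hN} := hN N (leqnn N).
  rewrite Px -/(y x N) ltr_pdivlMr// => hN.
  have h1 := nmB_ge (P (w x N)) (P (w x N) - P (U x)); rewrite subKr Pw in h1.
  have h2 : nm (P (w x N) - P (U x)) <= cabs c / 4 * nm x + nm (y x N - x).
    rewrite -opxB; apply: le_trans (proj_le _ hP) _.
    have -> : w x N - U x = U (y x N - x) - (U (y x N) - w x N).
      by rewrite opxB opprB [RHS]addrC addrA subrK.
    by apply: le_trans (nmBD _ _) _; rewrite Un addrC lerD2r.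
  have h3 := nmB_ge x (x - y x N); rewrite subKr (nmB x) in h3.
  have := ler_wpM2l (cabs_ge0 c) h3; lra.
have high : nm (P (V (f 0))) <= cabs c / 4.
  set v := P (V (f 0)); have Pv : P v = v by exact: projK.
  have v2 : nm v ^+ 2 = cre (inner (U v) (f 0)) by rewrite nm_sqr proj_inner// UV.
  have [->|v0] := eqVneq v 0; first by rewrite nm0 divr_ge0 ?cabs_ge0.
  have nv0 : 0 < nm v by rewrite nm_gt0.
  rewrite -(ler_pM2r nv0) -expr2 v2; apply/ler_addgt0Pr => e e0.
  have [N hN] := Pt v _ e0; have {hN} := hN N (leqnn N); rewrite Pv -/(y v N) => hN.
  have -> : inner (U v) (f 0) = inner (U v - w v N) (f 0).
    rewrite innerBl [inner (w v N) _]inner_suml big1 ?subr0// => k _.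
    by rewrite innerZl hf mul0r mulr0.
  apply: le_trans (ler_norm _) (le_trans (Re_inner_le _ _) _); rewrite f1 mulr1.
  have -> : U v - w v N = (U (y v N) - w v N) - U (y v N - v).
    by rewrite opxB opprB [RHS]addrC addrA subrK.
  apply: le_trans (nmBD _ _) _; rewrite Un; have := Uy v N; lra.
have := cU P hP; rewrite (opnorm_adjoint (adjoint_corner hP UV)) => qE.
have f0P : P (f 0) = f 0 by exact: Pf.
have c34 : 0 <= 3 / 4 * cabs c by rewrite !mulr_ge0 ?invr_ge0 ?cabs_ge0.
have h0 : (3 / 4 * cabs c) ^+ 2 <= 1.
  have low0 := low _ f0P; rewrite f1 mulr1 in low0.
  rewrite expr_le1//; apply: le_trans low0 _.
  by apply: le_trans (proj_le _ hP) _; rewrite Un f1.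
have h1 : opnorm ((1 - P) * U * P) ^+ 2 <= 1 - (3 / 4 * cabs c) ^+ 2.
  have r0 : 0 <= 1 - (3 / 4 * cabs c) ^+ 2 by rewrite subr_ge0.
  rewrite -[leRHS](sqr_sqrtr r0) ler_pXn2r ?nnegrE ?opnorm_ge0 ?sqrtr_ge0//.
  apply: opnorm_le => [|x]; first exact: sqrtr_ge0.
  rewrite -(ler_pXn2r (n := 2)) ?nnegrE ?mulr_ge0 ?nm_ge0 ?sqrtr_ge0//.
  rewrite exprMn sqr_sqrtr// !opM opB op1.
  have := proj_pythagoras (U (P x)) hP; rewrite Un.
  have : (3 / 4 * cabs c * nm (P x)) ^+ 2 <= nm (P (U (P x))) ^+ 2.
    by rewrite ler_pXn2r ?nnegrE ?nm_ge0 ?(mulr_ge0 c34) ?nm_ge0// low// projK.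
  have : nm (P x) ^+ 2 <= nm x ^+ 2 by rewrite ler_pXn2r ?nnegrE ?nm_ge0// proj_le.
  move=> /(ler_wpM2l r0); rewrite exprMn; lra.
have h2 : 1 - (cabs c / 4) ^+ 2 <= opnorm ((1 - P) * V * P) ^+ 2.
  have := proj_pythagoras (V (f 0)) hP.
  rewrite (unitary_nm _ (adjoint_sym UV) UV1) f1 expr1n => pyth.
  have : nm (P (V (f 0))) ^+ 2 <= (cabs c / 4) ^+ 2.
    by rewrite ler_pXn2r ?nnegrE ?nm_ge0 ?divr_ge0 ?cabs_ge0.
  have : nm (V (f 0) - P (V (f 0))) ^+ 2 <= opnorm ((1 - P) * V * P) ^+ 2.
    rewrite ler_pXn2r ?nnegrE ?nm_ge0 ?opnorm_ge0//.
    by have := opnorm_ub ((1 - P) * V * P) (f 0); rewrite !opM f0P f1 mulr1.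
  by lra.
have := exprn_gt0 2 cp; move: h1 h2; rewrite qE => h1 h2; lra.
Qed.

End ShiftCompression.

Section UnitaryRotation.
Variables (R : realType) (H : hilbertType R).
Implicit Types (U V : bounded_op H) (w z : R[i]).

Lemma ess_approx_unitary_circle U V z : adjoint_of U V -> V * U = 1 ->
  ess_approx U z -> cabs z = 1.
Proof.
move=> UV VU zU; apply/eqP; rewrite -subr_eq0 -normr_eq0 eq_le normr_ge0 andbT.
apply/ler_addgt0Pr => e e0; rewrite add0r; have [//|x [x1 _ Ux]] := zU [::] _ _ e0.
have := nmB_ge (U x) (z *: x); have := nmB_ge (z *: x) (U x).
rewrite (nmB (z *: x)) nmZ (unitary_nm x UV VU) x1 mulr1 => h1 h2.
by rewrite ler_norml; apply/andP; split; lra.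
Qed.

Lemma unitaryZ w U : cabs w = 1 -> unitary U -> unitary (w *: U).
Proof.
move=> w1 [V [UV VU UV1]]; exists (conjc w *: V).
have ww : w * conjc w = 1 by rewrite mulJc w1 expr1n.
split; first exact: adjointZ.
- apply: bounded_op_inj => x; rewrite opM !opZ opxZ scalerA mulrC ww scale1r.
  by rewrite -opM VU.
- apply: bounded_op_inj => x; rewrite opM !opZ opxZ scalerA ww scale1r.
  by rewrite -opM UV1.
Qed.

Lemma ess_spectrum_rotate U w z : unitary U -> cabs w = 1 ->
  ess_spectrum (w *: U) z -> ess_approx U (conjc w * z).
Proof.
move=> hU w1 zU; have [V [UV VU UV1]] := unitaryZ w1 hU.
have := approx_null_spectrum UV (etrans UV1 (esym VU)) zU.
apply: approx_nullW => x.
have -> : (w *: U) x - z *: x = w *: (U x - (conjc w * z) *: x).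
  by rewrite opZ scalerBr scalerA mulrA mulJc w1 expr1n mul1r.
by rewrite nmZ w1 mul1r.
Qed.

(** If every rotation fails, each open half-plane bounded by a line through [0] contains an
    essential approximate eigenvalue of [U]. *)
Lemma common_norm_unitary_rotation U : unitary U -> common_norm U ->
  exists2 w : R[i], cabs w = 1 & ess_spectrum (w *: U) `<=`
    [set z : R[i] | `|z| = 1] `&` [set z | 0 <= cre z].
Proof.
move=> hU cU; have [V [UV VU UV1]] := hU; apply: contrapT => h.
pose S := [set z | ess_approx U z].
have S1 z : S z -> cabs z = 1 by exact: ess_approx_unitary_circle.
have [w w1|z [a zaP]] := @positive_relation_exists R S S1.
  apply: contrapT => hw; apply: h; exists w => // z zU.
  have wz := ess_spectrum_rotate hU w1 zU.
  have z1 : cabs z = 1 by have := S1 _ wz; rewrite cabsM cabsJ w1 mul1r.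
  split; first exact/norm1_cabs.
  rewrite /= leNgt; apply/negP => z0; apply: hw; exists (conjc w * z) => //.
  by rewrite mulrA mulJc w1 expr1n mul1r.
have [al [be [s1 s2 s3 s4 c0]]] := shift_coefficients S1 zaP.
have [zS _ _ _] := zaP.
set c := (X in X != 0) in c0.
have eta0 : 0 < cabs c / 8 by rewrite divr_gt0// lt_neqAle cabs_ge0 eq_sym cabs_eq0 c0.
have [f [g [ff gf fg]]] := shift_like_sequence zS eta0 s1 s2 s3 s4.
exact: (shift_contradiction UV VU UV1 cU c0 ff gf fg).
Qed.

Lemma common_norm_affine_cases (T : bounded_op H) : common_norm T ->
  (exists (lambda mu : R[i]) L, self_adjoint L /\
     T = lambda *: (1 : bounded_op H) + mu *: L) \/
  (exists (lambda mu : R[i]) U, [/\ mu != 0, unitary U &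
     T = lambda *: (1 : bounded_op H) + mu *: U]).
Proof.
move=> cT; have [V TV] := adjoint_exists T; have TVC := common_norm_normal TV cT.
have [[p p0 pZ]|[A Aunit AZ]] :=
    spanning_or_annihilated [set quad_value z | z in approx_spectrum T].
  have pT : pencil T V p = 0.
    by apply: pencil_annihilated => // z zT; apply: pZ; exists z.
  have pE : p = \row_k [:: p 0 0; p 0 1; p 0 (inord 2); p 0 (inord 3)]`_k.
    apply/rowP => -[[|[|[|[|//]]]] kP]; rewrite mxE /=; congr (p _ _);
      by apply: val_inj; rewrite /= ?inordK.
  apply: (pencil_eq0_affine TV TVC (p0 := p 0 0) (p1 := p 0 1)
      (p2 := p 0 (inord 2)) (p3 := p 0 (inord 3))).
    apply: contraNneq p0 => -[e0 e1 e2 e3]; rewrite pE e0 e1 e2 e3.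
    by apply/eqP/rowP => -[[|[|[|[|//]]]] kP]; rewrite !mxE.
  move=> x; have := congr1 (fun S : bounded_op H => S x) pT.
  by rewrite {1}pE pencil_row.
exfalso; apply: (quad_values_dependent TV cT Aunit) => k.
by have [z zT zE] := AZ k; exists z.
Qed.

End UnitaryRotation.

Theorem theorem4p13 (R : realType) (H : hilbertType R)
    (H_infinite_dimensional : ~ finite_dimensional H)
    (H_separable : separable H) (T : bounded_op H) :
  common_norm T <->
  (exists (lambda mu : R[i]) (L : bounded_op H),
     self_adjoint L /\ T = lambda *: (1 : bounded_op H) + mu *: L)
  \/
  (exists (lambda mu : R[i]) (U : bounded_op H),
     [/\ mu != 0,
         unitary U,
         ess_spectrum U `<=`
           [set z : R[i] | `|z| = 1] `&` [set z | 0 <= complex.Re z]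
       & T = lambda *: (1 : bounded_op H) + mu *: U]).
Proof.
split=> [cT|[[l [m [L [hL ->]]]]|[l [m [U [_ hU sU ->]]]]]].
- have [|[l [m [U [m0 hU TE]]]]] := common_norm_affine_cases cT; first by left.
  right; have cU : common_norm U.
    have -> : U = (- (m^-1 * l)) *: (1 : bounded_op H) + m^-1 *: T.
      apply: bounded_op_inj => x; rewrite TE opD !opZ opD !opZ scalerDr !scalerA.
      by rewrite mulVf// scale1r scaleNr addKr.
    exact: common_norm_affine.
  have [w w1 sU] := common_norm_unitary_rotation hU cU.
  have w0 : w != 0 by rewrite -cabs_eq0 w1 oner_eq0.
  exists l, (m / w), (w *: U); split=> //.
  + by rewrite mulf_neq0 ?invr_neq0.
  + exact: unitaryZ.
  + by rewrite scalerA divfK.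
- exact/common_norm_affine/self_adjoint_common_norm.
- by apply/common_norm_affine/unitary_common_norm => // z /sU[].
Qed.
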